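(* Let $k$ be a field, $n\ge 1$, and let $\mathfrak{g}$ be a finite-dimensional centreless Lie algebra over $k$ (e.g. simple). For $Y_0,\ldots,Y_n\in\mathfrak{g}$ put $$B(Y_0,\ldots,Y_n):=\operatorname{tr}_{\operatorname{End}_k(\mathfrak{g})}\big(\operatorname{ad}(Y_0)\operatorname{ad}(Y_1)\cdots\operatorname{ad}(Y_n)\big).$$ Let $L=\mathfrak{g}[t_1^{\pm},\ldots,t_n^{\pm}]$. Then on all Lie cycles admitting a lift under $I$ (see context), the pullback to $L$ of the Tate extension class $\phi$ is given explicitly by $$\phi\big(Y_0t_1^{c_{0,1}}\cdots t_n^{c_{0,n}}\wedge\cdots\wedge Y_nt_1^{c_{n,1}}\cdots t_n^{c_{n,n}}\big)=(-1)^n\sum_{\pi\in\mathfrak{S}_n}\operatorname{sgn}(\pi)\,B(Y_{\pi(1)},\ldots,Y_{\pi(n)},Y_0)\prod_{i=1}^{n}c_{\pi(i),i}$$ whenever $\sum_{p=0}^n c_{p,i}=0$ for all $i\in\{1,\ldots,n\}$, and zero otherwise. Here $c_{i,p}\in\mathbf{Z}$ for all $i=0,\ldots,n$ and $p=1,\ldots,n$, and integers are read in $k$.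
   Context: Lifts under $I$. $C(L)_r=L\otimes\bigwedge^rL$ is the Chevalley–Eilenberg complex of $L$ with coefficients in the adjoint module, with differential $\delta(f_0\otimes f_1\wedge\cdots\wedge f_r)=\sum_{i=1}^r(-1)^i[f_0,f_i]\otimes f_1\wedge\cdots\widehat{f_i}\cdots\wedge f_r+\sum_{1\le i<j\le r}(-1)^{i+j+1}f_0\otimes[f_i,f_j]\wedge f_1\cdots\widehat{f_i}\cdots\widehat{f_j}\cdots\wedge f_r$. The map $f_0\otimes f_1\wedge\cdots\wedge f_n\mapsto f_0\wedge f_1\wedge\cdots\wedge f_n$ induces $I:H_n(L,L)\to H_{n+1}(L,k)$. The theorem concerns cycles which are the image of a cycle in $C(L)_n$ (the lift); the formula is applied to the terms $f_0\otimes f_1\wedge\cdots\wedge f_n$ of the lift, extended $k$-linearly. Infinite matrix algebras. For an associative $k$-algebra $R$ let $E(R)$ be the algebra of matrices $(\phi_{ij})_{i,j\in\mathbf{Z}}$, $\phi_{ij}\in R$, for which there is $K$ with $\phi_{ij}=0$ whenever $|i-j|>K$. Let $I^{+}(R)$ (resp. $I^{-}(R)$) be the two-sided ideal of those $\phi\in E(R)$ for which there is $B$ with $\phi_{ij}=0$ for all $i<B$ (resp. for all $j>B$); on $I^{0}(R)=I^{+}(R)\cap I^{-}(R)$ (finitely many nonzero entries) let $\operatorname{tr}\phi=\sum_i\phi_{ii}\in R$. Put $A=E^{n}(\operatorname{End}_k(\mathfrak{g}))$ (isomorphic to $E^n(k)$ when $\mathfrak g\ne 0$), $\mathfrak{G}=A_{Lie}$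 ($A$ with the commutator bracket). Let $I_i^{\pm}\subseteq A$ be the ideal obtained by applying $E$ in all places except the $i$-th (counted from the inside), where $I^{\pm}$ is applied. Put $I_i^0=I_i^+\cap I_i^-$, $I_{\operatorname{tr}}=I_1^0\cap\cdots\cap I_n^0$, and let $\tau:I_{\operatorname{tr}}\to k$ be the $n$-fold iterated trace followed by the matrix trace of $\operatorname{End}_k(\mathfrak{g})$. The embedding $L\hookrightarrow\mathfrak{G}$ sends $Yt_1^{c_1}\cdots t_n^{c_n}$ to $\operatorname{ad}(Y)t_1^{c_1}\cdots t_n^{c_n}$, where $t_i$ is the multiplication (shift) operator in the $i$-th place; it is injective since $\mathfrak{g}$ is centreless. The pullback of $\phi$ is along this embedding. The class $\phi$. For a Lie ideal $\mathfrak{j}\subseteq\mathfrak{G}$ let $CE(\mathfrak{j})_0=k$ and, for $r\ge1$, $CE(\mathfrak{j})_r=\mathfrak{j}\wedge\bigwedge^{r-1}\mathfrak{G}\subseteq\bigwedge^r\mathfrak{G}$ (span of all $j\wedge g_1\wedge\cdots\wedge g_{r-1}$, $j\in\mathfrak{j}$), with differential $\delta(f_0\wedge\cdots\wedge f_r)=\sum_{0\le i<j\le r}(-1)^{i+j}[f_i,f_j]\wedge f_0\wedge\cdots\widehat{f_i}\cdots\widehat{f_j}\cdots\wedge f_r$. $CE(\mathfrak{G})_\bullet$ computes $H_\bullet(\mathfrak{G},k)$. For $s\in\{+,-,0\}^n$ put $\deg(s)=1+\#\{i: s_i=0\}$. Let ${}^{\wedge}T^0_\bullet=CE(\mathfrak{G})_\bullet$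 and, for $1\le p\le n+1$, ${}^{\wedge}T^p_\bullet=\bigoplus_{\deg(s)=p}\bigcap_{i=1}^n X_i^{s_i}$, where $X_i^{\pm}=CE(I_i^{\pm})_\bullet$, $X_i^0=CE(I_i^+)_\bullet\cap CE(I_i^-)_\bullet$. Define $\partial:{}^{\wedge}T^{p}\to{}^{\wedge}T^{p-1}$ for $p\ge2$ by $(\partial f)_{s_1\ldots s_n}=\sum_{\{i: s_i=\pm\}}(-1)^{\#\{j>i: s_j=0\}}f_{s_1\ldots0\ldots s_n}$ ($0$ in the $i$-th place), and for $p=1$ by $\partial f=\sum_{s\in\{+,-\}^n}(-1)^{s_1+\cdots+s_n}f_s$, where $(-1)^{\pm}=\pm1$. This is an exact complex of complexes; its bicomplex spectral sequence with $E^1_{p,q}=H_q({}^{\wedge}T^p_\bullet)$ converges to $0$, and $d_{n+1}:E^{n+1}_{n+1,1}\to E^{n+1}_{0,n+1}$ is an isomorphism. Let $\rho_2:H_{n+1}(\mathfrak{G},k)=E^1_{0,n+1}\to E^{n+1}_{0,n+1}$ and $\rho_1:E^{n+1}_{n+1,1}\to E^1_{n+1,1}=I_{\operatorname{tr}}/[I_{\operatorname{tr}},\mathfrak{G}]$ be the edge maps; put $\operatorname{res}_*=\tau\circ\rho_1\circ(d_{n+1})^{-1}\circ\rho_2$. Concretely (this fixes signs), for a cycle $\theta_0$ choose $\theta_i\in{}^{\wedge}T^i_{n+2-i}$ with $\partial\theta_1=\theta_0$, $\partial\theta_{i+1}=\delta\theta_i$ for $1\le i\le n$; then $\operatorname{res}_*[\theta_0]=\tau(\theta_{n+1})$.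 The Tate extension class $\phi=\operatorname{res}^*(1)\in H^{n+1}(\mathfrak{G},k)\cong H_{n+1}(\mathfrak{G},k)^*$ corresponds to $\operatorname{res}_*$, i.e. $\phi(z)=\operatorname{res}_*[z]$ for cycles $z$. *)

(* Defs.v *)
From HB Require Import structures.
From mathcomp Require Import all_boot all_order all_algebra.
From mathcomp Require Import finmap mathcomp_extra boolp classical_sets functions.
From mathcomp Require Import cardinality fsbigop.
From mathcomp Require Import perm ssrAC zify.

(* World: MathComp, with the classical layer of MathComp-Analysis (arbitrary
   functions, quotients by propositional relations, finitely supported sums). *)

Set Implicit Arguments.
Unset Strict Implicit.
Unset Printing Implicit Defensive.

Import GRing.Theory.

Local Open Scope classical_set_scope.
Local Open Scope ring_scope.

Section FinitelySupported.
Variables (k : fieldType) (I : choiceType) (V : lmodType k).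

Definition finite_supp : {pred I -> V} :=
  fun f => `[< finite_set [set i | f i != 0] >].

Lemma finite_supp_closed : submod_closed finite_supp.
Proof.
split; first by apply/asboolP; rewrite (_ : [set _ | _] = set0) // -subset0 => i /=; rewrite eqxx.
move=> a f g /asboolP finf /asboolP fing; apply/asboolP.
have : finite_set ([set i | f i != 0] `|` [set i | g i != 0]) by rewrite finite_setU.
apply: sub_finite_set => i /= fg0; have [fi0|] := eqVneq (f i) 0; last by left.
by right; apply: contra_neq fg0 => gi0; rewrite !fctE fi0 gi0 scaler0 addr0.
Qed.

HB.instance Definition _ :=
  GRing.isSubmodClosed.Build k (I -> V) finite_supp
    finite_supp_closed.
Record fsupp := FSupp { fsval :> I -> V; _ : fsval \in finite_supp }.

HB.instance Definition _ := [isSub for fsval].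
HB.instance Definition _ := [Choice of fsupp by <:].
HB.instance Definition _ := [SubChoice_isSubLmodule of fsupp by <:].

End FinitelySupported.

Section FsuppTheory.
Variables (k : fieldType) (I : choiceType).
Implicit Types V W : lmodType k.

Lemma fsupp_finite V (f : fsupp I V) : finite_set [set i | f i != 0].
Proof. by case: f => f /= /asboolP. Qed.

Lemma fsuppP V (f g : fsupp I V) : f =1 g <-> f = g.
Proof. by split=> [fg|->//]; apply/val_inj/funext. Qed.

Lemma fsuppDE V (f g : fsupp I V) i : (f + g) i = f i + g i.
Proof. by []. Qed.

Lemma fsuppZE V a (f : fsupp I V) i : (a *: f) i = a *: f i.
Proof. by []. Qed.

Lemma fsupp0E V i : (0 : fsupp I V) i = 0.
Proof. by []. Qed.

Lemma fsingle_subproof V (i : I) (v : V) :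
  (fun j => if j == i then v else 0) \in @finite_supp k I V.
Proof.
apply/asboolP; apply: (@sub_finite_set _ _ [set i]); last exact: finite_set1.
by move=> j /=; case: (j =P i) => // _; rewrite eqxx.
Qed.

Definition fsingle V (i : I) (v : V) : fsupp I V := FSupp (fsingle_subproof i v).

Lemma fsingleE V i (v : V) j : fsingle i v j = if j == i then v else 0.
Proof. by []. Qed.

Lemma fsingle_linear V i : linear (@fsingle V i).
Proof.
move=> a u v; apply/fsuppP => j; rewrite fsuppDE fsuppZE !fsingleE.
by case: ifP => // _; rewrite scaler0 addr0.
Qed.

HB.instance Definition _ V i :=
  GRing.isLinear.Build k V (fsupp I V) *:%R (@fsingle V i) (@fsingle_linear V i).

(* The linear map on finitely supported functions assembled from a family of
   linear maps; in particular (V = k) the linear extension from a basis. *)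
Definition fs_sum V W (F : I -> {linear V -> W}) (f : fsupp I V) : W :=
  \sum_(i \in [set: I]) F i (f i).

Lemma fs_sumE V W (F : I -> {linear V -> W}) (f : fsupp I V) (A : {fset I}) :
  (forall i, i \notin A -> f i = 0) -> fs_sum F f = \sum_(i <- A) F i (f i).
Proof. by move=> fA; apply: fsbigTE => i /fA ->; rewrite linear0. Qed.

Lemma fsupp_fset V (f : fsupp I V) :
  exists A : {fset I}, forall i, i \notin A -> f i = 0.
Proof.
exists (fset_set [set i | f i != 0]) => i.
by rewrite in_fset_set ?inE ?mem_setE; [move/negPn/eqP | exact: fsupp_finite].
Qed.

Lemma fs_sum_linear V W (F : I -> {linear V -> W}) : linear (fs_sum F).
Proof.
move=> a f g; have [A fA] := fsupp_fset f; have [B gB] := fsupp_fset g.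
have fAB i : i \notin (A `|` B)%fset -> f i = 0.
  by rewrite in_fsetU negb_or => /andP[/fA].
have gAB i : i \notin (A `|` B)%fset -> g i = 0.
  by rewrite in_fsetU negb_or => /andP[_ /gB].
rewrite (fs_sumE _ fAB) (fs_sumE _ gAB) (@fs_sumE _ _ _ _ (A `|` B)%fset); last first.
  by move=> i iAB; rewrite [LHS](_ : _ = a *: f i + g i)// fAB// gAB// scaler0 addr0.
rewrite scaler_sumr -big_split /=; apply: eq_bigr => i _.
by rewrite [X in F i X](_ : _ = a *: f i + g i)// linearP.
Qed.

HB.instance Definition _ V W F :=
  GRing.isLinear.Build k (fsupp I V) W *:%R (@fs_sum V W F) (@fs_sum_linear V W F).

Lemma fs_sum_single V W (F : I -> {linear V -> W}) i v :
  fs_sum F (fsingle i v) = F i v.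
Proof.
rewrite (@fs_sumE _ _ _ _ [fset i]%fset); last first.
  by move=> j; rewrite fsingleE in_fset1 => /negbTE ->.
by rewrite big_seq_fset1 fsingleE eqxx.
Qed.

Lemma fsupp_sum_single V (f : fsupp I V) :
  exists A : {fset I}, f = \sum_(i <- A) fsingle i (f i).
Proof.
have [A fA] := fsupp_fset f; exists A; apply/fsuppP => j.
have evalE (s : seq I) : (\sum_(i <- s) fsingle i (f i)) j
    = \sum_(i <- s) (fsingle i (f i)) j.
  by elim: s => [|i s ih]; rewrite ?big_nil// !big_cons fsuppDE ih.
rewrite evalE; have [jA|jA] := boolP (j \in A); last first.
  rewrite fA// big_seq big1// => i iA; rewrite fsingleE.
  by case: eqP => // ji; rewrite ji iA in jA.
rewrite (big_fsetD1 j jA) fsingleE eqxx big_seq big1 => [|i]; first by rewrite /= addr0.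
by rewrite in_fsetD1 fsingleE eq_sym => /andP[/negbTE ->].
Qed.

Lemma fsupp_ind V (P : fsupp I V -> Prop) :
  P 0 -> (forall i v f, P f -> P (fsingle i v + f)) -> forall f, P f.
Proof.
move=> P0 PD f; have [A ->] := fsupp_sum_single f.
by elim: (A : seq I) => [|i s ih]; rewrite ?big_nil// big_cons; apply: PD.
Qed.

Lemma fsupp_lin_ext V W (F G : {linear fsupp I V -> W}) :
  (forall i v, F (fsingle i v) = G (fsingle i v)) -> F =1 G.
Proof.
move=> FG; apply: fsupp_ind => [|i v f ih]; first by rewrite !linear0.
by rewrite !linearD ih FG.
Qed.

End FsuppTheory.

Section LinearSpan.
Variables (k : fieldType) (V : lmodType k).

Definition lspan (S : set V) : set V :=
  [set v | exists N (a : 'I_N -> k) (x : 'I_N -> V),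
     (forall i, S (x i)) /\ v = \sum_i a i *: x i].

Lemma sub_lspan S : S `<=` lspan S.
Proof.
move=> v Sv; exists 1%N, (fun=> 1), (fun=> v); split=> //.
by rewrite big_ord1 scale1r.
Qed.

Lemma lspan0 S : lspan S 0.
Proof. by exists 0%N, (fun=> 0), (fun=> 0); split=> [[]|]; rewrite ?big_ord0. Qed.

Lemma lspanP S a u v : lspan S u -> lspan S v -> lspan S (a *: u + v).
Proof.
move=> [N [b [x [Sx ->]]]] [M [c [y [Sy ->]]]].
pose pick T (f : 'I_N -> T) (g : 'I_M -> T) (i : 'I_(N + M)) :=
  match fintype.split i with inl i => f i | inr j => g j end.
exists (N + M)%N, (pick k (fun i => a * b i) c), (pick V x y); split=> [i|].
  by rewrite /pick; case: fintype.split.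
rewrite big_split_ord /= scaler_sumr; congr (_ + _); apply: eq_bigr => i _.
  by rewrite /pick (unsplitK (inl i)) scalerA.
by rewrite /pick (unsplitK (inr i)).
Qed.

Definition in_lspan (S : set V) : {pred V} := fun v => `[< lspan S v >].

Lemma in_lspan_closed S : submod_closed (in_lspan S).
Proof.
split; first by apply/asboolP/lspan0.
by move=> a u v /asboolP Su /asboolP Sv; apply/asboolP/lspanP.
Qed.

HB.instance Definition _ S :=
  GRing.isSubmodClosed.Build k V (in_lspan S) (in_lspan_closed S).

End LinearSpan.

Section QuotientModule.
Local Open Scope quotient_scope.
Variables (k : fieldType) (V : lmodType k) (S : set V).

Definition quotmod : Type := Quotient.quot (in_lspan S : zmodClosed V).

HB.instance Definition _ := GRing.Zmodule.on quotmod.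

Definition qproj (v : V) : quotmod := \pi_(Quotient.quot (in_lspan S)) v.

Lemma qprojP u v : qproj u = qproj v <-> lspan S (u - v).
Proof.
rewrite /qproj; split=> [/eqP|uv]; first by rewrite -Quotient.idealrBE => /asboolP.
by apply/eqP; rewrite -Quotient.idealrBE; apply/asboolP.
Qed.

Lemma qproj0 v : qproj v = 0 <-> lspan S v.
Proof.
have -> : (0 : quotmod) = qproj 0 by rewrite /qproj pi_zeror.
by rewrite qprojP subr0.
Qed.

Definition qrepr (x : quotmod) : V := repr x.

Lemma qreprK x : qproj (qrepr x) = x.
Proof. exact: reprK. Qed.

Lemma qprojD u v : qproj (u + v) = qproj u + qproj v.
Proof. by rewrite /qproj pi_addr. Qed.

Definition quot_scale (a : k) (x : quotmod) : quotmod := qproj (a *: qrepr x).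

Lemma qprojZ a v : qproj (a *: v) = quot_scale a (qproj v).
Proof.
apply/qprojP; rewrite -scalerBr -[_ *: _]addr0; apply: lspanP; last exact: lspan0.
by apply/qprojP; rewrite qreprK.
Qed.

Fact quot_scalerA a b x : quot_scale a (quot_scale b x) = quot_scale (a * b) x.
Proof. by rewrite -[x]qreprK -!qprojZ scalerA. Qed.
Fact quot_scale1r x : quot_scale 1 x = x.
Proof. by rewrite -[x]qreprK -qprojZ scale1r. Qed.
Fact quot_scalerDr a : {morph quot_scale a : x y / x + y}.
Proof. by move=> x y; rewrite -[x]qreprK -[y]qreprK -qprojD -!qprojZ scalerDr qprojD. Qed.
Fact quot_scalerDl x a b : quot_scale (a + b) x = quot_scale a x + quot_scale b x.
Proof. by rewrite -[x]qreprK -!qprojZ scalerDl qprojD. Qed.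

HB.instance Definition _ := GRing.Zmodule_isLmodule.Build k quotmod
  quot_scalerA quot_scale1r quot_scalerDr quot_scalerDl.

Fact qproj_linear : linear qproj.
Proof. by move=> a u v; rewrite qprojD qprojZ. Qed.

HB.instance Definition _ :=
  GRing.isLinear.Build k V quotmod *:%R qproj qproj_linear.

End QuotientModule.

Section ScaleVector.
Variables (k : fieldType) (W : lmodType k) (w : W).

Definition scalev (a : k^o) : W := a *: w.

Fact scalev_linear : linear scalev.
Proof. by move=> a b c; rewrite /scalev scalerDl scalerA. Qed.

HB.instance Definition _ :=
  GRing.isLinear.Build k k^o W *:%R scalev scalev_linear.

End ScaleVector.

Section Presented.
Variables (k : fieldType) (I : choiceType) (R : set (fsupp I (k^o : lmodType k))).

(* The k-module with generators I and relators R. *)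
Definition presented : Type := quotmod R.
HB.instance Definition _ := GRing.Lmodule.on presented.

Definition pgen (i : I) : presented := qproj R (fsingle i (1 : k^o)).

Section Lift.
Variables (W : lmodType k) (f : I -> W).

Definition free_lift : {linear fsupp I (k^o : lmodType k) -> W} :=
  fs_sum (fun i => scalev (f i)).

Definition respects := forall r, R r -> free_lift r = 0.

Definition plift (Rf : respects) (x : presented) : W := free_lift (qrepr x).

Variable Rf : respects.

Lemma plift_proj r : plift Rf (qproj R r) = free_lift r.
Proof.
apply/eqP; rewrite -subr_eq0 -linearB; apply/eqP.
have : lspan R (qrepr (qproj R r) - r) by apply/qprojP; rewrite qreprK.
move=> [N [a [x [Rx ->]]]]; rewrite linear_sum big1// => i _.
by rewrite linearZ /= Rf// scaler0.
Qed.

Lemma plift_linear : linear (plift Rf).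
Proof.
move=> a x y; rewrite -[x]qreprK -[y]qreprK -linearP !plift_proj.
exact: linearP.
Qed.

HB.instance Definition _ :=
  GRing.isLinear.Build k presented W *:%R (plift Rf) plift_linear.

Lemma free_lift_single i a : free_lift (fsingle i (a : k^o)) = a *: f i.
Proof. exact: fs_sum_single. Qed.

Lemma plift_gen i : plift Rf (pgen i) = f i.
Proof. by rewrite plift_proj free_lift_single scale1r. Qed.

End Lift.

Lemma qproj_single i a : qproj R (fsingle i (a : k^o)) = a *: pgen i.
Proof.
rewrite -linearZ; congr qproj; apply/fsuppP => j; rewrite fsuppZE !fsingleE.
by case: ifP => _; rewrite ?scaler0// /GRing.scale/= mulr1.
Qed.

Lemma presented_ext (W : lmodType k) (F G : {linear presented -> W}) :
  (forall i, F (pgen i) = G (pgen i)) -> F =1 G.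
Proof.
move=> FG x; rewrite -[x]qreprK; move: (qrepr x).
apply: fsupp_ind => [|i v f ih].
  by rewrite (_ : qproj R 0 = 0) ?linear0//; apply: (linear0 (qproj R)).
have -> : qproj R (fsingle i v + f) = v *: pgen i + (qproj R f : presented).
  by rewrite -qproj_single; apply: (linearD (qproj R)).
by rewrite !linearP ih FG.
Qed.

End Presented.

Section Tensor.
Variables (k : fieldType) (V W : lmodType k).

Local Notation pure v w := (fsingle (v, w) (1 : k^o)).

Definition tens_rel : set (fsupp (V * W)%type (k^o : lmodType k)) :=
  [set r |
     (exists a x y w, r = pure (a *: x + y) w - (a *: pure x w + pure y w)) \/
     (exists a v x y, r = pure v (a *: x + y) - (a *: pure v x + pure v y))].

Definition tens : Type := presented tens_rel.
HB.instance Definition _ := GRing.Lmodule.on tens.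

Definition tensor (v : V) (w : W) : tens := pgen tens_rel (v, w).

Lemma tensorPl a x y w : tensor (a *: x + y) w = a *: tensor x w + tensor y w.
Proof.
rewrite /tensor /pgen -linearP; apply/qprojP/sub_lspan; left.
by exists a, x, y, w.
Qed.

Lemma tensorPr a v x y : tensor v (a *: x + y) = a *: tensor v x + tensor v y.
Proof.
rewrite /tensor /pgen -linearP; apply/qprojP/sub_lspan; right.
by exists a, v, x, y.
Qed.

Section Lift.
Variables (U : lmodType k) (f : V -> W -> U).

Definition bilin :=
  (forall a x y w, f (a *: x + y) w = a *: f x w + f y w) /\
  (forall a v x y, f v (a *: x + y) = a *: f v x + f v y).

Lemma bilin_respects : bilin -> respects tens_rel (fun p => f p.1 p.2).
Proof.
move=> [fl fr] r [] [a [x [y [w ->]]]]; rewrite linearB linearP !free_lift_single.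
  by rewrite !scale1r /= fl subrr.
by rewrite !scale1r /= fr subrr.
Qed.

Definition tlift (fP : bilin) : {linear tens -> U} :=
  plift (bilin_respects fP).

Lemma tliftE (fP : bilin) v w : tlift fP (tensor v w) = f v w.
Proof. exact: plift_gen. Qed.

End Lift.
End Tensor.

HB.instance Definition _ (k : fieldType) (V W : lmodType k) (v : V) :=
  GRing.isLinear.Build k W (tens V W) *:%R (tensor v) (fun a => tensorPr a v).

Section Exterior.
Variables (k : fieldType) (V : lmodType k).

Local Notation word s := (fsingle s (1 : k^o)).

(* The whole exterior algebra T(V)/(x (x) x) of V is used as one module; its part
   of degree r is the span of the [wedge s] with [size s = r], so that wedges of
   different degrees live in one type and no dependent index is needed. *)
Definition ext_rel : set (fsupp (seq V) (k^o : lmodType k)) :=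
  [set r |
     (exists s1 s2 a x y, r = word (s1 ++ (a *: x + y) :: s2)
                          - (a *: word (s1 ++ x :: s2) + word (s1 ++ y :: s2))) \/
     (exists s1 s2 x, r = word (s1 ++ x :: x :: s2))].

Definition ext : Type := presented ext_rel.
HB.instance Definition _ := GRing.Lmodule.on ext.

Definition wedge (s : seq V) : ext := pgen ext_rel s.

Section Lift.
Variables (W : lmodType k) (f : seq V -> W).

Definition alternating :=
  (forall s1 s2 a x y, f (s1 ++ (a *: x + y) :: s2) =
                       a *: f (s1 ++ x :: s2) + f (s1 ++ y :: s2)) /\
  (forall s1 s2 x, f (s1 ++ x :: x :: s2) = 0).

Lemma alternating_respects : alternating -> respects ext_rel f.
Proof.
move=> [fl fx] r [[s1 [s2 [a [x [y ->]]]]]|[s1 [s2 [x ->]]]].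
  by rewrite linearB linearP !free_lift_single !scale1r fl subrr.
by rewrite free_lift_single fx scaler0.
Qed.

Definition elift (fP : alternating) : {linear ext -> W} :=
  plift (alternating_respects fP).

Lemma eliftE (fP : alternating) s : elift fP (wedge s) = f s.
Proof. exact: plift_gen. Qed.

End Lift.

(* F is determined by left "multiplications" M and a multilinear correction E. *)
Lemma alternating_rec (W : lmodType k) (F : seq V -> W) (M : V -> {linear W -> W})
    (E : V -> seq V -> W) :
  (forall x s, F (x :: s) = E x s + M x (F s)) ->
  (forall a x y w, M (a *: x + y) w = a *: M x w + M y w) ->
  (forall x w, M x (M x w) = 0) ->
  (forall x, alternating (E x)) ->
  (forall a x y s, E (a *: x + y) s = a *: E x s + E y s) ->
  (forall x s, E x (x :: s) + M x (E x s) = 0) ->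
  alternating F.
Proof.
move=> FE Ml Mx Ealt El Ex; split.
  elim=> [|z s1 ih] s2 a x y /=.
    rewrite !FE El Ml scalerDr -!addrA; congr (_ + _).
    by rewrite !addrA; congr (_ + _); rewrite addrC.
  rewrite !FE ih (Ealt z).1 linearP scalerDr -!addrA; congr (_ + _).
  by rewrite !addrA; congr (_ + _); rewrite addrC.
elim=> [|z s1 ih] s2 x /=; last by rewrite FE ih (Ealt z).2 linear0 addr0.
by rewrite !FE linearD /= Mx addr0 Ex.
Qed.

Lemma wedge_alternating : alternating wedge.
Proof.
split=> [s1 s2 a x y|s1 s2 x].
  rewrite /wedge /pgen -linearP; apply/qprojP/sub_lspan; left.
  by exists s1, s2, a, x, y.
by apply/qproj0/sub_lspan; right; exists s1, s2, x.
Qed.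

Lemma ext_ext (W : lmodType k) (F G : {linear ext -> W}) :
  (forall s, F (wedge s) = G (wedge s)) -> F =1 G.
Proof. exact: presented_ext. Qed.

Lemma wedge_cons_alternating x : alternating (fun s => wedge (x :: s)).
Proof.
have [wl wx] := wedge_alternating.
by split=> [s1 s2|s1 s2]; [exact: (wl (x :: s1))|exact: (wx (x :: s1))].
Qed.

Definition lmulw x : {linear ext -> ext} := elift (wedge_cons_alternating x).

Lemma lmulwE x s : lmulw x (wedge s) = wedge (x :: s).
Proof. exact: eliftE. Qed.

Lemma lmulw_bilin : bilin (fun x (w : ext) => lmulw x w).
Proof.
split=> [a x y w|a v x y]; last exact: linearP.
pose F := lmulw (a *: x + y); pose G := a \*: lmulw x \+ lmulw y.
rewrite -[LHS]/(F w) -[RHS]/(G w); move: w.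
apply: (@ext_ext _ F G) => s; rewrite /F /G /= !lmulwE.
exact: (wedge_alternating.1 [::]).
Qed.

Lemma lmulwxx x w : lmulw x (lmulw x w) = 0.
Proof.
pose F : {linear ext -> ext} := lmulw x \o lmulw x.
rewrite -[LHS]/(F w) -[RHS]/((\0 : {linear ext -> ext}) w); move: w.
apply: ext_ext => s; rewrite /F /= !lmulwE.
exact: (wedge_alternating.2 [::]).
Qed.

Lemma lmulwC x y w : lmulw x (lmulw y w) = - lmulw y (lmulw x w).
Proof.
apply/eqP; rewrite -addr_eq0; apply/eqP.
have lD u v z : lmulw (u + v) z = lmulw u z + lmulw v z.
  by rewrite -[u]scale1r lmulw_bilin.1 !scale1r.
have := lmulwxx (x + y) w; rewrite (lD x y w) lD (linearD (lmulw x)) (linearD (lmulw y)).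
by rewrite (lmulwxx x w) (lmulwxx y w) add0r addr0.
Qed.

Lemma wedge_swap x y s : wedge (x :: y :: s) = - wedge (y :: x :: s).
Proof. by rewrite -!lmulwE lmulwC. Qed.

Lemma ext1_alternating :
  alternating (fun s => if s is [:: x] then x else 0 : V).
Proof.
split=> [[|z [|z' s1]] [|z'' s2] a x y|[|z [|z' s1]] s2 x] //=;
  by rewrite ?scaler0 ?addr0.
Qed.

(* The projection of the exterior algebra onto its degree 1 part V. *)
Definition ext1 : {linear ext -> V} := elift ext1_alternating.

End Exterior.

Section ExteriorMap.
Variables (k : fieldType) (V W : lmodType k) (f : {linear V -> W}).

Lemma wedge_map_alternating : alternating (fun s => wedge (map f s)).
Proof.
have [wl wx] := wedge_alternating W.
by split=> *; rewrite !map_cat /= ?linearP; [exact: wl|exact: wx].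
Qed.

Definition ext_map : {linear ext V -> ext W} := elift wedge_map_alternating.

Lemma ext_mapE s : ext_map (wedge s) = wedge (map f s).
Proof. exact: eliftE. Qed.

End ExteriorMap.

HB.mixin Record Lmodule_isLieAlgebra (k : fieldType) L of GRing.Lmodule k L := {
  lie : L -> L -> L;
  lie_linearl : forall a x y z, lie (a *: x + y) z = a *: lie x z + lie y z;
  lie_linearr : forall a x y z, lie z (a *: x + y) = a *: lie z x + lie z y;
  liexx : forall x, lie x x = 0;
  lie_jacobi : forall x y z,
    lie x (lie y z) + lie y (lie z x) + lie z (lie x y) = 0
}.

#[short(type="lieAlgType")]
HB.structure Definition LieAlgebra (k : fieldType) :=
  {L of GRing.Lmodule k L & Lmodule_isLieAlgebra k L}.

#[short(type="finLieAlgType")]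
HB.structure Definition FinLieAlgebra (k : fieldType) :=
  {L of LieAlgebra k L & Vector k L}.

Notation "⁅ x , y ⁆" := (lie x y) (at level 0, x, y at level 99) : ring_scope.

HB.instance Definition _ (k : fieldType) (L : lieAlgType k) (x : L) :=
  GRing.isLinear.Build k L L *:%R (lie x) (fun a y z => lie_linearr a y z x).

Definition centreless (k : fieldType) (L : lieAlgType k) :=
  forall x : L, (forall y, ⁅x, y⁆ = 0) -> x = 0.

Definition delat (T : Type) (i : nat) (s : seq T) := take i s ++ drop i.+1 s.

Notation adj_complex L := (tens L (ext L)).

Section Chains.
Variables (k : fieldType) (L : lieAlgType k).
Implicit Types (s : seq L) (f x y z : L).

Section Derivation.
Variable D : {linear L -> L}.

Definition der_term s : ext L := \sum_(m < size s) (-1) ^+ m *: wedge (D s`_m :: delat m s).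

Lemma der_term_cons y s : der_term (y :: s) = wedge (D y :: s) + lmulw y (der_term s).
Proof.
rewrite /der_term big_ord_recl expr0 scale1r /delat /= drop0; congr (_ + _).
rewrite (linear_sum (lmulw y)); apply: eq_bigr => m _ /=.
by rewrite (linearZZ (lmulw y)) /= lmulwE wedge_swap scalerN exprS mulN1r scaleNr opprK.
Qed.

Lemma der_term_alternating : alternating der_term.
Proof.
have Dl a x y s : wedge (D (a *: x + y) :: s) = a *: wedge (D x :: s) + wedge (D y :: s).
  by rewrite linearP; apply: ((wedge_alternating L).1 [::]).
apply: (@alternating_rec _ L _ _ (@lmulw k L) (fun y s => wedge (D y :: s))).
- exact: der_term_cons.
- exact: (lmulw_bilin L).1.
- exact: lmulwxx.
- by move=> x; apply: wedge_cons_alternating.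
- exact: Dl.
- by move=> x s; rewrite lmulwE wedge_swap addNr.
Qed.

End Derivation.

(* Letters of s are numbered from 0. *)
Definition ce_term s : ext L :=
  \sum_(j < size s) \sum_(i < j)
    (-1) ^+ (i + j) *: wedge (⁅s`_i, s`_j⁆ :: delat i (delat j s)).

Local Notation T x := (der_term (lie x)).

Lemma ce_term_cons x s : ce_term (x :: s) = - T x s - lmulw x (ce_term s).
Proof.
rewrite /ce_term big_ord_recl big_ord0 add0r.
rewrite (eq_bigr (fun j : 'I_(size s) =>
   - ((-1) ^+ j *: wedge (⁅x, s`_j⁆ :: delat j s)) +
   - lmulw x (\sum_(i < j) (-1) ^+ (i + j) *:
               wedge (⁅s`_i, s`_j⁆ :: delat i (delat j s))))); last first.
  move=> j _; rewrite big_ord_recl; congr (_ + _).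
    by rewrite /delat /= drop0 add0n exprS mulN1r scaleNr.
  rewrite (linear_sum (lmulw x)) -sumrN; apply: eq_bigr => i _.
  rewrite (linearZZ (lmulw x)) [X in _ = - (_ *: X)]lmulwE wedge_swap /= scalerN.
  by rewrite /bump !add1n addnS addSn !exprS !mulN1r opprK.
by rewrite big_split /= !sumrN (linear_sum (lmulw x)).
Qed.

Lemma ce_term_alternating : alternating ce_term.
Proof.
have [Tl Tx] : (forall x, alternating (T x)) /\
    (forall a x y s, T (a *: x + y) s = a *: T x s + T y s).
  split=> [x|a x y s]; first exact: (der_term_alternating (lie x)).
  rewrite /der_term scaler_sumr -big_split /=; apply: eq_bigr => m _.
  rewrite lie_linearl ((wedge_alternating L).1 [::]) scalerDr !scalerA.
  by rewrite mulrC.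
apply: (@alternating_rec _ L _ _ (fun x => \- (lmulw x)) (fun x s => - T x s)).
- exact: ce_term_cons.
- by move=> a x y w /=; rewrite (lmulw_bilin L).1 opprD scalerN.
- by move=> x w /=; rewrite linearN lmulwxx !oppr0.
- by move=> x; split=> *; rewrite ?(Tl x).1 ?(Tl x).2 ?opprD ?scalerN ?oppr0.
- by move=> *; rewrite Tx opprD scalerN.
- move=> x s; rewrite -[X in _ + X]/(- lmulw x (- T x s)) (linearN (lmulw x)) opprK.
  have w0 : wedge (lie x x :: s) = 0.
    rewrite liexx; have := (wedge_alternating L).1 [::] s 1 0 0.
    by rewrite !scale1r addr0 => /eqP; rewrite addrC -subr_eq subrr => /eqP <-.
  by rewrite (der_term_cons (lie x)) [X in - (X + _)]w0 add0r addNr.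
Qed.

Definition ce_diff : {linear ext L -> ext L} := elift ce_term_alternating.

Lemma ce_diffE s : ce_diff (wedge s) = ce_term s.
Proof. exact: eliftE. Qed.

Local Notation adj_chain := (adj_complex L).

(* [adj_complex L] is L (x) (exterior algebra of L).  In f_0 (x) f_1 ^ ... ^ f_r the
   letter f_(i+1) is s`_i, whence the shifted exponents. *)
Definition adj_term f s : adj_chain :=
  \sum_(i < size s) (-1) ^+ i.+1 *: tensor ⁅f, s`_i⁆ (wedge (delat i s)) +
  \sum_(j < size s) \sum_(i < j) (-1) ^+ (i.+1 + j.+1 + 1) *:
     tensor f (wedge (⁅s`_i, s`_j⁆ :: delat i (delat j s))).

Let tens_lmulw_bilin x : bilin (fun f (w : ext L) => tensor f (lmulw x w)).
Proof. by split=> *; rewrite ?linearP ?tensorPl ?tensorPr. Qed.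

Let M x : {linear adj_chain -> adj_chain} := tlift (tens_lmulw_bilin x).

Let C f s : adj_chain :=
  \sum_(i < size s) (-1) ^+ i.+1 *: tensor ⁅f, s`_i⁆ (wedge (delat i s)).

Let C_cons f x s :
  C f (x :: s) = - tensor ⁅f, x⁆ (wedge s) + (\- (M x) : {linear _ -> _}) (C f s).
Proof.
rewrite /C big_ord_recl /= expr1 scaleN1r /delat /= drop0; congr (_ + _).
rewrite (linear_sum (M x)) -sumrN; apply: eq_bigr => i _ /=.
by rewrite (linearZZ (M x)) /= tliftE lmulwE exprS mulN1r scaleNr.
Qed.

Let tens_ext (W : lmodType k) (F G : {linear adj_chain -> W}) :
  (forall f w, F (tensor f w) = G (tensor f w)) -> F =1 G.
Proof. by move=> FG; apply: presented_ext => -[]. Qed.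

Let C_alternating f : alternating (C f).
Proof.
apply: (@alternating_rec _ L _ _ (fun x => \- (M x))
          (fun x s => - tensor ⁅f, x⁆ (wedge s))).
- exact: C_cons.
- move=> a x y w; pose F := \- (M (a *: x + y)).
  pose G := a \*: (\- (M x)) \+ (\- (M y)).
  rewrite -[LHS]/(F w) -[RHS]/(G w); move: w; apply: tens_ext => g w.
  rewrite /F /G /= !tliftE (lmulw_bilin L).1 tensorPr opprD scalerN.
  by [].
- move=> x w; pose F : {linear adj_chain -> adj_chain} := \- (M x) \o \- (M x).
  rewrite -[LHS]/(F w) -[RHS]/((\0 : {linear adj_chain -> adj_chain}) w).
  move: w; apply: tens_ext => g w; rewrite /F /= (linearN (M x)) opprK !tliftE lmulwxx.
  exact: (linear0 (tensor g)).
- move=> x; split=> [s1 s2 a y z|s1 s2 y].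
    by rewrite (wedge_alternating L).1 tensorPr opprD scalerN.
  rewrite (wedge_alternating L).2; apply/eqP; rewrite oppr_eq0; apply/eqP.
  exact: (linear0 (tensor ⁅f, x⁆)).
- by move=> *; rewrite lie_linearr tensorPl opprD scalerN.
- by move=> x s /=; rewrite (linearN (M x)) opprK tliftE lmulwE addNr.
Qed.

Lemma adj_termE f s : adj_term f s = C f s - tensor f (ce_term s).
Proof.
rewrite /adj_term -/(C f s); congr (_ + _).
rewrite (linear_sum (tensor f)) -sumrN; apply: eq_bigr => j _.
rewrite (linear_sum (tensor f)) -sumrN; apply: eq_bigr => i _ /=.
by rewrite (linearZZ (tensor f)) /= addn1 addSn addnS !exprS !mulN1r opprK scaleNr.
Qed.

Lemma adj_term_alternating f : alternating (adj_term f).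
Proof.
split=> *; rewrite !adj_termE.
  rewrite (C_alternating f).1 ce_term_alternating.1 linearP /= scalerBr.
  by rewrite opprD addrACA.
by rewrite (C_alternating f).2 ce_term_alternating.2 linear0 subrr.
Qed.

Lemma adj_term_bilin : bilin (fun f => elift (adj_term_alternating f)).
Proof.
split=> [a x y w|a v x y]; last exact: linearP.
pose F f := elift (adj_term_alternating f).
pose G := a \*: F x \+ F y.
rewrite -[LHS]/(F _ w) -[RHS]/(G w); move: w; apply: ext_ext => s.
rewrite /F /G /= !eliftE !adj_termE tensorPl opprD scalerBr addrACA.
congr (_ + _); rewrite /C scaler_sumr -big_split /=; apply: eq_bigr => i _.
by rewrite lie_linearl tensorPl scalerDr !scalerA mulrC.
Qed.

Definition adj_diff : {linear adj_chain -> adj_chain} := tlift adj_term_bilin.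

Lemma adj_diffE f s : adj_diff (tensor f (wedge s)) = adj_term f s.
Proof. by rewrite [LHS]tliftE eliftE. Qed.

(* f_0 (x) f_1 ^ ... ^ f_n |-> f_0 ^ f_1 ^ ... ^ f_n, inducing I in homology. *)
Definition adj_to_ce : {linear adj_chain -> ext L} := tlift (lmulw_bilin L).

Lemma adj_to_ceE f s : adj_to_ce (tensor f (wedge s)) = wedge (f :: s).
Proof. by rewrite [LHS]tliftE lmulwE. Qed.

End Chains.

(* Associative algebras, not necessarily unital and possibly zero: the algType of
   MathComp excludes End(g) for g = 0. *)
HB.mixin Record Lmodule_isAssocAlgebra (k : fieldType) A of GRing.Lmodule k A := {
  amul : A -> A -> A;
  amulA : associative amul;
  amul_linearl : forall a x y z, amul (a *: x + y) z = a *: amul x z + amul y z;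
  amul_linearr : forall a x y z, amul z (a *: x + y) = a *: amul z x + amul z y
}.

#[short(type="assocAlgType")]
HB.structure Definition AssocAlgebra (k : fieldType) :=
  {A of GRing.Lmodule k A & Lmodule_isAssocAlgebra k A}.

Notation "x ⋅ y" := (amul x y) (at level 40, left associativity) : ring_scope.

Section AssocAlgebraTheory.
Variables (k : fieldType) (A : assocAlgType k).
Implicit Types x y z : A.

HB.instance Definition _ x :=
  GRing.isLinear.Build k A A *:%R (amul x) (fun a y z => amul_linearr a y z x).

Lemma amulDl x y z : (x + y) ⋅ z = x ⋅ z + y ⋅ z.
Proof. by rewrite -[x]scale1r amul_linearl !scale1r. Qed.

Lemma amul0l y : 0 ⋅ y = 0.
Proof. by apply: (addrI (0 ⋅ y)); rewrite -amulDl !addr0. Qed.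

Lemma amulNl x y : (- x) ⋅ y = - (x ⋅ y).
Proof. by apply: (addrI (x ⋅ y)); rewrite -amulDl !subrr amul0l. Qed.

Lemma amulBl x y z : (x - y) ⋅ z = x ⋅ z - y ⋅ z.
Proof. by rewrite amulDl amulNl. Qed.

Lemma amulBr x y z : z ⋅ (x - y) = z ⋅ x - z ⋅ y.
Proof. exact: (linearB (amul z)). Qed.

Lemma amul0r x : x ⋅ 0 = 0.
Proof. exact: (linear0 (amul x)). Qed.

Lemma amul_suml (I : Type) (s : seq I) (F : I -> A) y :
  (\sum_(i <- s) F i) ⋅ y = \sum_(i <- s) (F i ⋅ y).
Proof. exact: (big_morph (amul^~ y) (fun u v => amulDl u v y) (amul0l y)). Qed.

Lemma amul_sumr (I : Type) (s : seq I) (F : I -> A) x :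
  x ⋅ (\sum_(i <- s) F i) = \sum_(i <- s) (x ⋅ F i).
Proof. exact: (linear_sum (amul x)). Qed.

Definition comm_lie : Type := A.
HB.instance Definition _ := GRing.Lmodule.on comm_lie.

Definition commutator (x y : comm_lie) : comm_lie := (x : A) ⋅ y - (y : A) ⋅ x.

Fact commutator_linearl a (x y z : comm_lie) :
  commutator (a *: x + y) z = a *: commutator x z + commutator y z.
Proof.
by rewrite /commutator amul_linearl amul_linearr scalerBr opprD addrACA.
Qed.

Fact commutator_linearr a (x y z : comm_lie) :
  commutator z (a *: x + y) = a *: commutator z x + commutator z y.
Proof.
by rewrite /commutator amul_linearl amul_linearr scalerBr opprD addrACA.
Qed.

Fact commutatorxx x : commutator x x = 0. Proof. exact: subrr. Qed.

Fact commutator_jacobi x y z :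
  commutator x (commutator y z) + commutator y (commutator z x)
    + commutator z (commutator x y) = 0.
Proof.
rewrite /commutator !amulBl !amulBr !amulA !opprB.
set p1 := x ⋅ y ⋅ z; set p2 := x ⋅ z ⋅ y; set p3 := y ⋅ z ⋅ x.
set p4 := z ⋅ y ⋅ x; set p5 := y ⋅ x ⋅ z; set p6 := z ⋅ x ⋅ y.
rewrite !addrA (ACl (1*12*(2*7)*(3*10)*(4*5)*(6*11)*(8*9))%AC) /=.
by rewrite !subrr !addNr !addr0.
Qed.

HB.instance Definition _ := Lmodule_isLieAlgebra.Build k comm_lie
  commutator_linearl commutator_linearr commutatorxx commutator_jacobi.

End AssocAlgebraTheory.

Section EndAlgebra.
Variables (k : fieldType) (V : vectType k).

Definition endo : Type := 'End(V).
HB.instance Definition _ := GRing.Lmodule.on endo.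

Definition endo_mul (f g : endo) : endo := (f \o g)%VF.

Fact endo_mulA : associative endo_mul.
Proof. by move=> f g h; apply: comp_lfunA. Qed.
Fact endo_linearl a (f g h : endo) :
  endo_mul (a *: f + g) h = a *: endo_mul f h + endo_mul g h.
Proof. by rewrite /endo_mul comp_lfunDl comp_lfunZl. Qed.

Fact endo_linearr a (f g h : endo) :
  endo_mul h (a *: f + g) = a *: endo_mul h f + endo_mul h g.
Proof. by rewrite /endo_mul comp_lfunDr comp_lfunZr. Qed.

HB.instance Definition _ := Lmodule_isAssocAlgebra.Build k endo
  endo_mulA endo_linearl endo_linearr.

Definition endo_trace (f : endo) : k := \tr (passmx.mxof (vbasis {:V}) (vbasis {:V}) f).

End EndAlgebra.

Section BandMatrices.
Variables (k : fieldType) (R : assocAlgType k).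

Definition banded : {pred int -> int -> R} :=
  fun phi => `[< exists K : nat, forall i j, (K%:Z < `|i - j|)%R -> phi i j = 0 >].

Fact banded_closed : submod_closed banded.
Proof.
split; first by apply/asboolP; exists 0%N.
move=> a f g /asboolP[K fK] /asboolP[M gM]; apply/asboolP.
exists (maxn K M) => i j; rewrite -[f]/f => ij.
rewrite [LHS](_ : _ = a *: f i j + g i j)// fK ?gM ?scaler0 ?addr0//.
all: by apply: Order.POrderTheory.le_lt_trans ij; rewrite lez_nat ?leq_maxl ?leq_maxr.
Qed.

HB.instance Definition _ :=
  GRing.isSubmodClosed.Build k (int -> int -> R) banded banded_closed.

Record bandmx := BandMx { bmval :> int -> int -> R; _ : bmval \in banded }.

HB.instance Definition _ := [isSub for bmval].
HB.instance Definition _ := [Choice of bandmx by <:].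
HB.instance Definition _ := [SubChoice_isSubLmodule of bandmx by <:].

Implicit Types f g h : bandmx.

Lemma bandedP f : exists K : nat, forall i j, (K%:Z < `|i - j|)%R -> f i j = 0.
Proof. by case: f => f /= /asboolP. Qed.

Lemma bandmxP f g : (forall i j, f i j = g i j) <-> f = g.
Proof.
by split=> [fg|->//]; apply/val_inj/funext => i; apply/funext => j; apply: fg.
Qed.

Lemma bandmxDE f g i j : (f + g) i j = f i j + g i j. Proof. by []. Qed.
Lemma bandmxZE a f i j : (a *: f) i j = a *: f i j. Proof. by []. Qed.

Let near (i : int) (K : nat) : {fset int} :=
  [fset x in [seq (i - K%:Z + m%:Z)%R | m <- iota 0 (K.*2).+1]]%fset.

Let nearP i K j : j \notin near i K -> (K%:Z < `|i - j|)%R.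
Proof.
rewrite in_fset; apply: contraR; rewrite -Order.TotalTheory.leNgt => ij.
apply/mapP; exists (absz (j - i + K%:Z)); first by rewrite mem_iota; lia.
by lia.
Qed.

Definition bmmul_fun f g (i j : int) : R := \sum_(l \in [set: int]) f i l ⋅ g l j.

Let bmmulE f g i j (A : {fset int}) (K : nat) :
  (forall i j, (K%:Z < `|i - j|)%R -> f i j = 0) ->
  (forall l, l \notin A -> (K%:Z < `|i - l|)%R) ->
  bmmul_fun f g i j = \sum_(l <- A) f i l ⋅ g l j.
Proof. by move=> fK Al; apply: fsbigTE => l /Al/fK ->; rewrite amul0l. Qed.

Fact bmmul_subproof f g : bmmul_fun f g \in banded.
Proof.
have [K fK] := bandedP f; have [M gM] := bandedP g.
apply/asboolP; exists (K + M)%N => i j ij.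
rewrite (bmmulE _ _ fK (@nearP i K)) big1// => l _.
have [il|il] := Order.TotalTheory.ltP K%:Z (`|i - l|)%R.
  by rewrite fK// amul0l.
by rewrite gM ?amul0r//; lia.
Qed.

Definition bmmul f g : bandmx := BandMx (bmmul_subproof f g).

Fact bmmulA : associative bmmul.
Proof.
move=> f g h; have [K fK] := bandedP f; have [M gM] := bandedP g.
have [N fgN] := bandedP (bmmul f g).
apply/bandmxP => i j /=.
have far l : l \notin near i (K + M + N) -> ((K + M + N)%N%:Z < `|i - l|)%R.
  exact: nearP.
rewrite (@bmmulE f _ i j (near i (K + M + N)) K)//; last by move=> l /far; lia.
rewrite (@bmmulE _ h i j (near i (K + M + N)) N)//; last by move=> l /far; lia.
under [RHS]eq_bigr => l _.
  rewrite [X in X ⋅ _](@bmmulE f g i l (near i (K + M + N)) K)//; last first.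
    by move=> m /far; lia.
  rewrite amul_suml; over.
rewrite /= exchange_big /=; apply: eq_bigr => m _.
have [im|im] := Order.TotalTheory.ltP K%:Z (`|i - m|)%R.
  by rewrite fK// amul0l big1// => l _; rewrite !amul0l.
rewrite [X in _ ⋅ X](@bmmulE g h m j (near i (K + M + N)) M)//; last first.
  by move=> l /far; lia.
by rewrite amul_sumr; apply: eq_bigr => l _; rewrite amulA.
Qed.

Fact bmmul_linearl a f g h : bmmul (a *: f + g) h = a *: bmmul f h + bmmul g h.
Proof.
have [K fK] := bandedP f; have [M gM] := bandedP g.
have [N fgN] := bandedP (a *: f + g); apply/bandmxP => i j.
rewrite bandmxDE bandmxZE /=.
have far l : l \notin near i (K + M + N) -> ((K + M + N)%N%:Z < `|i - l|)%R.
  exact: nearP.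
rewrite (@bmmulE f _ i j (near i (K + M + N)) K)//; last by move=> l /far; lia.
rewrite (@bmmulE g _ i j (near i (K + M + N)) M)//; last by move=> l /far; lia.
rewrite (@bmmulE _ _ i j (near i (K + M + N)) N fgN); last by move=> l /far; lia.
rewrite scaler_sumr -big_split /=; apply: eq_bigr => l _.
by rewrite -amul_linearl.
Qed.

Fact bmmul_linearr a f g h : bmmul h (a *: f + g) = a *: bmmul h f + bmmul h g.
Proof.
have [K hK] := bandedP h; apply/bandmxP => i j; rewrite bandmxDE bandmxZE /=.
rewrite !(bmmulE _ _ hK (@nearP i K)) scaler_sumr -big_split /=.
by apply: eq_bigr => l _; rewrite -amul_linearr.
Qed.

HB.instance Definition _ := Lmodule_isAssocAlgebra.Build k bandmx
  bmmulA bmmul_linearl bmmul_linearr.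

End BandMatrices.

Section Laurent.
Variables (k : fieldType) (n : nat) (g : lieAlgType k).

(* g[t_1^+-1, ..., t_n^+-1]: f stands for the sum of the f(c) t^c. *)
Definition laurent : Type := fsupp {ffun 'I_n -> int} g.
HB.instance Definition _ := GRing.Lmodule.on laurent.

Definition lmono (c : {ffun 'I_n -> int}) (Y : g) : laurent := fsingle c Y.

Fact lmono_linear c : linear (lmono c).
Proof. exact: (linearP (fsingle c)). Qed.

HB.instance Definition _ c :=
  GRing.isLinear.Build k g laurent *:%R (lmono c) (lmono_linear c).

Definition laurent_lie (f h : laurent) : laurent :=
  \sum_(a \in [set: {ffun 'I_n -> int}]) \sum_(b \in [set: {ffun 'I_n -> int}])
    lmono (a + b) ⁅f a, h b⁆.

Let lie0l (x : g) : ⁅0, x⁆ = 0.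
Proof.
by have /eqP := lie_linearl 1 0 0 x; rewrite !scale1r addr0 addrC -subr_eq subrr => /eqP <-.
Qed.

Let laurent_lieE (f h : laurent) (A B : {fset {ffun 'I_n -> int}}) :
  (forall a, a \notin A -> f a = 0) -> (forall b, b \notin B -> h b = 0) ->
  laurent_lie f h = \sum_(a <- A) \sum_(b <- B) lmono (a + b) ⁅f a, h b⁆.
Proof.
move=> fA hB; rewrite /laurent_lie (@fsbigTE _ _ _ _ A) => [|a /fA ->].
  apply: eq_bigr => a _; apply: fsbigTE => b /hB ->.
  by rewrite (linear0 (lie (f a))) (linear0 (lmono (a + b))).
by apply: fsbig1 => b _; rewrite lie0l (linear0 (lmono (a + b))).
Qed.

Fact laurent_lie_linearl a f h e :
  laurent_lie (a *: f + h) e = a *: laurent_lie f e + laurent_lie h e.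
Proof.
have [A fA] := fsupp_fset f; have [B hB] := fsupp_fset h.
have [C eC] := fsupp_fset e.
have fAB i : i \notin (A `|` B)%fset -> f i = 0.
  by rewrite in_fsetU negb_or => /andP[/fA].
have hAB i : i \notin (A `|` B)%fset -> h i = 0.
  by rewrite in_fsetU negb_or => /andP[_ /hB].
rewrite (laurent_lieE fAB eC) (laurent_lieE hAB eC).
rewrite (@laurent_lieE _ _ (A `|` B)%fset C) => [|i iAB|//]; last first.
  by rewrite [LHS](_ : _ = a *: f i + h i)// fAB// hAB// scaler0 addr0.
rewrite scaler_sumr -big_split /=; apply: eq_bigr => i _.
rewrite scaler_sumr -big_split /=; apply: eq_bigr => j _.
by rewrite -linearP -lie_linearl.
Qed.

Fact laurent_lie_linearr a f h e :
  laurent_lie e (a *: f + h) = a *: laurent_lie e f + laurent_lie e h.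
Proof.
have [A fA] := fsupp_fset f; have [B hB] := fsupp_fset h.
have [C eC] := fsupp_fset e.
have fAB i : i \notin (A `|` B)%fset -> f i = 0.
  by rewrite in_fsetU negb_or => /andP[/fA].
have hAB i : i \notin (A `|` B)%fset -> h i = 0.
  by rewrite in_fsetU negb_or => /andP[_ /hB].
rewrite (laurent_lieE eC fAB) (laurent_lieE eC hAB).
rewrite (@laurent_lieE _ _ C (A `|` B)%fset) => [|//|i iAB]; last first.
  by rewrite [LHS](_ : _ = a *: f i + h i)// fAB// hAB// scaler0 addr0.
rewrite scaler_sumr -big_split /=; apply: eq_bigr => i _.
rewrite scaler_sumr -big_split /=; apply: eq_bigr => j _.
by rewrite -linearP -lie_linearr.
Qed.

Lemma laurent_lie_mono a b x y :
  laurent_lie (lmono a x) (lmono b y) = lmono (a + b) ⁅x, y⁆.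
Proof.
rewrite (@laurent_lieE _ _ [fset a]%fset [fset b]%fset).
- by rewrite !big_seq_fset1 !fsingleE !eqxx.
- by move=> i; rewrite in_fset1 fsingleE => /negbTE ->.
- by move=> i; rewrite in_fset1 fsingleE => /negbTE ->.
Qed.

Let lieC (x y : g) : ⁅x, y⁆ = - ⁅y, x⁆.
Proof.
have := liexx (x + y); rewrite (linearD (lie (x + y))) /=.
rewrite -[X in lie (X + y)]scale1r !lie_linearl !scale1r !liexx add0r addr0.
by move/eqP; rewrite addrC addr_eq0 => /eqP.
Qed.

Let lieD f h e : laurent_lie (f + h) e = laurent_lie f e + laurent_lie h e.
Proof. by rewrite -[f]scale1r laurent_lie_linearl !scale1r. Qed.

Let lieDr f h e : laurent_lie e (f + h) = laurent_lie e f + laurent_lie e h.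
Proof. by rewrite -[f]scale1r laurent_lie_linearr !scale1r. Qed.

Let lie0f f : laurent_lie 0 f = 0.
Proof. by apply: (addrI (laurent_lie 0 f)); rewrite -lieD !addr0. Qed.

Let lief0 f : laurent_lie f 0 = 0.
Proof. by apply: (addrI (laurent_lie f 0)); rewrite -lieDr !addr0. Qed.

Let laurent_lieC f h : laurent_lie f h = - laurent_lie h f.
Proof.
move: f; apply: fsupp_ind => [|a x f ih]; first by rewrite lie0f lief0 oppr0.
rewrite lieD lieDr ih opprD; congr (_ + _); move: h {ih}.
apply: fsupp_ind => [|b y h ih]; first by rewrite lie0f lief0 oppr0.
rewrite lieD lieDr ih opprD; congr (_ + _).
by rewrite !laurent_lie_mono lieC addrC (linearN (lmono _)).
Qed.

Fact laurent_liexx f : laurent_lie f f = 0.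
Proof.
move: f; apply: fsupp_ind => [|a x f ih]; first exact: lie0f.
rewrite lieD !lieDr ih addr0 (laurent_lieC f) [laurent_lie (fsingle a x) (fsingle a x)]laurent_lie_mono liexx.
by rewrite (linear0 (lmono _)) add0r subrr.
Qed.

Fact laurent_jacobi f h e :
  laurent_lie f (laurent_lie h e) + laurent_lie h (laurent_lie e f)
    + laurent_lie e (laurent_lie f h) = 0.
Proof.
move: f; apply: fsupp_ind => [|a x f ihf].
  by rewrite !(lie0f, lief0) !addr0.
rewrite !(lieD, lieDr) [X in X + _ = _]addrACA [LHS]addrACA ihf addr0 => {ihf f}.
move: h; apply: fsupp_ind => [|b y h ihh].
  by rewrite !(lie0f, lief0) !addr0.
rewrite !(lieD, lieDr) [X in X + _ = _]addrACA [LHS]addrACA ihh addr0 => {ihh h}.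
move: e; apply: fsupp_ind => [|c z e ihe].
  by rewrite !(lie0f, lief0) !addr0.
rewrite !(lieD, lieDr) [X in X + _ = _]addrACA [LHS]addrACA ihe addr0 => {ihe e}.
rewrite !laurent_lie_mono.
have -> : b + (c + a) = a + (b + c) by rewrite addrA addrC.
have -> : c + (a + b) = a + (b + c) by rewrite addrC addrA.
by rewrite -!linearD lie_jacobi linear0.
Qed.

HB.instance Definition _ := Lmodule_isLieAlgebra.Build k laurent
  laurent_lie_linearl laurent_lie_linearr laurent_liexx laurent_jacobi.

End Laurent.

Section IteratedBand.
Variables (k : fieldType).

Section Shift.
Variables (R : assocAlgType k) (c : int).

Fact shift_subproof (x : R) : (fun i j : int => if i == j + c then x else 0) \in @banded k R.
Proof.
apply/asboolP; exists (absz c) => i j; case: eqP => // ->.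
by rewrite addrAC subrr add0r -abszE Order.POrderTheory.ltxx.
Qed.

(* The operator x t^c of R[t,t^-1], sending t^j to x t^(j+c): its entry in row
   j + c and column j is x. *)
Definition shift_mx (x : R) : bandmx R := BandMx (shift_subproof x).

Fact shift_mx_linear : linear shift_mx.
Proof.
move=> a x y; apply/bandmxP => i j; rewrite bandmxDE bandmxZE /=.
by case: ifP => // _; rewrite scaler0 addr0.
Qed.

HB.instance Definition _ :=
  GRing.isLinear.Build k R (bandmx R) *:%R shift_mx shift_mx_linear.

End Shift.

(* The two-sided ideals I^+(R) and I^-(R) of E(R). *)
Definition band_pos (R : assocAlgType k) : set (bandmx R) :=
  [set phi | exists B : int, forall i j, (i < B)%R -> phi i j = 0].

Definition band_neg (R : assocAlgType k) : set (bandmx R) :=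
  [set phi | exists B : int, forall i j, (B < j)%R -> phi i j = 0].

Definition band_trace (R : assocAlgType k) (phi : bandmx R) : R :=
  \sum_(i \in [set: int]) phi i i.

Variable R : assocAlgType k.

(* E^n(R), the outermost application of E being the last place: the i-th place
   counted from the inside (i = 1, ..., n) is the ordinal i - 1 of 'I_n. *)
Fixpoint iter_band (n : nat) : assocAlgType k :=
  if n is m.+1 then bandmx (iter_band m) else R.

(* x t_1^(c_1) ... t_n^(c_n). *)
Fixpoint iter_mono (n : nat) : ('I_n -> int) -> R -> iter_band n :=
  match n with
  | 0 => fun _ x => x
  | m.+1 => fun c x =>
      shift_mx (c ord_max) (iter_mono (fun i => c (lift ord_max i)) x)
  end.

(* E is applied in all places except the i-th, where I^+ or I^- is. *)
Fixpoint iter_ideal (pos : bool) (n : nat) : 'I_n -> set (iter_band n) :=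
  match n with
  | 0 => fun _ => set0
  | m.+1 => fun i =>
      if unlift ord_max i is Some i' then
        [set phi : bandmx (iter_band m) | forall a b, iter_ideal pos i' (phi a b)]
      else if pos then @band_pos (iter_band m) else @band_neg (iter_band m)
  end.

Fixpoint iter_trace (n : nat) : iter_band n -> R :=
  match n with
  | 0 => id
  | m.+1 => fun phi : bandmx (iter_band m) => iter_trace (band_trace phi)
  end.

Fact iter_mono_linear n (c : 'I_n -> int) : linear (iter_mono c).
Proof.
elim: n c => [|n ih] c a x y //=.
by rewrite ih; apply: (linearP (shift_mx (c ord_max))).
Qed.

HB.instance Definition _ n (c : 'I_n -> int) :=
  GRing.isLinear.Build k R (iter_band n) *:%R (iter_mono c) (iter_mono_linear c).

End IteratedBand.

Section IdealChains.
Variables (k : fieldType) (L : lieAlgType k).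

Definition ce_ideal (J : set L) (r : nat) : set (ext L) :=
  if r is r'.+1 then
    lspan [set w | exists x s, [/\ J x, size s = r' & w = wedge (x :: s)]]
  else lspan [set wedge [::]].

End IdealChains.

Section Tate.
Variables (k : fieldType) (n : nat) (g : finLieAlgType k).

Definition tate_alg : assocAlgType k := iter_band (endo g) n.
Definition tate_lie : lieAlgType k := comm_lie tate_alg.

Definition tate_tau (phi : tate_alg) : k := endo_trace (iter_trace phi).

Definition ad (Y : g) : endo g := linfun (lie Y).

Fact ad_linear : linear ad.
Proof.
move=> a x y; apply/lfunP => z.
by rewrite add_lfunE scale_lfunE !lfunE /= lie_linearl.
Qed.

HB.instance Definition _ := GRing.isLinear.Build k g (endo g) *:%R ad ad_linear.

Definition tate_embed : {linear laurent n g -> tate_lie} :=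
  fs_sum (fun c : {ffun 'I_n -> int} =>
     (iter_mono (R := endo g) c \o ad : {linear g -> tate_alg})).

End Tate.

Section TateClass.
Variables (k : fieldType) (n : nat) (g : finLieAlgType k).
Local Notation G := (tate_lie n g).

Definition tate_ideal (pos : bool) (i : 'I_n) : set G :=
  @iter_ideal k (endo g) pos n i.

(* The signs +, -, 0 are Some true, Some false and None. *)
Definition signs : Type := {ffun 'I_n -> option bool}.
HB.instance Definition _ := Finite.on signs.

Definition sdeg (s : signs) : nat := #|[set i | s i == None]%SET|.+1.

Definition szero (s : signs) (i : 'I_n) : signs :=
  [ffun j => if j == i then None else s j].

Definition tate_X (i : 'I_n) (e : option bool) (r : nat) : set (ext G) :=
  match e with
  | Some pos => ce_ideal (tate_ideal pos i) r
  | None => ce_ideal (tate_ideal true i) r `&` ce_ideal (tate_ideal false i) r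
  end.

(* Elements of degree r of the p-th term (p >= 1), as families indexed by all sign
   vectors and vanishing outside degree p. *)
Definition tate_T (p r : nat) : set (signs -> ext G) :=
  [set f | forall s, if sdeg s == p then forall i, tate_X i (s i) r (f s)
                     else f s = 0].

Definition tate_bdry (f : signs -> ext G) (s : signs) : ext G :=
  \sum_(i | s i != None)
    (-1) ^+ #|[set j : 'I_n | (i < j)%N && (s j == None)]%SET| *: f (szero s i).

(* On sign vectors of degree 1 the factor is the product of the signs. *)
Definition tate_bdry1 (f : signs -> ext G) : ext G :=
  \sum_(s : signs | sdeg s == 1%N)
    (\prod_i (if s i == Some true then 1 else -1)) *: f s.

Definition tate_system (theta0 : ext G) (theta : nat -> signs -> ext G) : Prop :=
  [/\ forall p, (1 <= p <= n.+1)%N -> tate_T p (n.+2 - p) (theta p),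
      tate_bdry1 (theta 1%N) = theta0 &
      forall p s, (1 <= p <= n)%N -> sdeg s = p ->
        tate_bdry (theta p.+1) s = ce_diff G (theta p s)].

(* All values tau(theta_(n+1)) obtainable from theta_0 by the zigzag; res_* is
   well defined at [theta_0] when this set is a singleton, and [tate_class] then
   is its unique element. *)
Definition tate_res (theta0 : ext G) : set k :=
  [set v | exists2 theta, tate_system theta0 theta &
           v = tate_tau (ext1 G (theta n.+1 [ffun=> None]))].

Definition tate_class (theta0 : ext G) : k := xget 0 (tate_res theta0).

(* tr (ad Y_0 ... ad Y_n). *)
Definition trace_form (Ys : seq g) : k :=
  endo_trace (foldr (fun Y f => ad Y ⋅ f) (\1%VF : endo g) Ys).

(* The letters Y_1, ..., Y_n are Y (lift ord0 i) for i : 'I_n. *)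
Definition tate_formula (Y : 'I_n.+1 -> g) (c : 'I_n.+1 -> {ffun 'I_n -> int}) : k :=
  if [forall i, \sum_p c p i == 0] then
    (-1) ^+ n * \sum_(s : 'S_n) (-1) ^+ s *
      trace_form (rcons [seq Y (lift ord0 (s i)) | i <- enum 'I_n] (Y ord0)) *
      \prod_i (c (lift ord0 (s i)) i)%:~R
  else 0.

End TateClass.

(* Main.v *)
Require Import Defs.
From HB Require Import structures.
From mathcomp Require Import all_boot all_order all_algebra.
From mathcomp Require Import finmap boolp classical_sets fsbigop.
From mathcomp Require Import perm ssrAC zify.

(** Let d be the differential of the adjoint complex, the tensor product of G with its
    exterior algebra, and let p_i be the projection onto the rows of nonnegative index
    in the i-th place.  It commutes with right multiplication and with the other p_j,
    maps G into I_i^+, and 1 - p_i maps G into I_i^-.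

    Existence and value.  Acting on the coefficient, p_i is an operator on the adjoint
    complex.  Put o_i(+) = p_i, o_i(-) = - (1 - p_i) and o_i(0) = [d, p_i].  Then
    d o_i(+-) = o_i(+-) d + o_i(0), and d anticommutes with o_i(0).  So for a lifted cycle
    z the family of the images of o_1(s_1) ... o_n(s_n) z, with suitable signs, satisfies
    the equations of the zigzag ([tate_zigzag_system]).  Its last term comes from
    [d, p_1] ... [d, p_n] z.  On f_0 (x) f_1 /\ ... /\ f_r the operator [d, p] is the
    alternating sum of the [p, f_i] f_0 with the letter f_i removed ([adj_cut_diff]), so
    the last term is the antisymmetrisation of [p_1, f_1] ... [p_n, f_n] f_0
    ([zero_ops_perm]).  For monomials its trace factors over the places: the matrix part
    gives the trace form, the trace vanishes unless the exponents add up to 0 in every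
    place, and [p_i, t_i^c] contributes the sum over r of 1_(r >= 0) - 1_(r - c >= 0),
    which is c ([has_sum_step], [iter_trace_mono]).

    Independence of choices.  The exterior power of 1 - p_i and its complement are
    commuting idempotents of the exterior algebra of G that contract the sign complexes
    one place after the other ([cube_exact], [tate_exact]).  Therefore the ends of two
    zigzags differ by the boundary of a chain w of degree 2 that lies in the span of
    the J /\ G for each of the 2n ideals J.  Such a w is a sum of wedges x /\ y such
    that each J contains x or y ([shared_span]), and for those tr(xy) = tr(yx)
    ([iter_traceC]). *)

Set Implicit Arguments.
Unset Strict Implicit.
Unset Printing Implicit Defensive.

Import GRing.Theory.

Local Open Scope classical_set_scope.
Local Open Scope ring_scope.

(** * Scaling the rows of iterated band matrices *)

Section Rows.
Variables (k : fieldType).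

Definition int_ball (M : nat) : {fset int} :=
  [fset x in [seq (m%:Z - M%:Z)%R | m <- iota 0 (M.*2).+1]]%fset.

Lemma notin_int_ball M j : j \notin int_ball M -> (M%:Z < `|j|)%R.
Proof.
rewrite in_fset; apply: contraR; rewrite -Order.TotalTheory.leNgt => jM.
apply/mapP; exists (absz (j + M%:Z)); first by rewrite mem_iota; lia.
by lia.
Qed.

Section RowMap.
Variables (R S : assocAlgType k) (F : int -> {linear R -> S}).

Fact rowmap_banded (x : bandmx R) : (fun a b => F a (x a b)) \in @banded k S.
Proof.
have [K xK] := bandedP x; apply/asboolP; exists K => a b /xK ->.
exact: linear0.
Qed.

Definition rowmap (x : bandmx R) : bandmx S := BandMx (rowmap_banded x).

Fact rowmap_linear : linear rowmap.
Proof. by move=> c x y; apply/bandmxP => a b; rewrite bandmxDE bandmxZE /= -linearP. Qed.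

HB.instance Definition _ :=
  GRing.isLinear.Build k (bandmx R) (bandmx S) *:%R rowmap rowmap_linear.
End RowMap.

Section BandProduct.
Variable R : assocAlgType k.
Implicit Types x y : bandmx R.

Lemma bandmulE x y a b (F : {fset int}) :
  (forall l, l \notin F -> x a l ⋅ y l b = 0) ->
  (x ⋅ y) a b = \sum_(l <- F) x a l ⋅ y l b.
Proof. exact: fsbigTE. Qed.

Lemma bandmul_ball x y a b : exists M,
  forall N, (M <= N)%N -> (x ⋅ y) a b = \sum_(l <- int_ball N) x a l ⋅ y l b.
Proof.
have [K xK] := bandedP x; exists (`|a| + K)%N => N MN.
apply: bandmulE => l /notin_int_ball lN; rewrite xK ?amul0l//; lia.
Qed.

End BandProduct.

Variable R : assocAlgType k.

Definition cons_row n (a : int) (r : 'I_n -> int) (i : 'I_n.+1) : int :=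
  if unlift ord_max i is Some j then r j else a.

Lemma cons_row_max n a (r : 'I_n -> int) : cons_row a r ord_max = a.
Proof. by rewrite /cons_row unlift_none. Qed.

Lemma cons_row_lift n a (r : 'I_n -> int) i : cons_row a r (lift ord_max i) = r i.
Proof. by rewrite /cons_row liftK. Qed.

Lemma cons_rowK n (r : 'I_n.+1 -> int) :
  cons_row (r ord_max) (fun i => r (lift ord_max i)) = r.
Proof.
apply/funext => i; case: (unliftP ord_max i) => [j ->|->].
  by rewrite cons_row_lift.
by rewrite cons_row_max.
Qed.

(** Left multiplication by a diagonal matrix of scalars, as an operator rather than
    as an element: the coefficient algebras are not assumed unital.  Every
    projector below is of this form.  A weight [w] sees the row indices of all
    places at once, so that a cut in one place may depend on the others. *)
Fixpoint rowscale (n : nat) : (('I_n -> int) -> k) ->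
    {linear iter_band R n -> iter_band R n} :=
  match n with
  | 0 => fun w => (w (fun=> 0)) \*: idfun
  | m.+1 => fun w => rowmap (fun a => rowscale (fun r => w (cons_row a r)))
  end.

Lemma rowscaleE n w (x : iter_band R n.+1) a b :
  (rowscale w x : bandmx _) a b =
  rowscale (fun r => w (cons_row a r)) ((x : bandmx _) a b).
Proof. by []. Qed.

Lemma rowscaleM n w (x y : iter_band R n) : rowscale w (x ⋅ y) = rowscale w x ⋅ y.
Proof.
elim: n w x y => [|n ih] w x y.
  by have := amul_linearl (w (fun=> 0)) x 0 y; rewrite !addr0 amul0l addr0 => ->.
apply/bandmxP => a b; rewrite rowscaleE.
have [M xyM] := bandmul_ball x y a b.
have [N wxyN] := bandmul_ball (rowscale w x : bandmx _) y a b.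
rewrite (xyM (maxn M N)) ?leq_maxl// (wxyN (maxn M N)) ?leq_maxr//.
by rewrite linear_sum; apply: eq_bigr => l _; rewrite ih.
Qed.

Lemma rowscale_comp n w v (x : iter_band R n) :
  rowscale w (rowscale v x) = rowscale (fun r => w r * v r) x.
Proof.
elim: n w v x => [|n ih] w v x; first by rewrite /= scalerA.
by apply/bandmxP => a b; rewrite !rowscaleE ih.
Qed.

Lemma rowscaleD n w v (x : iter_band R n) :
  rowscale (fun r => w r + v r) x = rowscale w x + rowscale v x.
Proof.
elim: n w v x => [|n ih] w v x; first by rewrite /= scalerDl.
by apply/bandmxP => a b; rewrite bandmxDE !rowscaleE ih.
Qed.

Lemma rowscaleN n w (x : iter_band R n) :
  rowscale (fun r => - w r) x = - rowscale w x.
Proof.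
elim: n w x => [|n ih] w x; first by rewrite /= scaleNr.
by apply/bandmxP => a b; rewrite rowscaleE ih.
Qed.

Lemma rowscale_cst n c (x : iter_band R n) : rowscale (fun=> c) x = c *: x.
Proof.
elim: n x => [|n ih] x //.
by apply/bandmxP => a b; rewrite bandmxZE !rowscaleE ih.
Qed.

Lemma rowscale0 n (x : iter_band R n) : rowscale (fun=> 0) x = 0.
Proof. by rewrite rowscale_cst scale0r. Qed.

Lemma rowscale1 n (x : iter_band R n) : rowscale (fun=> 1) x = x.
Proof. by rewrite rowscale_cst scale1r. Qed.

Lemma rowscaleC n w v (x : iter_band R n) :
  rowscale w (rowscale v x) = rowscale v (rowscale w x).
Proof.
rewrite !rowscale_comp; congr (rowscale _ x).
by apply/funext => r; rewrite mulrC.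
Qed.

Local Notation J := (@iter_ideal k R).

Lemma iter_ideal_max pos n (x : iter_band R n.+1) :
  J pos ord_max x = (if pos then @band_pos k (iter_band R n) else @band_neg k (iter_band R n)) x.
Proof. by rewrite /= unlift_none; case: pos. Qed.

Lemma iter_ideal_lift pos n i (x : iter_band R n.+1) :
  J pos (lift ord_max i) x = forall a b, J pos i ((x : bandmx _) a b).
Proof. by rewrite /= liftK. Qed.

Lemma iter_idealP pos n (i : 'I_n) c (x y : iter_band R n) :
  J pos i x -> J pos i y -> J pos i (c *: x + y).
Proof.
elim: n i c x y => [[] //|n ih] i c x y.
case: (unliftP ord_max i) => [j ->|->].
  rewrite !iter_ideal_lift => Jx Jy a b; rewrite bandmxDE bandmxZE.
  exact: ih.
rewrite !iter_ideal_max => {ih}; case: pos => -[A xA] [B yB].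
- exists (Order.min A B) => a b aAB; rewrite bandmxDE bandmxZE xA ?yB ?scaler0 ?addr0//; lia.
- exists (Order.max A B) => a b aAB; rewrite bandmxDE bandmxZE xA ?yB ?scaler0 ?addr0//; lia.
Qed.

Lemma iter_ideal0 pos n (i : 'I_n) : J pos i 0.
Proof.
elim: n i => [[] //|n ih] i.
case: (unliftP ord_max i) => [j ->|->]; first by rewrite iter_ideal_lift => a b; apply: ih.
by rewrite iter_ideal_max => {ih}; case: pos; exists 0.
Qed.

Lemma iter_idealD pos n (i : 'I_n) (x y : iter_band R n) :
  J pos i x -> J pos i y -> J pos i (x + y).
Proof. by move=> Jx Jy; rewrite -[x]scale1r; apply: iter_idealP. Qed.

Lemma iter_idealN pos n (i : 'I_n) (x : iter_band R n) :
  J pos i x -> J pos i (- x).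
Proof.
move=> Jx; rewrite -[- x]addr0 -scaleN1r; apply: iter_idealP => //.
exact: iter_ideal0.
Qed.

Lemma iter_ideal_sum pos n (i : 'I_n) I (s : seq I) (F : I -> iter_band R n) :
  (forall j, J pos i (F j)) -> J pos i (\sum_(j <- s) F j).
Proof.
move=> JF; elim/big_rec: _ => [|j x _ Jx]; first exact: iter_ideal0.
exact: iter_idealD.
Qed.

(** For the ideal of negative type, the vanishing of columns beyond [A] moves to
    columns beyond [A + K], [K] being the band width of the other factor. *)
Lemma iter_ideal_mulr pos n (i : 'I_n) (x y : iter_band R n) :
  J pos i x -> J pos i (x ⋅ y).
Proof.
elim: n i x y => [[] //|n ih] i x y.
case: (unliftP ord_max i) => [j ->|->].
  rewrite !iter_ideal_lift => Jx a b; have [M /(_ M (leqnn M)) ->] := bandmul_ball x y a b.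
  by apply: iter_ideal_sum => l; apply: ih.
rewrite !iter_ideal_max => {ih}; case: pos => -[A xA].
  exists A => a b aA; have [M /(_ M (leqnn M)) ->] := bandmul_ball x y a b.
  by rewrite big1// => l _; rewrite xA// amul0l.
have [K yK] := bandedP y.
exists (A + K%:Z) => a b bA; have [M /(_ M (leqnn M)) ->] := bandmul_ball x y a b.
rewrite big1// => l _; have [lA|Al] := Order.TotalTheory.leP l A.
  by rewrite yK ?amul0r//; lia.
by rewrite xA ?amul0l.
Qed.

Lemma iter_ideal_mull pos n (i : 'I_n) (x y : iter_band R n) :
  J pos i x -> J pos i (y ⋅ x).
Proof.
elim: n i x y => [[] //|n ih] i x y.
case: (unliftP ord_max i) => [j ->|->].
  rewrite !iter_ideal_lift => Jx a b; have [M /(_ M (leqnn M)) ->] := bandmul_ball y x a b.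
  by apply: iter_ideal_sum => l; apply: ih.
rewrite !iter_ideal_max => {ih}; case: pos => -[A xA]; last first.
  exists A => a b bA; have [M /(_ M (leqnn M)) ->] := bandmul_ball y x a b.
  by rewrite big1// => l _; rewrite xA// amul0r.
have [K yK] := bandedP y.
exists (A - K%:Z) => a b bA; have [M /(_ M (leqnn M)) ->] := bandmul_ball y x a b.
rewrite big1// => l _; have [lA|Al] := Order.TotalTheory.ltP l A.
  by rewrite xA ?amul0r.
by rewrite yK ?amul0l//; lia.
Qed.

Lemma iter_ideal_rowscale pos n (i : 'I_n) w (x : iter_band R n) :
  J pos i x -> J pos i (rowscale w x).
Proof.
elim: n i w x => [[] //|n ih] i w x.
case: (unliftP ord_max i) => [j ->|->].
  by rewrite !iter_ideal_lift => Jx a b; rewrite rowscaleE; apply: ih.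
by rewrite !iter_ideal_max => {ih}; case: pos => -[A xA];
  exists A => a b bA; rewrite rowscaleE xA// linear0.
Qed.

(** An element of [iter_ideal pos i] vanishes beyond a bound in the [i]-th place
    which may vary with the entry taken in the outer places; the row indices of the
    outer places are the [j > i]. *)
Definition same_outer n (i : 'I_n) (r r' : 'I_n -> int) :=
  forall j : 'I_n, (i < j)%N -> r j = r' j.

(** Sign convention making both types of ideal mean: rows of small height vanish.
    For the negative type this exchanges columns for rows, at the cost of the band
    width. *)
Definition height (pos : bool) (a : int) : int := if pos then a else - a.

Lemma same_outer_lift n (i : 'I_n) a r b r' :
  same_outer (lift ord_max i) (cons_row a r) (cons_row b r') <->
  a = b /\ same_outer i r r'.
Proof.
split=> [arr|[-> rr] j].
  split; first by have := arr ord_max; rewrite !cons_row_max; apply; rewrite lift_max /= ltn_ord.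
  move=> j ij; have := arr (lift ord_max j); rewrite !cons_row_lift; apply.
  by rewrite !lift_max.
case: (unliftP ord_max j) => [j' ->|->]; rewrite ?cons_row_max// !cons_row_lift => ij.
by apply: rr; move: ij; rewrite !lift_max.
Qed.

(** Cutting away the rows of small height lands in the ideal: there too the bound may
    vary with the outer coordinates. *)
Lemma rowscale_ideal pos n (i : 'I_n) w (x : iter_band R n) :
  (forall r, exists B, forall r', same_outer i r r' ->
     (height pos (r' i) < B)%R -> w r' = 0) ->
  J pos i (rowscale w x).
Proof.
elim: n i w x => [[] //|n ih] i w x.
case: (unliftP ord_max i) => [j ->|->] wB.
  rewrite iter_ideal_lift => a b; rewrite rowscaleE; apply: ih => r.
  have [B BP] := wB (cons_row a r); exists B => r' rr' r'B; apply: BP.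
    exact/same_outer_lift.
  by rewrite cons_row_lift.
have [B BP] := wB (fun=> 0).
have w0 a r : (height pos a < B)%R -> w (cons_row a r) = 0.
  move=> aB; apply: BP; last by rewrite cons_row_max.
  by move=> j; rewrite ltnNge -ltnS ltn_ord.
have wx0 a b : (height pos a < B)%R -> (rowscale w x : bandmx _) a b = 0.
  move=> aB; rewrite rowscaleE (_ : (fun r => _) = fun=> 0) ?rowscale0//.
  by apply/funext => r; apply: w0.
rewrite iter_ideal_max => {ih wB BP w0}; case: pos wx0 => /= wx0; first by exists B.
have [K wxK] := bandedP (rowscale w x : bandmx _).
exists (K%:Z - B) => a b bB; have [aB|aB] := Order.TotalTheory.ltP (- a) B.
  exact: wx0.
by apply: wxK; lia.
Qed.

Definition outer_only n (i : 'I_n) (b : ('I_n -> int) -> int) :=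
  forall r r', same_outer i r r' -> b r = b r'.

(** Conversely an element of the ideal is killed by every cut far enough out.  The
    threshold depends on the outer rows only: by bandedness each outer row meets
    finitely many nonzero entries, and [b] is the minimum of their thresholds. *)
Lemma iter_ideal_threshold pos n (i : 'I_n) (x : iter_band R n) :
  J pos i x -> exists2 b, outer_only i b &
    forall w, (forall r, (b r <= height pos (r i))%R -> w r = 0) -> rowscale w x = 0.
Proof.
elim: n i x => [[] //|n ih] i x.
case: (unliftP ord_max i) => [j ->|->].
  rewrite iter_ideal_lift => Jx.
  have /choice[B BP] : forall ab : int * int, exists b, outer_only j b /\
     forall w, (forall r, (b r <= height pos (r j))%R -> w r = 0) ->
       rowscale w ((x : bandmx _) ab.1 ab.2) = 0.
    by move=> ab; have [b bo b0] := ih _ _ (Jx ab.1 ab.2); exists b.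
  have [K xK] := bandedP x.
  (* The columns that a row [a] of a matrix of band width [K] can meet. *)
  pose cols (a : int) := [seq (a + m%:Z - K%:Z)%R | m <- iota 0 (K.*2).+1].
  pose b (r : 'I_n.+1 -> int) : int :=
    \big[Order.min/0%R]_(c <- cols (r ord_max))
       B (r ord_max, c) (fun i => r (lift ord_max i)).
  exists b => [r r' rr'|w wb].
    have [rm ro] : r ord_max = r' ord_max /\
        same_outer j (fun i => r (lift ord_max i)) (fun i => r' (lift ord_max i)).
      by apply/same_outer_lift; rewrite !cons_rowK.
    rewrite /b rm; apply: eq_bigr => c _; exact: (BP _).1.
  apply/bandmxP => a c; rewrite rowscaleE.
  have [ac|ac] := Order.TotalTheory.ltP K%:Z `|a - c|.
    by rewrite xK// linear0.
  apply: (BP (a, c)).2 => r rB; apply: wb; rewrite cons_row_lift.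
  apply: Order.POrderTheory.le_trans rB.
  rewrite /b cons_row_max (_ : (fun i => _) = r); last first.
    by apply/funext => l; rewrite cons_row_lift.
  have : c \in cols a.
    by apply/mapP; exists (absz (c - a + K%:Z)); rewrite ?mem_iota; lia.
  elim: (cols a) => // d s ihs; rewrite inE big_cons => /orP[/eqP<-|/ihs cs].
    by rewrite Order.TotalTheory.ge_min Order.POrderTheory.lexx.
  by rewrite Order.TotalTheory.ge_min cs orbT.
rewrite iter_ideal_max => {ih} Jx.
have [B BP] : exists B, forall a c, (height pos a < B)%R -> (x : bandmx _) a c = 0.
  case: pos Jx => -[B BP]; first by exists B.
  have [K xK] := bandedP x.
  exists (- B - K%:Z) => a c aB; have [cB|cB] := Order.TotalTheory.ltP B c; first exact: BP.
  by apply: xK; move: aB => /=; lia.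
exists (fun=> B) => // w wB; apply/bandmxP => a c; rewrite rowscaleE.
have [aB|aB] := Order.TotalTheory.ltP (height pos a) B; first by rewrite BP// linear0.
rewrite (_ : (fun r => _) = fun=> 0) ?rowscale0//.
by apply/funext => r; apply: wB; rewrite cons_row_max.
Qed.

End Rows.
Arguments rowscale {k R n} w.

(** * The iterated trace *)

Section Trace.
Variables (k : fieldType) (R : assocAlgType k).
Local Notation J := (@iter_ideal k R).

(** The ideal I_tr.  Off it [iter_trace] is a junk value of a sum of infinite
    support, and additivity fails; hence the membership hypotheses below. *)
Definition trace_ideal n : set (iter_band R n) :=
  [set x | forall pos i, J pos i x].

Lemma trace_idealP n c (x y : iter_band R n) :
  trace_ideal x -> trace_ideal y -> trace_ideal (c *: x + y).
Proof. by move=> Jx Jy pos i; apply: iter_idealP. Qed.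

Lemma trace_ideal_sum n I (s : seq I) (F : I -> iter_band R n) :
  (forall j, trace_ideal (F j)) -> trace_ideal (\sum_(j <- s) F j).
Proof. by move=> JF pos i; apply: iter_ideal_sum => j; apply: JF. Qed.

Lemma trace_ideal_entry n (x : iter_band R n.+1) a b :
  trace_ideal x -> trace_ideal ((x : bandmx _) a b).
Proof. by move=> Jx pos i; have := Jx pos (lift ord_max i); rewrite iter_ideal_lift. Qed.

Lemma trace_ideal_ball n (x : iter_band R n.+1) : trace_ideal x ->
  exists M, forall a b, (M%:Z < `|a|)%R -> (x : bandmx _) a b = 0.
Proof.
move=> Jx; have := Jx true ord_max; rewrite iter_ideal_max => -[A xA].
have := Jx false ord_max; rewrite iter_ideal_max => -[B xB].
have [K xK] := bandedP (x : bandmx _).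
exists (`|A| + `|B| + K)%N => a b aM.
have [aA|aA] := Order.TotalTheory.ltP a A; first exact: xA.
have [bB|bB] := Order.TotalTheory.ltP B b; first exact: xB.
by apply: xK; lia.
Qed.

Lemma band_traceE (x : bandmx R) (F : {fset int}) :
  (forall a, a \notin F -> x a a = 0) -> band_trace x = \sum_(a <- F) x a a.
Proof. exact: fsbigTE. Qed.
End Trace.

Section TraceLinear.
Variables (k : fieldType) (R : assocAlgType k).

Lemma iter_traceP n c (x y : iter_band R n) : trace_ideal x -> trace_ideal y ->
  iter_trace (c *: x + y) = c *: iter_trace x + iter_trace y.
Proof.
elim: n c x y => [|n ih] c x y //= Jx Jy.
have [M xM] := trace_ideal_ball Jx; have [N yN] := trace_ideal_ball Jy.
pose F := int_ball (maxn M N).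
have far a : a \notin F -> (M%:Z < `|a|)%R /\ (N%:Z < `|a|)%R.
  by move=> /notin_int_ball; lia.
have xF a : a \notin F -> (x : bandmx _) a a = 0 by move=> /far[/xM->].
have yF a : a \notin F -> (y : bandmx _) a a = 0 by move=> /far[_ /yN->].
rewrite (band_traceE xF) (band_traceE yF) (@band_traceE _ _ _ F); last first.
  move=> a aF; rewrite [LHS](_ : _ = c *: (x : bandmx _) a a + (y : bandmx _) a a)//.
  by rewrite xF// yF// scaler0 addr0.
rewrite -ih; last 2 first.
- by apply: trace_ideal_sum => a; apply: trace_ideal_entry.
- by apply: trace_ideal_sum => a; apply: trace_ideal_entry.
congr iter_trace; rewrite scaler_sumr -big_split /=.
by apply: eq_bigr.
Qed.

Lemma iter_trace0 n : iter_trace (0 : iter_band R n) = 0.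
Proof.
have J0 : trace_ideal (0 : iter_band R n) by move=> pos i; apply: iter_ideal0.
have := iter_traceP 1 J0 J0; rewrite !scale1r addr0 => tE.
by apply: (addrI (iter_trace (0 : iter_band R n))); rewrite addr0 -tE.
Qed.

Lemma iter_trace_sum n I (s : seq I) (F : I -> iter_band R n) :
  (forall j, trace_ideal (F j)) ->
  iter_trace (\sum_(j <- s) F j) = \sum_(j <- s) iter_trace (F j).
Proof.
move=> JF; elim: s => [|j s ih]; first by rewrite !big_nil iter_trace0.
rewrite !big_cons -{}ih -[F j]scale1r iter_traceP ?scale1r//.
exact: trace_ideal_sum.
Qed.

(** Both products of such a pair lie in I_tr, although neither factor need do so. *)
Definition traceable n (x y : iter_band R n) :=
  forall pos i, @iter_ideal k R pos n i x \/ @iter_ideal k R pos n i y.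

Lemma traceableC n (x y : iter_band R n) : traceable x y -> traceable y x.
Proof. by move=> xy pos i; case: (xy pos i); [right|left]. Qed.

Lemma traceable_mul n (x y : iter_band R n) : traceable x y -> trace_ideal (x ⋅ y).
Proof.
by move=> xy pos i; case: (xy pos i) => [/iter_ideal_mulr|/iter_ideal_mull]; apply.
Qed.

Lemma traceable_entry n (x y : iter_band R n.+1) a b c d : traceable x y ->
  traceable ((x : bandmx _) a b) ((y : bandmx _) c d).
Proof.
move=> xy pos i.
by case: (xy pos (lift ord_max i)); rewrite iter_ideal_lift => xyi; [left|right].
Qed.

(** One factor bounds the rows below and one bounds them above; bandedness then
    bounds the columns too, so the double sum computing tr(xy) is finite. *)
Lemma traceable_ball n (x y : iter_band R n.+1) : traceable x y ->
  exists M, forall a b, (M%:Z < `|a|)%R || (M%:Z < `|b|)%R ->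
    (x : bandmx _) a b = 0 \/ (y : bandmx _) b a = 0.
Proof.
move=> xy; have [K xK] := bandedP (x : bandmx _); have [L yL] := bandedP (y : bandmx _).
have [A xyA] : exists A : int, forall a b, (a < A)%R ->
    (x : bandmx _) a b = 0 \/ (y : bandmx _) b a = 0.
  have := xy true ord_max; rewrite !iter_ideal_max => -[] [A xA].
    by exists A => a b aA; left; apply: xA.
  exists (A - L%:Z) => a b aA; right; have [bA|bA] := Order.TotalTheory.ltP b A.
    exact: xA.
  by apply: yL; lia.
have [B xyB] : exists B : int, forall a b, (B < a)%R ->
    (x : bandmx _) a b = 0 \/ (y : bandmx _) b a = 0.
  have := xy false ord_max; rewrite !iter_ideal_max => -[] [B xB].
    exists (B + K%:Z) => a b Ba; left; have [bB|bB] := Order.TotalTheory.ltP B b.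
      exact: xB.
    by apply: xK; lia.
  by exists B => a b Ba; right; apply: xB.
exists (`|A| + `|B| + K)%N => a b abM.
have [aA|aA] := Order.TotalTheory.ltP a A; first exact: xyA.
have [aB|aB] := Order.TotalTheory.ltP B a; first exact: xyB.
by left; apply: xK; lia.
Qed.

Variable t : {linear R -> k^o}.
Hypothesis tC : forall x y, t (x ⋅ y) = t (y ⋅ x).

Lemma iter_trace_mulE n (x y : iter_band R n.+1) (F : {fset int}) : traceable x y ->
  (forall a b, (a \notin F) || (b \notin F) ->
    (x : bandmx _) a b = 0 \/ (y : bandmx _) b a = 0) ->
  t (iter_trace (x ⋅ y)) = \sum_(a <- F) \sum_(b <- F)
    t (iter_trace ((x : bandmx _) a b ⋅ (y : bandmx _) b a)).
Proof.
move=> xy FP /=.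
have xyE a b : (a \notin F) || (b \notin F) ->
    (x : bandmx _) a b ⋅ (y : bandmx _) b a = 0.
  by case/FP => ->; rewrite ?amul0l ?amul0r.
have diagE a : (x ⋅ y : bandmx _) a a = \sum_(b <- F) (x : bandmx _) a b ⋅ (y : bandmx _) b a.
  by apply: bandmulE => b bF; rewrite xyE// bF orbT.
rewrite (@band_traceE _ _ _ F) => [|a aF]; last first.
  by rewrite diagE big1// => b _; rewrite xyE ?aF.
have Jab a b : trace_ideal ((x : bandmx _) a b ⋅ (y : bandmx _) b a).
  exact/traceable_mul/traceable_entry.
rewrite (eq_bigr _ (fun a _ => diagE a)) iter_trace_sum => [|a]; last exact: trace_ideal_sum.
rewrite linear_sum; apply: eq_bigr => a _ /=; rewrite iter_trace_sum//.
by rewrite linear_sum.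
Qed.

(** In the outermost place both traces are the finite double sum of the
    [x a b] [y b a], up to the order of the factors; the entries again form a
    traceable pair, one place fewer. *)
Lemma iter_traceC n (x y : iter_band R n) : traceable x y ->
  t (iter_trace (x ⋅ y)) = t (iter_trace (y ⋅ x)).
Proof.
elim: n x y => [|n ih] x y xy; first exact: tC.
have [M xyM] := traceable_ball xy.
have FP a b : (a \notin int_ball M) || (b \notin int_ball M) ->
    (x : bandmx _) a b = 0 \/ (y : bandmx _) b a = 0.
  by move=> abM; apply: xyM; case/orP: abM => /notin_int_ball ->; rewrite ?orbT.
rewrite (iter_trace_mulE xy FP) (@iter_trace_mulE _ y x (int_ball M) (traceableC xy)).
  rewrite exchange_big /=; apply: eq_bigr => b _; apply: eq_bigr => a _.
  exact/ih/traceable_entry.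
by move=> b a; rewrite orbC => /FP[]; [right|left].
Qed.

End TraceLinear.

(** * Monomials *)

Section Monomials.
Variables (k : fieldType) (R : assocAlgType k).
Local Notation mono := (@iter_mono k R _).

Lemma shift_mxM (S : assocAlgType k) c d (x y : S) :
  shift_mx c x ⋅ shift_mx d y = shift_mx (c + d) (x ⋅ y) :> bandmx S.
Proof.
apply/bandmxP => a b; rewrite (@bandmulE _ _ _ _ _ _ [fset (b + d)%R]%fset) /=.
  by rewrite big_seq_fset1 eqxx -addrA [d + c]addrC; case: eqP => //; rewrite amul0l.
by move=> l; rewrite in_fset1 => /negbTE ->; rewrite amul0r.
Qed.

Lemma iter_monoM n (c d : 'I_n -> int) x y :
  mono c x ⋅ mono d y = mono (fun i => c i + d i) (x ⋅ y).
Proof.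
elim: n c d => [|n ih] c d //=.
by rewrite -ih; apply: shift_mxM.
Qed.

(** A monomial sends the row [r - c] to the row [r]. *)
Lemma mono_rowscale n (c : 'I_n -> int) x w (z : iter_band R n) :
  mono c x ⋅ rowscale w z = rowscale (fun r => w (fun i => r i - c i)) (mono c x ⋅ z).
Proof.
elim: n c w z => [|n ih] c w z.
  rewrite /= (_ : (fun i : 'I_0 => _) = fun=> 0); last by apply/funext => -[].
  by have := amul_linearr (w (fun=> 0)) z 0 x; rewrite !addr0 amul0r addr0.
apply/bandmxP => a b; rewrite rowscaleE.
have mulE (u : bandmx (iter_band R n)) : (mono c x ⋅ u : bandmx _) a b =
    mono (fun i => c (lift ord_max i)) x ⋅ u (a - c ord_max) b.
  rewrite (@bandmulE _ _ _ _ _ _ [fset (a - c ord_max)%R]%fset) /=.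
    by rewrite big_seq_fset1 subrK eqxx.
  move=> l; rewrite in_fset1 => la; case: eqP => [al|]; last by rewrite amul0l.
  by rewrite al addrK eqxx in la.
rewrite [in RHS](mulE z) [LHS](mulE (rowscale w z)) rowscaleE ih.
congr (rowscale _ _); apply/funext => r; congr w; apply/funext => i.
case: (unliftP ord_max i) => [j ->|->]; last by rewrite !cons_row_max.
by rewrite !cons_row_lift.
Qed.

Definition nonneg_wt n (i : 'I_n) (r : 'I_n -> int) : k := (0 <= r i)%R%:R.
Definition cut n (i : 'I_n) : {linear iter_band R n -> iter_band R n} := rowscale (nonneg_wt i).

(** The product [p_i, y] x, where p_i projects onto the nonnegative rows of the
    [i]-th place. *)
Definition cut_bracket n (i : 'I_n) (y x : iter_band R n) : iter_band R n :=
  cut i (y ⋅ x) - y ⋅ cut i x.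

Lemma cut_bracket_mono n (i : 'I_n) (c d : 'I_n -> int) x y w :
  cut_bracket i (mono c x) (rowscale w (mono d y)) =
  rowscale (fun r => ((0 <= r i)%R%:R - (0 <= r i - c i)%R%:R) * w (fun j => r j - c j))
    (mono (fun j => c j + d j) (x ⋅ y)).
Proof.
rewrite /cut_bracket /cut rowscale_comp !mono_rowscale rowscale_comp iter_monoM.
rewrite -rowscaleN -rowscaleD; congr (rowscale _ _); apply/funext => r.
by rewrite mulrBl.
Qed.

(** The finiteness clause excludes the junk value 0 of a sum of infinite support. *)
Definition has_sum (v : int -> k) (S : k) :=
  (exists F : {fset int}, forall a, a \notin F -> v a = 0) /\ \sum_(a \in [set: int]) v a = S.

Lemma has_sumE v S (F : {fset int}) : has_sum v S ->
  (forall a, a \notin F -> v a = 0) -> \sum_(a <- F) v a = S.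
Proof. by move=> [_ <-] vF; rewrite (fsbigTE _ _ vF). Qed.

Lemma has_sumD v u S T : has_sum v S -> has_sum u T ->
  has_sum (fun a => v a + u a) (S + T).
Proof.
move=> vS uT; have [[F vF] _] := vS; have [[G uG] _] := uT.
have vFG a : a \notin (F `|` G)%fset -> v a = 0.
  by rewrite in_fsetU negb_or => /andP[/vF].
have uFG a : a \notin (F `|` G)%fset -> u a = 0.
  by rewrite in_fsetU negb_or => /andP[_ /uG].
have vuFG a : a \notin (F `|` G)%fset -> v a + u a = 0.
  by move=> aFG; rewrite vFG// uFG// addr0.
split; first by exists (F `|` G)%fset.
by rewrite (fsbigTE _ _ vuFG) big_split /= (has_sumE vS vFG) (has_sumE uT uFG).
Qed.

Lemma has_sum_shift v S c : has_sum v S -> has_sum (fun a => v (a - c)) S.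
Proof.
move=> [[F vF] <-]; split.
  exists [fset (a + c)%R | a in F]%fset => a aF; apply: vF.
  by apply: contra aF => aF; apply/imfsetP; exists (a - c); rewrite ?subrK.
rewrite [RHS](@reindex_fsbigT _ _ _ _ _ (fun a => a - c))//.
by exists (fun a => a + c) => a; rewrite ?addrK ?subrK.
Qed.

Lemma has_sum1 a0 : has_sum (fun a => (a == a0)%:R) 1.
Proof.
have aF a : a \notin [fset a0]%fset -> (a == a0)%:R = 0 :> k.
  by rewrite in_fset1 => /negbTE ->.
by split; [exists [fset a0]%fset|rewrite (fsbigTE _ _ aF) big_seq_fset1 eqxx].
Qed.

Lemma has_sumN v S : has_sum v S -> has_sum (fun a => - v a) (- S).
Proof.
move=> vS; have [[F vF] _] := vS.
have nvF a : a \notin F -> - v a = 0 by move=> /vF ->; rewrite oppr0.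
by split; [exists F|rewrite (fsbigTE _ _ nvF) sumrN (has_sumE vS)].
Qed.

(** The origin of the exponents in the formula: the trace of [p, t^c] is [c], by
    telescoping one step of [c] at a time. *)
Lemma has_sum_step (c : int) :
  has_sum (fun a => (0 <= a)%R%:R - (0 <= a - c)%R%:R) c%:~R.
Proof.
have step (m : int) : forall a : int,
    (m <= a)%R%:R - (m + 1 <= a)%R%:R = (a == m)%:R :> k.
  move=> a; have [->|am] := eqVneq a m.
    by rewrite Order.POrderTheory.lexx (_ : (m + 1 <= m)%R = false) ?subr0//; lia.
  by rewrite (_ : (m + 1 <= a)%R = (m <= a)%R) ?subrr//; lia.
have le_sub a m : (0 <= a - m :> int)%R = (m <= a)%R by lia.
under eq_fun do rewrite le_sub.
elim: c => [|c ih|c ih].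
- by split; [exists fset0 => a _; rewrite subrr|rewrite fsbig1// => a; rewrite subrr].
- have := has_sumD ih (has_sum1 c%:Z).
  rewrite (_ : c%:~R + 1 = c.+1%:~R); last by rewrite -!pmulrn -natr1.
  congr has_sum; apply/funext => a; rewrite -step addrA subrK.
  by rewrite -[c.+1]addn1 PoszD.
- have := has_sumD ih (has_sumN (has_sum1 (- c.+1%:Z))).
  rewrite (_ : _ - 1 = (- c.+1%:Z)%:~R); last by rewrite !mulrNz -!pmulrn -natr1 opprD.
  congr has_sum; apply/funext => a; rewrite -step opprB addrA.
  rewrite (_ : - c.+1%:Z + 1 = - c%:Z); last by lia.
  by rewrite subrK.
Qed.

Lemma rowscale_sum n I (s : seq I) (w : I -> ('I_n -> int) -> k) (x : iter_band R n) :
  rowscale (fun r => \sum_(i <- s) w i r) x = \sum_(i <- s) rowscale (w i) x.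
Proof.
elim: s => [|i s ih].
  by rewrite big_nil -(rowscale0 x); congr (rowscale _ x); apply/funext => r; rewrite big_nil.
rewrite big_cons -ih -rowscaleD; congr (rowscale _ x).
by apply/funext => r; rewrite big_cons.
Qed.

(** The trace of a monomial with product weights factors over the places.  The
    scalar [al] absorbs the weights of the places already summed. *)
Lemma iter_trace_mono n (t : {linear R -> k^o}) (al : k) (v : 'I_n -> int -> k)
    (S : 'I_n -> k) (d : 'I_n -> int) z :
  (forall j, has_sum (v j) (S j)) ->
  t (iter_trace (rowscale (fun r => al * \prod_j v j (r j)) (mono d z))) =
  if [forall i, d i == 0] then al * \prod_j S j * t z else 0.
Proof.
elim: n al v S d => [|n ih] al v S d vS.
  by rewrite /= !big_ord0 linearZ /= (_ : [forall i, _])//; apply/forallP => -[].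
have dE : [forall i, d i == 0] =
    (d ord_max == 0) && [forall i, d (lift ord_max i) == 0].
  apply/forallP/andP => [d0|[d0 /forallP dl] i]; first by split; [|apply/forallP].
  by case: (unliftP ord_max i) => [j ->|->].
rewrite dE [iter_trace _]/=; have [d0|d0] /= := eqVneq (d ord_max) 0; last first.
  rewrite [band_trace _](_ : _ = 0) ?iter_trace0 ?linear0//.
  apply: fsbig1 => a _ /=; rewrite -[X in X == _]addr0 (inj_eq (addrI _)).
  by rewrite eq_sym (negbTE d0) linear0.
have [F vF] := (vS ord_max).1.
rewrite (@band_traceE _ _ _ F) => [|a aF /=]; last first.
  rewrite (_ : (fun r => _) = fun=> 0) ?rowscale0//; apply/funext => r.
  by rewrite (bigD1_ord ord_max) //= cons_row_max vF// mul0r mulr0.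
have -> : \sum_(a <- F) (rowscale (fun r => al * \prod_j v j (r j))
      (mono d z : iter_band R n.+1) : bandmx _) a a =
    rowscale (fun r => (al * S ord_max) * \prod_j v (lift ord_max j) (r j))
      (mono (fun i => d (lift ord_max i)) z).
  rewrite -(has_sumE (vS ord_max) vF) mulr_sumr.
  rewrite (_ : (fun r => _) = fun r => \sum_(a <- F)
      (al * v ord_max a) * \prod_j v (lift ord_max j) (r j)); last first.
    by apply/funext => r; rewrite mulr_suml.
  rewrite rowscale_sum; apply: eq_bigr => a _ /=; rewrite d0 addr0 eqxx.
  congr (rowscale _ _); apply/funext => r; rewrite (bigD1_ord ord_max) //=.
  rewrite cons_row_max mulrA; congr (_ * _); apply: eq_bigr => j _.
  by rewrite cons_row_lift.
have := ih (al * S ord_max) (fun j => v (lift ord_max j))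
  (fun j => S (lift ord_max j)) (fun i => d (lift ord_max i)) (fun j => vS _).
move=> ->; case: ifP => // _.
by rewrite [in RHS](bigD1_ord ord_max) //= mulrA.
Qed.

End Monomials.

(** * Cartan calculus on Chevalley-Eilenberg complexes *)

Section Span.
Variables (k : fieldType) (V W : lmodType k).

Lemma lspan_min (S : set V) (P : V -> Prop) : P 0 ->
  (forall a u v, P u -> P v -> P (a *: u + v)) -> (forall u, S u -> P u) ->
  forall v, lspan S v -> P v.
Proof.
move=> P0 PP SP v [N [a [x [Sx ->]]]]; elim/big_rec: _ => // i w _ Pw.
exact/PP/Pw/SP.
Qed.

Lemma lspanD (S : set V) u v : lspan S u -> lspan S v -> lspan S (u + v).
Proof. by move=> Su Sv; rewrite -[u]scale1r; apply: lspanP. Qed.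

Lemma lspanZ (S : set V) a u : lspan S u -> lspan S (a *: u).
Proof. by move=> Su; rewrite -[_ *: _]addr0; apply: lspanP => //; apply: lspan0. Qed.

Lemma lspanN (S : set V) u : lspan S u -> lspan S (- u).
Proof. by move=> Su; rewrite -scaleN1r; apply: lspanZ. Qed.

Lemma lspanB (S : set V) u v : lspan S u -> lspan S v -> lspan S (u - v).
Proof. by move=> Su /lspanN; apply: lspanD. Qed.

Lemma lspan_sum (S : set V) I (s : seq I) (P : pred I) (F : I -> V) :
  (forall i, P i -> lspan S (F i)) -> lspan S (\sum_(i <- s | P i) F i).
Proof.
by move=> SF; elim/big_rec: _ => [|i x Pi]; [apply: lspan0|apply/lspanD/SF].
Qed.

Lemma lspan_linear (S : set V) (T : set W) (F : {linear V -> W}) :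
  (forall u, S u -> lspan T (F u)) -> forall v, lspan S v -> lspan T (F v).
Proof.
move=> SF; apply: lspan_min => //; first by rewrite linear0; apply: lspan0.
by move=> a u v Tu Tv; rewrite linearP; apply: lspanP.
Qed.

Lemma lspanS (S T : set V) v : (forall u, S u -> T u) -> lspan S v -> lspan T v.
Proof.
move=> ST; apply: (@lspan_min S) => [|a u w|u /ST/sub_lspan//].
  exact: lspan0.
exact: lspanP.
Qed.

End Span.

Section Brackets.
Variables (k : fieldType) (L : lieAlgType k).
Implicit Types x y z : L.

Lemma lieDl x y z : ⁅x + y, z⁆ = ⁅x, z⁆ + ⁅y, z⁆.
Proof. by rewrite -[x]scale1r lie_linearl !scale1r. Qed.

Lemma lieC x y : ⁅x, y⁆ = - ⁅y, x⁆.
Proof.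
apply/eqP; rewrite -addr_eq0; apply/eqP.
have := liexx (x + y); rewrite lieDl !(linearD (lie _)) /=.
by rewrite !liexx add0r addr0.
Qed.

Lemma lie_bracket x y z : ⁅⁅x, y⁆, z⁆ = ⁅x, ⁅y, z⁆⁆ - ⁅y, ⁅x, z⁆⁆.
Proof.
apply/eqP; rewrite lieC [⁅x, z⁆]lieC (linearN (lie y)) opprK /= eqr_oppLR.
by rewrite -addr_eq0 addrC lie_jacobi.
Qed.

End Brackets.

(** The identities L_[x,y] = [L_x, L_y], [d, L_x] = 0 and d^2 = 0, derived from the
    formulas for d i_x and L_x i_y alone ([M] is left multiplication, [U] the Lie
    derivative, [A] the differential).  Stated for abstract operators because they
    are needed for two complexes: the trivial and the adjoint coefficients. *)

Section Cartan.
Variables (k : fieldType) (L : lieAlgType k) (W : lmodType k).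
Variables (A : {linear W -> W}) (M U : L -> {linear W -> W}) (B : set W).
Hypothesis gen : forall F : {linear W -> W},
  (forall b s, B b -> F (foldr M b s) = 0) -> forall w, F w = 0.
Hypothesis ML : forall a x y w, M (a *: x + y) w = a *: M x w + M y w.
Hypothesis AM : forall x w, A (M x w) = U x w - M x (A w).
Hypothesis UM : forall x y w, U x (M y w) = M ⁅x, y⁆ w + M y (U x w).
Hypothesis UUB : forall x y b, B b -> U ⁅x, y⁆ b = U x (U y b) - U y (U x b).
Hypothesis AB : forall b, B b -> A b = 0.
Hypothesis AUB : forall x b, B b -> A (U x b) = 0.

Let MB x y w : M (x - y) w = M x w - M y w.
Proof. by have := ML (-1) y x w; rewrite !scaleN1r addrC [in RHS]addrC. Qed.

Let gen2 (F G : {linear W -> W}) :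
  (forall b, B b -> F b = G b) ->
  (forall x w, F w = G w -> F (M x w) = G (M x w)) -> forall w, F w = G w.
Proof.
move=> FGB FGM w; apply/eqP; rewrite -subr_eq0; apply/eqP.
pose H : {linear W -> W} := F \- G; rewrite -[LHS]/(H w).
apply: gen => b s Bb; rewrite /H /=; apply/eqP; rewrite subr_eq0; apply/eqP.
by elim: s => [|x s ih] /=; [apply: FGB|apply: FGM].
Qed.

Lemma cartan_bracket x y w : U ⁅x, y⁆ w = U x (U y w) - U y (U x w).
Proof.
pose G : {linear W -> W} := (U x \o U y) \- (U y \o U x).
rewrite -[RHS]/(G w); move: w; apply: gen2 => [b|z w]; first exact: UUB.
rewrite /G /= => ih; rewrite !UM (linearD (U x)) (linearD (U y)) /= !UM ih.
rewrite lie_bracket MB (linearB (M z)) /=.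
rewrite !opprD !addrA [RHS](ACl (1*5*(4*8)*(2*7)*(3*6))%AC) /=.
by rewrite !subrr !addr0 addrA.
Qed.

Lemma cartan_comm x w : A (U x w) = U x (A w).
Proof.
move: w; apply: (gen2 (F := A \o U x) (G := U x \o A)) => [b Bb|y w] /=.
  by rewrite AUB// AB// linear0.
move=> ih; rewrite UM AM (linearD A) /= !AM (linearB (U x)) /= UM cartan_bracket ih.
rewrite opprD !addrA; congr (_ - _).
by rewrite addrAC subrK.
Qed.

Lemma cartan_square w : A (A w) = 0.
Proof.
move: w; apply: (gen2 (F := A \o A) (G := \0)) => [b Bb|y w] /=.
  by rewrite (AB Bb) linear0.
by move=> ih; rewrite AM (linearB A) /= AM cartan_comm ih linear0 subr0 subrr.
Qed.

End Cartan.

Section Chevalley.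
Variables (k : fieldType) (L : lieAlgType k).
Implicit Types (x y f : L) (s : seq L) (w : ext L).

Lemma foldr_lmulw s : foldr (fun x => lmulw x) (wedge [::]) s = wedge s.
Proof. by elim: s => //= x s ->; rewrite lmulwE. Qed.

Definition lie_der x : {linear ext L -> ext L} := elift (der_term_alternating (lie x)).

Lemma lie_derE x s : lie_der x (wedge s) = der_term (lie x) s.
Proof. exact: eliftE. Qed.

Lemma lie_der_nil x : lie_der x (wedge [::]) = 0.
Proof. by rewrite lie_derE /der_term big_ord0. Qed.

Lemma ce_diff_nil : ce_diff L (wedge [::]) = 0.
Proof. by rewrite ce_diffE /ce_term big_ord0. Qed.

Lemma lie_der_lmulw x y w :
  lie_der x (lmulw y w) = lmulw ⁅x, y⁆ w + lmulw y (lie_der x w).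
Proof.
pose F : {linear ext L -> ext L} := lie_der x \o lmulw y.
pose G : {linear ext L -> ext L} := lmulw ⁅x, y⁆ \+ (lmulw y \o lie_der x).
rewrite -[LHS]/(F w) -[RHS]/(G w); move: w; apply: ext_ext => s.
rewrite /F /G /= (lmulwE y s) (lmulwE ⁅x, y⁆ s) (lie_derE x (y :: s)) (lie_derE x s).
exact: der_term_cons.
Qed.

Lemma ce_diff_lmulw x w :
  ce_diff L (lmulw x w) = - lie_der x w - lmulw x (ce_diff L w).
Proof.
pose F : {linear ext L -> ext L} := ce_diff L \o lmulw x.
pose G : {linear ext L -> ext L} := (\- lie_der x) \- (lmulw x \o ce_diff L).
rewrite -[LHS]/(F w) -[RHS]/(G w); move: w; apply: ext_ext => s.
rewrite /F /G /= (lmulwE x s) (ce_diffE (x :: s)) (ce_diffE s) (lie_derE x s).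
exact: ce_term_cons.
Qed.

(** With [ce_diff] the Cartan formula reads d(x w) = - L_x w - x d(w): the calculus
    applies to its opposite. *)
Lemma ce_diff_square w : ce_diff L (ce_diff L w) = 0.
Proof.
pose A : {linear ext L -> ext L} := \- ce_diff L.
suff : A (A w) = 0 by rewrite /A /= (linearN (ce_diff L)) opprK.
apply: (@cartan_square k L _ A (@lmulw k L) lie_der [set wedge [::]]).
- move=> F F0; pose Z : {linear ext L -> ext L} := \0.
  apply: (@ext_ext _ _ _ F Z) => s.
  by have := F0 (wedge [::]) s erefl; rewrite foldr_lmulw.
- exact: (lmulw_bilin L).1.
- by move=> x v; rewrite /A /= ce_diff_lmulw (linearN (lmulw x)) opprK opprB opprK addrC.
- exact: lie_der_lmulw.
- by move=> x y b ->; rewrite !lie_der_nil (linear0 (lie_der x)) (linear0 (lie_der y)) subr0.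
- by move=> b ->; rewrite /A /= ce_diff_nil oppr0.
- by move=> x b ->; rewrite lie_der_nil; apply: (linear0 A).
Qed.

End Chevalley.

Lemma map_delat (T U : Type) (f : T -> U) i s : map f (delat i s) = delat i (map f s).
Proof. by rewrite /delat map_cat map_take map_drop. Qed.

Lemma size_delat (T : Type) i (s : seq T) : (i < size s)%N -> size (delat i s) = (size s).-1.
Proof. by move=> i_s; rewrite size_cat size_takel ?size_drop; lia. Qed.

Section TensorWedge.
Variables (k : fieldType) (V V' W : lmodType k).

Lemma tens_wedge_ext (F G : {linear tens V (ext V') -> W}) :
  (forall f s, F (tensor f (wedge s)) = G (tensor f (wedge s))) -> F =1 G.
Proof.
move=> FG; apply: presented_ext => -[f w]; move: w.
by apply: (@ext_ext _ _ _ (F \o tensor f) (G \o tensor f)) => s; apply: FG.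
Qed.

(** Extensionality for functions that agree with linear maps; giving the linear
    maps apart keeps the statements about their values in normal form. *)
Lemma tens_wedge_eq (F G : {linear tens V (ext V') -> W}) F' G' :
  F =1 F' -> G =1 G' ->
  (forall f s, F' (tensor f (wedge s)) = G' (tensor f (wedge s))) -> F' =1 G'.
Proof.
move=> FF GG FG z; rewrite -FF -GG; move: z.
by apply: tens_wedge_ext => f s; rewrite FF GG.
Qed.

End TensorWedge.

Lemma tensorNl (k : fieldType) (V W : lmodType k) (v : V) (w : W) :
  tensor (- v) w = - tensor v w.
Proof.
have := tensorPl (-1) v v w; rewrite !scaleN1r addNr => t0.
have := tensorPl (-1) v 0 w; rewrite !scaleN1r addr0 => ->.
by rewrite t0 addNr addr0.
Qed.

Lemma tensorDl (k : fieldType) (V W : lmodType k) (u v : V) (w : W) :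
  tensor (u + v) w = tensor u w + tensor v w.
Proof. by have := tensorPl 1 u v w; rewrite (scale1r u) (scale1r (tensor u w)). Qed.

Section TensorMap.
Variables (k : fieldType) (V V' W W' : lmodType k).
Variables (P : {linear V -> V'}) (Q : {linear W -> W'}).

Lemma tens_map_bilin : bilin (fun v w => tensor (P v) (Q w)).
Proof. by split=> *; rewrite linearP ?tensorPl ?tensorPr. Qed.

Definition tens_map : {linear tens V W -> tens V' W'} := tlift tens_map_bilin.

Lemma tens_mapE v w : tens_map (tensor v w) = tensor (P v) (Q w).
Proof. exact: tliftE. Qed.

End TensorMap.

Section AdjointComplex.
Variables (k : fieldType) (L : lieAlgType k).
Local Notation adj := (adj_complex L).
Implicit Types (x y f : L) (s : seq L) (w : ext L) (z : adj).

Definition adj_lmul x : {linear adj -> adj} := tens_map idfun (lmulw x).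

Lemma adj_lmulE x f w : adj_lmul x (tensor f w) = tensor f (lmulw x w).
Proof. exact: tens_mapE. Qed.

Definition adj_der x : {linear adj -> adj} :=
  tens_map (lie x) idfun \+ tens_map idfun (lie_der x).

Lemma adj_derE x f w : adj_der x (tensor f w) = tensor ⁅x, f⁆ w + tensor f (lie_der x w).
Proof. by rewrite /adj_der /= (tens_mapE (lie x) idfun f w) (tens_mapE idfun (lie_der x) f w). Qed.

Lemma adj_lmulP a x y z : adj_lmul (a *: x + y) z = a *: adj_lmul x z + adj_lmul y z.
Proof.
pose G : {linear adj -> adj} := a \*: adj_lmul x \+ adj_lmul y.
rewrite -[RHS]/(G z); move: z; apply: tens_wedge_ext => f s.
rewrite /G /= (adj_lmulE _ f) (adj_lmulE x f) (adj_lmulE y f) (lmulw_bilin L).1.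
exact: tensorPr.
Qed.

Lemma adj_diff_lmul x z :
  adj_diff L (adj_lmul x z) = adj_der x z - adj_lmul x (adj_diff L z).
Proof.
move: z; apply: (@tens_wedge_eq _ _ _ _ (adj_diff L \o adj_lmul x)
  (adj_der x \- (adj_lmul x \o adj_diff L))) => // f s.
rewrite (adj_lmulE x f) (lmulwE x s) (adj_derE x f) (adj_diffE f) (adj_diffE f).
rewrite !adj_termE ce_term_cons (lie_derE x s) big_ord_recl expr1 scaleN1r.
rewrite (_ : delat (@ord0 (size s)) (x :: s) = s); last by rewrite /delat /= drop0.
rewrite (linearB (adj_lmul x)) (adj_lmulE x f).
rewrite (linearB (tensor f)) (linearN (tensor f)) opprD !opprK opprB.
rewrite (_ : tensor ⁅f, (x :: s)`_ord0⁆ (wedge s) = - tensor ⁅x, f⁆ (wedge s)); last first.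
  by rewrite /= lieC tensorNl.
rewrite opprK -!addrA; congr (_ + _); rewrite addrCA; congr (_ + _).
rewrite addrC; congr (_ + _).
rewrite (linear_sum (adj_lmul x)) -sumrN; apply: eq_bigr => i _.
rewrite (linearZZ (adj_lmul x)) (adj_lmulE x) (lmulwE x) -scaleNr.
by rewrite [in LHS]exprS mulN1r.
Qed.

Lemma adj_der_lmul x y z :
  adj_der x (adj_lmul y z) = adj_lmul ⁅x, y⁆ z + adj_lmul y (adj_der x z).
Proof.
move: z; apply: (@tens_wedge_eq _ _ _ _ (adj_der x \o adj_lmul y)
  (adj_lmul ⁅x, y⁆ \+ (adj_lmul y \o adj_der x))) => // f s.
rewrite !(adj_lmulE y f) (adj_derE x f) (adj_derE x f) (adj_lmulE ⁅x, y⁆ f).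
rewrite (linearD (adj_lmul y)) (adj_lmulE y f) (adj_lmulE y ⁅x, f⁆).
by rewrite lie_der_lmulw (linearD (tensor f)) addrCA.
Qed.

Lemma adj_diff_nil f : adj_diff L (tensor f (wedge [::])) = 0.
Proof. by rewrite adj_diffE /adj_term !big_ord0 addr0. Qed.

Lemma adj_der_nil x f : adj_der x (tensor f (wedge [::])) = tensor ⁅x, f⁆ (wedge [::]).
Proof. by rewrite adj_derE lie_der_nil (linear0 (tensor f)) addr0. Qed.

Lemma foldr_adj_lmul f s :
  foldr (fun x => adj_lmul x) (tensor f (wedge [::])) s = tensor f (wedge s).
Proof. by elim: s => //= x s ->; rewrite adj_lmulE lmulwE. Qed.

Lemma adj_diff_square z : adj_diff L (adj_diff L z) = 0.
Proof.
move: z; apply: (@cartan_square k L _ (adj_diff L) adj_lmul adj_der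
  [set z | exists f, z = tensor f (wedge [::])]).
- move=> F F0; apply: (@tens_wedge_ext _ _ _ _ F \0) => f s.
  by rewrite -foldr_adj_lmul F0//; exists f.
- exact: adj_lmulP.
- exact: adj_diff_lmul.
- exact: adj_der_lmul.
- move=> x y _ [f ->]; rewrite !adj_der_nil lie_bracket -tensorNl.
  exact: tensorDl.
- by move=> _ [f ->]; apply: adj_diff_nil.
- by move=> x _ [f ->]; rewrite adj_der_nil adj_diff_nil.
Qed.

Lemma adj_to_ce_lmul x z : adj_to_ce L (adj_lmul x z) = - lmulw x (adj_to_ce L z).
Proof.
move: z; apply: (@tens_wedge_eq _ _ _ _ (adj_to_ce L \o adj_lmul x)
  (\- (lmulw x \o adj_to_ce L))) => // f s.
rewrite (adj_lmulE x f) (lmulwE x s) (adj_to_ceE f) (adj_to_ceE f) (lmulwE x).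
exact: wedge_swap.
Qed.

Lemma adj_to_ce_der x z : adj_to_ce L (adj_der x z) = lie_der x (adj_to_ce L z).
Proof.
move: z; apply: (@tens_wedge_eq _ _ _ _ (adj_to_ce L \o adj_der x)
  (lie_der x \o adj_to_ce L)) => // f s.
rewrite (adj_derE x f) (linearD (adj_to_ce L)) (adj_to_ceE ⁅x, f⁆) (adj_to_ceE f).
rewrite -(lmulwE f s) lie_der_lmulw lmulwE; congr (_ + _).
exact: tliftE.
Qed.

(** The map I is a chain map: it intertwines the left multiplications up to sign and
    the Lie derivatives exactly, hence the differentials. *)
Lemma adj_to_ce_diff z : adj_to_ce L (adj_diff L z) = ce_diff L (adj_to_ce L z).
Proof.
move: z; apply: (@tens_wedge_ext _ _ _ _ (adj_to_ce L \o adj_diff L)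
  (ce_diff L \o adj_to_ce L)) => f s.
rewrite -[LHS]/(adj_to_ce L (adj_diff L _)) -[RHS]/(ce_diff L (adj_to_ce L _)).
rewrite -(foldr_adj_lmul f s); elim: s => [|x s ih].
  rewrite [foldr _ _ _]/= adj_diff_nil (linear0 (adj_to_ce L)) adj_to_ceE ce_diffE.
  by rewrite /ce_term !(big_ord_recl, big_ord0) addr0.
rewrite [foldr _ _ _]/=; move: (foldr _ _ _) ih => z ih.
rewrite (adj_diff_lmul x z) (linearB (adj_to_ce L)) (adj_to_ce_lmul x z).
rewrite (adj_to_ce_lmul x (adj_diff L z)) (adj_to_ce_der x z) ih opprK.
rewrite (linearN (ce_diff L)) (ce_diff_lmulw x (adj_to_ce L z)).
by rewrite opprB opprK addrC.
Qed.

End AdjointComplex.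

Section LieMorphism.
Variables (k : fieldType) (L L' : lieAlgType k) (E : {linear L -> L'}).
Hypothesis EL : forall x y, E ⁅x, y⁆ = ⁅E x, E y⁆.

Definition adj_map : {linear adj_complex L -> adj_complex L'} := tens_map E (ext_map E).

Lemma adj_mapE f s : adj_map (tensor f (wedge s)) = tensor (E f) (wedge (map E s)).
Proof. by rewrite /adj_map tens_mapE ext_mapE. Qed.

Lemma adj_map_diff z : adj_diff L' (adj_map z) = adj_map (adj_diff L z).
Proof.
move: z; apply: (@tens_wedge_eq _ _ _ _ (adj_diff L' \o adj_map)
  (adj_map \o adj_diff L)) => // f s.
rewrite (adj_mapE f s) (adj_diffE (E f)) (adj_diffE f) /adj_term size_map.
rewrite (linearD adj_map) !(linear_sum adj_map); congr (_ + _).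
  apply: eq_bigr => i _; rewrite (linearZZ adj_map) (adj_mapE _ (delat i s)) EL.
  by rewrite map_delat (nth_map 0).
apply: eq_bigr => j _; rewrite (linear_sum adj_map); apply: eq_bigr => i _.
rewrite (linearZZ adj_map) (adj_mapE f) /= EL !map_delat.
by rewrite (nth_map 0) ?(nth_map 0) //; apply: ltn_trans (ltn_ord i) _.
Qed.

Lemma adj_map_to_ce z : adj_to_ce L' (adj_map z) = ext_map E (adj_to_ce L z).
Proof.
move: z; apply: (@tens_wedge_eq _ _ _ _ (adj_to_ce L' \o adj_map)
  (ext_map E \o adj_to_ce L)) => // f s.
by rewrite (adj_mapE f s) (adj_to_ceE (E f)) (adj_to_ceE f) (ext_mapE E (f :: s)).
Qed.

End LieMorphism.

(** * Chains with a letter in an ideal *)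

Section IdealSpans.
Variables (k : fieldType) (L : lieAlgType k).
Implicit Types (J : set L) (x y f : L) (s : seq L) (w : ext L).

Lemma ce_idealP J r a u v : ce_ideal J r u -> ce_ideal J r v -> ce_ideal J r (a *: u + v).
Proof. by case: r => [|r]; apply: lspanP. Qed.

Lemma ce_ideal0 J r : ce_ideal J r 0.
Proof. by case: r => [|r]; apply: lspan0. Qed.

Lemma ce_idealD J r u v : ce_ideal J r u -> ce_ideal J r v -> ce_ideal J r (u + v).
Proof. by case: r => [|r]; apply: lspanD. Qed.

Lemma ce_idealZ J r a u : ce_ideal J r u -> ce_ideal J r (a *: u).
Proof. by case: r => [|r]; apply: lspanZ. Qed.

Lemma ce_idealN J r u : ce_ideal J r u -> ce_ideal J r (- u).
Proof. by case: r => [|r]; apply: lspanN. Qed.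

Lemma ce_idealB J r u v : ce_ideal J r u -> ce_ideal J r v -> ce_ideal J r (u - v).
Proof. by move=> Ju /ce_idealN; apply: ce_idealD. Qed.

Lemma ce_ideal_wedge J x s : J x -> ce_ideal J (size s).+1 (wedge (x :: s)).
Proof. by move=> Jx; apply: sub_lspan; exists x, s. Qed.

Lemma ce_idealS J J' r w : (forall x, J x -> J' x) -> ce_ideal J r w -> ce_ideal J' r w.
Proof.
move=> JJ; case: r => [|r]; apply: lspanS => // u [x [s [Jx sr ->]]].
by exists x, s; split => //; apply: JJ.
Qed.

Lemma ce_ideal_map J J' (F : {linear L -> L}) r w :
  (forall x, J x -> J' (F x)) -> ce_ideal J r w -> ce_ideal J' r (ext_map F w).
Proof.
move=> JF; case: r => [|r].
  by apply: lspan_linear => _ ->; rewrite ext_mapE; apply: sub_lspan.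
apply: lspan_linear => _ [x [s [Jx sr ->]]].
rewrite (ext_mapE F (x :: s)) -sr -(size_map F s); apply: ce_ideal_wedge.
exact: JF.
Qed.

Lemma ce_ideal_lmulw J r x w : ce_ideal J r.+1 w -> ce_ideal J r.+2 (lmulw x w).
Proof.
apply: (@lspan_linear _ _ _ _ _ (lmulw x)) => _ [y [s [Jy sr ->]]].
rewrite (lmulwE x (y :: s)) wedge_swap; apply: lspanN.
by rewrite -sr; apply: (@ce_ideal_wedge J y (x :: s)).
Qed.

(** The functor of exterior powers sends [F] to an operator congruent to the
    identity modulo the ideal [J] as soon as [F] is: change one letter at a time. *)
Lemma ext_map_sub J (F : {linear L -> L}) r w : (forall x, J (x - F x)) ->
  ce_ideal setT r.+1 w -> ce_ideal J r.+1 (w - ext_map F w).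
Proof.
move=> JF; pose D : {linear ext L -> ext L} := idfun \- ext_map F.
rewrite -[w - _]/(D w).
apply: (@lspan_linear _ _ _ _ _ D) => _ [x [s [_ sr ->]]].
rewrite /D /= -/(ext_map F) => {D}; rewrite -[X in _ - X]/(ext_map F (wedge _)) ext_mapE.
elim: s r x sr => [|y s ih] [|r] // x sr; rewrite [map _ _]/=.
  have -> : wedge [:: x] - wedge [:: F x] = wedge [:: x - F x].
    have := (wedge_alternating L).1 [::] [::] (-1) (F x) x.
    by rewrite !scaleN1r addrC [RHS]addrC.
  exact: (@ce_ideal_wedge J (x - F x) [::]).
have -> : wedge [:: x, y & s] - wedge [:: F x, F y & map F s] =
  wedge [:: x - F x, y & s] + lmulw (F x) (wedge (y :: s) - wedge (F y :: map F s)).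
  have := (wedge_alternating L).1 [::] (y :: s) (-1) (F x) x.
  rewrite /= !scaleN1r [- F x + x]addrC => ->.
  by rewrite (linearB (lmulw (F x))) !lmulwE addrA [X in _ = X - _]addrAC addNr add0r.
apply: lspanD; last by apply: (@ce_ideal_lmulw J r); apply: ih; case: sr.
by case: sr => <-; apply: (@ce_ideal_wedge J (x - F x) (y :: s)).
Qed.

Lemma ce_ideal_diff J r w : (forall x y, J x -> J ⁅x, y⁆) ->
  ce_ideal J r.+2 w -> ce_ideal J r.+1 (ce_diff L w).
Proof.
move=> JL; apply: lspan_linear => _ [x [s [Jx sr ->]]].
rewrite ce_diffE ce_term_cons; apply: lspanB.
  apply: lspanN; rewrite /der_term; apply: lspan_sum => m _; apply: lspanZ.
  have -> : r = size (delat m s) by rewrite size_delat// sr.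
  by apply: ce_ideal_wedge; apply: JL.
rewrite /ce_term (linear_sum (lmulw x)); apply: lspan_sum => j _.
rewrite (linear_sum (lmulw x)); apply: lspan_sum => i _.
rewrite (linearZZ (lmulw x)); apply: lspanZ.
rewrite (lmulwE x).
have ij : (i < size (delat j s))%N.
  by rewrite size_delat//; apply: leq_trans (ltn_ord i) _; rewrite -ltnS (ltn_predK (ltn_ord j)).
have -> : r = size (⁅s`_i, s`_j⁆ :: delat i (delat j s)).
  by have := size_delat (ltn_ord j); have := size_delat ij; move=> /=; lia.
exact: ce_ideal_wedge.
Qed.

Definition adj_ideal J r : set (adj_complex L) :=
  lspan [set z | exists x s, [/\ J x, size s = r & z = tensor x (wedge s)]].

Lemma adj_to_ce_ideal J r z : adj_ideal J r z -> ce_ideal J r.+1 (adj_to_ce L z).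
Proof.
apply: (@lspan_linear _ _ _ _ _ (adj_to_ce L)) => _ [x [s [Jx <- ->]]].
by rewrite (adj_to_ceE x s); apply: ce_ideal_wedge.
Qed.

Lemma adj_ideal_map J J' (F : {linear L -> L}) r z : (forall x, J x -> J' (F x)) ->
  adj_ideal J r z -> adj_ideal J' r (tens_map F idfun z).
Proof.
move=> JF; apply: (@lspan_linear _ _ _ _ _ (tens_map F idfun)) => _ [x [s [Jx sr ->]]].
rewrite tens_mapE; apply: sub_lspan; exists (F x), s; split => //.
exact: JF.
Qed.

Lemma adj_ideal_diff J r z : (forall x y, J x -> J ⁅x, y⁆) ->
  adj_ideal J r z -> adj_ideal J r.-1 (adj_diff L z).
Proof.
move=> JL; apply: (@lspan_linear _ _ _ _ _ (adj_diff L)) => _ [x [s [Jx sr ->]]].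
rewrite (adj_diffE x s) /adj_term; apply: lspanD; apply: lspan_sum => j _.
  apply: lspanZ; apply: sub_lspan; exists ⁅x, s`_j⁆, (delat j s); split => //.
    exact: JL.
  by rewrite size_delat// sr.
apply: lspan_sum => i _; apply: lspanZ; apply: sub_lspan.
exists x, (⁅s`_i, s`_j⁆ :: delat i (delat j s)); split => //=.
have ij : (i < size (delat j s))%N.
  by rewrite size_delat//; apply: leq_trans (ltn_ord i) _; rewrite -ltnS (ltn_predK (ltn_ord j)).
by have := size_delat (ltn_ord j); have := size_delat ij; lia.
Qed.

End IdealSpans.

Section Commutator.
Variables (k : fieldType) (A : assocAlgType k) (P : {linear A -> A}).
Hypothesis PM : forall x y, P (x ⋅ y) = P x ⋅ y.
Local Notation L := (comm_lie A).

Definition adj_cut : {linear adj_complex L -> adj_complex L} :=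
  tens_map (P : {linear L -> L}) idfun.

(** The commutator of the differential with a right-linear [P] acting on the
    coefficient.  The terms that do not touch the coefficient cancel, and
    [P (f s) = P f s] turns the others into [P, s] f. *)
Lemma adj_cut_diff (f : L) (s : seq L) :
  adj_diff L (adj_cut (tensor f (wedge s))) - adj_cut (adj_diff L (tensor f (wedge s))) =
  \sum_(i < size s) (-1) ^+ i.+1 *:
    tensor (P ((s`_i : A) ⋅ f) - (s`_i : A) ⋅ P f : L) (wedge (delat i s)).
Proof.
rewrite /adj_cut (tens_mapE (P : {linear L -> L}) idfun f) (adj_diffE (P f : L) s) (adj_diffE f s).
rewrite /adj_term (linearD (tens_map _ _)) opprD addrACA.
rewrite !(linear_sum (tens_map (P : {linear L -> L}) idfun)) -!sumrB.
rewrite [X in _ + X]big1 ?addr0 => [|j _]; last first.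
  rewrite (linear_sum (tens_map (P : {linear L -> L}) idfun)) -sumrB big1// => i _.
  rewrite (linearZZ (tens_map (P : {linear L -> L}) idfun)).
  by rewrite (tens_mapE (P : {linear L -> L}) idfun f) subrr.
apply: eq_bigr => i _.
rewrite (linearZZ (tens_map (P : {linear L -> L}) idfun)).
rewrite (tens_mapE (P : {linear L -> L}) idfun) -scalerBr -tensorNl -tensorDl.
congr (_ *: tensor _ _); rewrite /lie /= /commutator (linearB P) /= !PM opprB.
by rewrite addrC addrA subrK.
Qed.

End Commutator.

(** * A zigzag starting from a lifted cycle *)

Section Signs.
Variable n : nat.
Implicit Types (s : signs n) (i j : 'I_n).

Lemma szeroE s i j : szero s i j = if j == i then None else s j.
Proof. by rewrite ffunE. Qed.

Lemma card_ord_count (P : pred 'I_n) :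
  #|[set j | P j]%SET| = count P (enum 'I_n).
Proof. by rewrite cardsE cardE -size_filter enumT. Qed.

Lemma sdegE s : sdeg s = (count (fun j => s j == None) (enum 'I_n)).+1.
Proof.
by rewrite /sdeg card_ord_count.
Qed.

Lemma sdeg_szero s i : s i != None -> sdeg (szero s i) = (sdeg s).+1.
Proof.
move=> si; rewrite /sdeg (cardsD1 i) inE szeroE eqxx /=; congr _.+2.
apply: eq_card => j; rewrite !inE szeroE.
by case: eqP => // ->; rewrite (negbTE si).
Qed.

Lemma sdeg1 s : (sdeg s == 1%N) = [forall i, s i != None].
Proof.
rewrite sdegE eqSS -leqn0 leqNgt -has_count -all_predC.
by apply/allP/forallP => s0 i; [apply: s0; rewrite mem_enum|move=> _; apply: s0].
Qed.

End Signs.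

Section Existence.
Variables (k : fieldType) (n : nat) (g : finLieAlgType k).
Local Notation A := (iter_band (endo g) n).
Local Notation G := (tate_lie n g).
Local Notation adj := (adj_complex G).
Implicit Types (z : adj) (s : signs n) (i : 'I_n).

Definition rows (w : ('I_n -> int) -> k) : {linear G -> G} := (rowscale w : {linear A -> A}).

Definition adj_rows (w : ('I_n -> int) -> k) : {linear adj -> adj} := tens_map (rows w) idfun.

Lemma adj_rowsE w (f : G) u : adj_rows w (tensor f u) = tensor (rows w f) u.
Proof. exact: tens_mapE. Qed.

Lemma adj_rowsD w v z : adj_rows (fun r => w r + v r) z = adj_rows w z + adj_rows v z.
Proof.
move: z; apply: (@tens_wedge_eq _ _ _ _ (adj_rows (fun r => w r + v r))
  (adj_rows w \+ adj_rows v)) => // f s.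
rewrite !(adj_rowsE _ f) -tensorDl; congr tensor.
exact: (rowscaleD w v (f : A)).
Qed.

Lemma adj_rows_comp w v z : adj_rows w (adj_rows v z) = adj_rows (fun r => w r * v r) z.
Proof.
move: z; apply: (@tens_wedge_eq _ _ _ _ (adj_rows w \o adj_rows v)
  (adj_rows (fun r => w r * v r))) => // f s.
rewrite (adj_rowsE v f) (adj_rowsE w) (adj_rowsE _ f); congr tensor.
exact: (rowscale_comp w v (f : A)).
Qed.

Lemma adj_rows1 z : adj_rows (fun=> 1) z = z.
Proof.
move: z; apply: (@tens_wedge_eq _ _ _ _ (adj_rows (fun=> 1)) idfun) => // f s.
rewrite (adj_rowsE _ f); congr tensor.
exact: (rowscale1 (f : A)).
Qed.

Lemma adj_rows0 z : adj_rows (fun=> 0) z = 0.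
Proof.
by apply: (addrI (adj_rows (fun=> 0) z)); rewrite -adj_rowsD !addr0.
Qed.

Lemma adj_rows_sum I (l : seq I) (P : pred I) (w : I -> ('I_n -> int) -> k) z :
  \sum_(i <- l | P i) adj_rows (w i) z = adj_rows (fun r => \sum_(i <- l | P i) w i r) z.
Proof.
elim: l => [|i l ih].
  by rewrite big_nil -(adj_rows0 z); congr (adj_rows _ z); apply/funext => r; rewrite big_nil.
rewrite big_cons {}ih -adj_rowsD; case: ifP => Pi; congr (adj_rows _ z); apply/funext => r.
  by rewrite big_cons Pi.
by rewrite big_cons Pi.
Qed.

Definition sign_wt (b : bool) i (r : 'I_n -> int) : k :=
  if b then nonneg_wt k i r else 1 - nonneg_wt k i r.

Lemma adj_rows_compl i z : adj_rows (sign_wt false i) z = z - adj_rows (nonneg_wt k i) z.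
Proof.
apply/eqP; rewrite eq_sym subr_eq -adj_rowsD -[X in X == _]adj_rows1; apply/eqP.
by congr (adj_rows _ z); apply/funext => r; rewrite subrK.
Qed.

(** The operators o_i(+) = p_i, o_i(-) = - (1 - p_i) and o_i(0) = [d, p_i].  Since p_i
    acts on the coefficient only, it is well defined here, whereas it has no
    analogue on the exterior algebra: this is what a lift is used for. *)
Definition tate_op (e : option bool) i : {linear adj -> adj} :=
  match e with
  | Some true => adj_rows (sign_wt true i)
  | Some false => \- adj_rows (sign_wt false i)
  | None => (adj_diff G \o adj_rows (nonneg_wt k i)) \- (adj_rows (nonneg_wt k i) \o adj_diff G)
  end.

Lemma tate_op_posE i z : tate_op (Some true) i z = adj_rows (nonneg_wt k i) z. Proof. by []. Qed.
Lemma tate_op_negE i z : tate_op (Some false) i z = adj_rows (nonneg_wt k i) z - z.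
Proof. by rewrite -[LHS]/(- adj_rows (sign_wt false i) z) adj_rows_compl opprB. Qed.
Lemma tate_op_zeroE i z :
  tate_op None i z =
  adj_diff G (adj_rows (nonneg_wt k i) z) - adj_rows (nonneg_wt k i) (adj_diff G z).
Proof. by []. Qed.

Lemma tate_op_diff_zero i z :
  adj_diff G (tate_op None i z) = - tate_op None i (adj_diff G z).
Proof.
rewrite (tate_op_zeroE i z) (tate_op_zeroE i (adj_diff G z)).
have := @adj_diff_square k G; move: (adj_diff G) (adj_rows (nonneg_wt k i)) => D P DD.
by rewrite (linearB D) /= !DD (linear0 P) subr0 sub0r.
Qed.

(** The sign in o_i(-) makes the commutators with d of both signs equal, because
    p_i and - (1 - p_i) differ by the identity. *)
Lemma tate_op_diff_sign b i z :
  adj_diff G (tate_op (Some b) i z) = tate_op (Some b) i (adj_diff G z) + tate_op None i z.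
Proof.
rewrite (tate_op_zeroE i z); case: b.
  rewrite (tate_op_posE i z) (tate_op_posE i (adj_diff G z)).
  by move: (adj_diff G) (adj_rows (nonneg_wt k i)) => D P; rewrite [RHS]addrC subrK.
rewrite (tate_op_negE i z) (tate_op_negE i (adj_diff G z)).
move: (adj_diff G) (adj_rows (nonneg_wt k i)) => D P.
by rewrite (linearB D) /= [RHS]addrC addrA subrK.
Qed.

Definition tate_ops s (l : seq 'I_n) z : adj := foldr (fun i => tate_op (s i) i) z l.

Lemma tate_ops_eq s s' (l : seq 'I_n) z : {in l, s =1 s'} -> tate_ops s l z = tate_ops s' l z.
Proof.
elim: l => //= i l ih ss; rewrite (ss i) ?mem_head// ih// => j jl.
by apply: ss; rewrite inE jl orbT.
Qed.

(** Moving d through the ordered product o_1(s_1) ... o_n(s_n): each nonzero sign is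
    replaced by 0 once, and each 0 to its left contributes a change of sign. *)
Lemma tate_ops_diff s (l : seq 'I_n) z : sorted ltn [seq nat_of_ord i | i <- l] ->
  adj_diff G z = 0 ->
  adj_diff G (tate_ops s l z) =
  \sum_(i <- l | s i != None)
    (-1) ^+ count (fun j : 'I_n => (j < i)%N && (s j == None)) l *: tate_ops (szero s i) l z.
Proof.
move=> + dz; elim: l => [|i l ih] /= ls; first by rewrite big_nil.
have il : forall j, j \in l -> (i < j)%N.
  move=> j jl; have /allP := order_path_min ltn_trans ls; apply.
  exact: map_f.
have {}ih := ih (path_sorted ls).
have inl : i \notin l by apply/negP => /il; rewrite ltnn.
rewrite big_cons /=.
have rest : \sum_(j <- l | s j != None)
    (-1) ^+ ((i < j)%N && (s i == None) + count (fun j' : 'I_n => (j' < j)%N && (s j' == None)) l)%N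
      *: tate_op (szero s j i) i (tate_ops (szero s j) l z) =
    (-1) ^+ (s i == None) *: tate_op (s i) i (adj_diff G (tate_ops s l z)).
  rewrite ih (linear_sum (tate_op (s i) i)) scaler_sumr [LHS]big_seq_cond [RHS]big_seq_cond.
  apply: eq_bigr => j /andP[jl _]; rewrite il//= szeroE.
  have -> : (i == j) = false by apply/negP => /eqP ij; rewrite ij jl in inl.
  by rewrite (linearZZ (tate_op (s i) i)) scalerA -exprD.
rewrite {}rest; case si : (s i) => [b|] /=.
  rewrite tate_op_diff_sign scale1r szeroE eqxx ltnn /= [RHS]addrC; congr (_ + _).
  rewrite (_ : count _ l = 0%N) ?scale1r; last first.
    apply/eqP; rewrite -leqn0 leqNgt -has_count; apply/hasPn => j jl.
    by rewrite ltnNge (ltnW (il j jl)).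
  congr (tate_op None i _); apply: tate_ops_eq => j jl; rewrite szeroE.
  by case: eqP => // ji; rewrite -ji jl in inl.
by rewrite tate_op_diff_zero scaleN1r.
Qed.

End Existence.

Section System.
Variables (k : fieldType) (n : nat) (g : finLieAlgType k).
Local Notation A := (iter_band (endo g) n).
Local Notation G := (tate_lie n g).
Local Notation adj := (adj_complex G).
Implicit Types (z : adj) (s : signs n) (i : 'I_n).
Local Notation ops := (tate_ops g).

Definition sign_scalar (e : option bool) : k := if e == Some true then 1 else -1.
Definition opt_sign_wt (e : option bool) i (r : 'I_n -> int) : k :=
  if e is Some b then sign_wt k b i r else 0.

Lemma tate_ops_sign s (l : seq 'I_n) z : (forall i, s i != None) ->
  tate_ops s l z = (\prod_(i <- l) sign_scalar (s i)) *:
    adj_rows g (fun r => \prod_(i <- l) opt_sign_wt (s i) i r) z.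
Proof.
move=> s0; elim: l => [|i l ih].
  rewrite big_nil scale1r -[LHS]adj_rows1; congr (adj_rows _ _ z).
  by apply/funext => r; rewrite big_nil.
have opE b y : tate_op g (Some b) i y = sign_scalar (Some b) *: adj_rows g (sign_wt k b i) y.
  by case: b; rewrite ?scale1r ?scaleN1r.
rewrite [LHS]/= {}ih; move: (s0 i); rewrite big_cons; case si: (s i) => [b|] // _.
rewrite opE (linearZZ (adj_rows g (sign_wt k b i))) (adj_rows_comp (sign_wt k b i)).
rewrite scalerA; congr (_ *: adj_rows _ _ z); apply/funext => r.
by rewrite big_cons si.
Qed.

(** On sign vectors without 0 the products are the projectors onto the 2^n orthants,
    which add up to the identity. *)
Lemma tate_ops_sum z :
  \sum_(s : signs n | sdeg s == 1%N)
     (\prod_i (if s i == Some true then 1 else -1)) *: tate_ops s (enum 'I_n) z = z.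
Proof.
rewrite (eq_bigr (fun s : signs n =>
    adj_rows g (fun r => \prod_i opt_sign_wt (s i) i r) z)); last first.
  move=> s; rewrite sdeg1 => /forallP s0; rewrite tate_ops_sign// scalerA.
  rewrite big_enum -big_split /= big1 ?scale1r => [|i _]; last first.
    by rewrite /sign_scalar; case: ifP => _; rewrite ?mulr1 ?mulrNN ?mulr1.
  by congr (adj_rows _ _ z); apply/funext => r; rewrite big_enum.
rewrite adj_rows_sum -[RHS]adj_rows1; congr (adj_rows _ _ z); apply/funext => r.
rewrite (_ : \sum_(s | _) _ = \sum_(s : {ffun 'I_n -> option bool}) \prod_i opt_sign_wt (s i) i r).
  rewrite -(bigA_distr_bigA (fun i e => opt_sign_wt e i r)) big1// => i _.
  rewrite (bigD1 None)//= add0r (bigD1 (Some true))//= (bigD1 (Some false))//= big1 ?addr0.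
    by rewrite addrC subrK.
  by case=> [[]|].
rewrite [RHS](bigID (fun s : signs n => sdeg s == 1%N)) /= [X in _ + X]big1 ?addr0// => s.
rewrite sdeg1 negb_forall => /existsP[i]; rewrite negbK => /eqP si.
by rewrite (bigD1 i)//= si mul0r.
Qed.

Lemma tate_ideal_lie pos i (x y : G) : tate_ideal pos i x -> tate_ideal pos i ⁅x, y⁆.
Proof.
move=> Jx; apply: iter_idealD; first exact: iter_ideal_mulr.
exact/iter_idealN/iter_ideal_mull.
Qed.

Lemma tate_ideal_rows pos i w (x : G) : tate_ideal pos i x -> tate_ideal pos i (rows g w x).
Proof. exact: iter_ideal_rowscale. Qed.

Lemma tate_ideal_sign_wt b i (x : G) : tate_ideal b i (rows g (sign_wt k b i) x).
Proof.
apply: rowscale_ideal => r; exists 0 => r' _; case: b; rewrite /= /sign_wt /nonneg_wt => ri.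
  by rewrite Order.POrderTheory.lt_geF.
by rewrite (_ : (0 <= r' i)%R) ?subrr//; lia.
Qed.

Definition rows_lie_ideal (J : set G) :=
  (forall x y : G, J x -> J ⁅x, y⁆) /\ (forall w x, J x -> J (rows g w x)).

Lemma adj_ideal_rows J r w z : rows_lie_ideal J ->
  adj_ideal J r z -> adj_ideal J r (adj_rows g w z).
Proof. by move=> [_ Jr]; apply: adj_ideal_map => x; apply: Jr. Qed.

Lemma tate_op_ideal J r e i z : rows_lie_ideal J -> adj_ideal J r z ->
  adj_ideal J (r - (e == None)) (tate_op g e i z).
Proof.
move=> JJ Jz; case: e => [[]|]; rewrite /= ?subn0 ?subn1.
- exact: adj_ideal_rows.
- by apply: lspanN; apply: adj_ideal_rows.
- apply: lspanB; first by apply: adj_ideal_diff; [exact: JJ.1|apply: adj_ideal_rows].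
  by apply: adj_ideal_rows => //; apply: adj_ideal_diff; first exact: JJ.1.
Qed.

Lemma adj_ideal_sign_wt b r i z : adj_ideal setT r z ->
  adj_ideal (tate_ideal b i) r (adj_rows g (sign_wt k b i) z).
Proof. by apply: adj_ideal_map => x _; apply: tate_ideal_sign_wt. Qed.

(** For the sign 0 both types of ideal are reached, since [d, p_i] is also the
    opposite of [d, 1 - p_i]. *)
Lemma tate_op_ideal_new pos r e i z : (e == Some pos) || (e == None) ->
  adj_ideal setT r z ->
  adj_ideal (tate_ideal pos i) (r - (e == None)) (tate_op g e i z).
Proof.
have JJ : rows_lie_ideal (tate_ideal pos i).
  by split=> *; [apply: tate_ideal_lie|apply: tate_ideal_rows].
have TT : adj_ideal setT r z -> adj_ideal setT r.-1 (adj_diff G z) by apply: adj_ideal_diff.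
case: e => [e|] /=.
  rewrite orbF subn0 => /eqP[->] Tz.
  by case: (pos) => /=; [|apply: lspanN]; apply: adj_ideal_sign_wt.
rewrite subn1 => _ Tz.
have -> : adj_diff G (adj_rows g (nonneg_wt k i) z) - adj_rows g (nonneg_wt k i) (adj_diff G z) =
    (if pos then 1 else -1) *: (adj_diff G (adj_rows g (sign_wt k pos i) z) -
       adj_rows g (sign_wt k pos i) (adj_diff G z)).
  case: (pos); first by rewrite scale1r.
  rewrite scaleN1r (adj_rows_compl i z) (adj_rows_compl i (adj_diff G z)).
  move: (adj_diff G) (adj_rows g (nonneg_wt k i)) => D P.
  by rewrite (linearB D) /= opprB opprB [RHS]addrC addrA subrK.
apply: lspanZ; apply: lspanB; last exact/adj_ideal_sign_wt/TT.
by apply: adj_ideal_diff; [exact: JJ.1|apply: adj_ideal_sign_wt].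
Qed.

Lemma tate_ops_ideal s pos r (l : seq 'I_n) z i : adj_ideal setT r z ->
  i \in l -> (s i == Some pos) || (s i == None) ->
  adj_ideal (tate_ideal pos i) (r - count (fun j => s j == None) l) (tate_ops s l z).
Proof.
move=> Tz; have Tops l' : adj_ideal setT (r - count (fun j => s j == None) l') (tate_ops s l' z).
  by elim: l' => [|j l' ih]; rewrite ?subn0//= addnC subnDA; apply: tate_op_ideal.
elim: l => // j l ih; rewrite inE => /orP[/eqP->|il] si /=; rewrite addnC subnDA.
  exact: tate_op_ideal_new.
apply: tate_op_ideal; last exact: ih.
by split=> *; [apply: tate_ideal_lie|apply: tate_ideal_rows].
Qed.

(** The differential of the zigzag counts the zeros to the left of the place that is
    changed, the boundary of sign vectors those to the right.  As the two counts add
    up to the number [m] of zeros, the sign binomial([m], 2) converts one into the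
    other. *)
Definition tate_zigzag z (p : nat) (s : signs n) : ext G :=
  if sdeg s == p then (-1) ^+ 'C(p.-1, 2) *: adj_to_ce G (tate_ops s (enum 'I_n) z) else 0.

Lemma tate_zigzag_system z : adj_ideal setT n z -> adj_diff G z = 0 ->
  tate_system (adj_to_ce G z) (tate_zigzag z).
Proof.
move=> Tz dz; split.
- move=> p /andP[p1 pn] s; rewrite /tate_zigzag; case: eqP => // sp i.
  have sE pos : (s i == Some pos) || (s i == None) ->
      ce_ideal (tate_ideal pos i) (n.+2 - p) ((-1) ^+ 'C(p.-1, 2) *:
        adj_to_ce G (tate_ops s (enum 'I_n) z)).
    move=> si; apply: ce_idealZ.
    have -> : (n.+2 - p = (n - count (fun j => s j == None) (enum 'I_n)).+1)%N.
      by move: sp pn; rewrite sdegE; set c := count _ _; move=> <- pn; rewrite subSS subSn.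
    by apply: adj_to_ce_ideal; apply: tate_ops_ideal => //; rewrite mem_enum.
  case si : (s i) => [pos|] /=; first by apply: sE; rewrite si eqxx.
  by split; apply: sE; rewrite si.
- rewrite /tate_bdry1 -[in RHS](tate_ops_sum z) (linear_sum (adj_to_ce G)).
  apply: eq_bigr => s sd; rewrite (linearZZ (adj_to_ce G)) /tate_zigzag sd.
  by rewrite expr0 scale1r.
- move=> p s /andP[p1 pn] sp.
  rewrite /tate_bdry {2}/tate_zigzag sp eqxx (linearZZ (ce_diff G)) -adj_to_ce_diff.
  rewrite tate_ops_diff//; last first.
    by rewrite val_enum_ord; apply: iota_ltn_sorted.
  rewrite (linear_sum (adj_to_ce G)) scaler_sumr big_enum_cond /=.
  apply: eq_bigr => i si; rewrite /tate_zigzag sdeg_szero// sp eqxx /=.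
  rewrite (linearZZ (adj_to_ce G)) !scalerA; congr (_ *: _).
  have -> : 'C(p, 2) = ('C(p.-1, 2) + p.-1)%N by rewrite -[in LHS](prednK p1) binS bin1.
  have -> : p.-1 = (#|[set j : 'I_n | (i < j)%N && (s j == None)]%SET| +
      count (fun j : 'I_n => (j < i)%N && (s j == None)) (enum 'I_n))%N.
    rewrite -sp sdegE card_ord_count -count_predUI /=.
    rewrite [X in (_ + X)%N](_ : _ = 0%N) ?addn0; last first.
      apply/eqP; rewrite -leqn0 leqNgt -has_count; apply/hasPn => j _ /=.
      by case: ltngtP => //; rewrite ?andbF.
    apply: eq_count => j /=.
    case: ltngtP => [||/val_inj ij] //=; rewrite ?orbF//.
    by apply/negbTE; rewrite ?ij // -?ij.
  rewrite exprD mulrCA -exprD; congr (_ * _).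
  by rewrite addnA addnn exprD -muln2 mulnC exprM sqrrN !expr1n mul1r.
Qed.

End System.

(** * Exactness of cubes indexed by sign vectors *)

Section SignCube.
Variables (k : fieldType) (E : lmodType k) (n : nat).
Variables (h : bool -> 'I_n -> {linear E -> E}) (X : 'I_n -> option bool -> set E).
Hypothesis hD : forall i w, h true i w + h false i w = w.
Hypothesis hK : forall b i w, h b i (h (~~ b) i w) = 0.
Hypothesis hC : forall b i c j w, h b i (h c j w) = h c j (h b i w).
Hypothesis X0 : forall i e, X i e 0.
Hypothesis XP : forall i e a u v, X i e u -> X i e v -> X i e (a *: u + v).
Hypothesis Xh : forall i e b j w, X i e w -> X i e (h b j w).
Hypothesis Xnew : forall i b w, X i (Some (~~ b)) w -> X i None (h b i w).
Hypothesis Xface : forall i b w, X i None w -> X i (Some b) w.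
Implicit Types (s : signs n) (i j : 'I_n) (f : signs n -> E).

Definition sset s i e : signs n := [ffun j => if j == i then e else s j].

Lemma ssetE s i e j : sset s i e j = if j == i then e else s j.
Proof. by rewrite ffunE. Qed.

Lemma sset_same s i e : sset s i e i = e.
Proof. by rewrite ssetE eqxx. Qed.

Lemma sset_id s i : sset s i (s i) = s.
Proof. by apply/ffunP => j; rewrite ssetE; case: eqP => // ->. Qed.

Lemma ssetK s i e e' : sset (sset s i e) i e' = sset s i e'.
Proof. by apply/ffunP => j; rewrite !ssetE; case: eqP. Qed.

Lemma ssetC s i j e e' : i != j -> sset (sset s i e) j e' = sset (sset s j e') i e.
Proof.
move=> ij; apply/ffunP => l; rewrite !ssetE; case: eqP => [->|//].
by rewrite eq_sym (negbTE ij).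
Qed.

Lemma sset_szero s i : szero s i = sset s i None. Proof. by []. Qed.

Lemma sdeg_sset s i b b' : s i = Some b -> sdeg (sset s i (Some b')) = sdeg s.
Proof.
move=> si; rewrite /sdeg; congr _.+1; apply: eq_card => j; rewrite !inE ssetE.
by case: (eqVneq j i) => [->|//]; rewrite si.
Qed.

Lemma sdeg_sset_None s i b : s i = None -> sdeg s = (sdeg (sset s i (Some b))).+1.
Proof.
move=> si; rewrite -(@sdeg_szero _ (sset s i (Some b)) i) ?sset_same//; congr sdeg.
by rewrite sset_szero ssetK -si sset_id.
Qed.

Definition cube_chain p f :=
  forall s, if sdeg s == p then forall i, X i (s i) (f s) else f s = 0.

Definition cube_sign i s : k := (-1) ^+ #|[set j : 'I_n | (i < j)%N && (s j == None)]%SET|.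

Definition cube_bdry f s : E := \sum_(i | s i != None) cube_sign i s *: f (szero s i).

Definition bool_scalar (b : bool) : k := if b then 1 else -1.

Definition cube_aug f : E :=
  \sum_(s : signs n | sdeg s == 1%N) (\prod_i (if s i == Some true then 1 else -1)) *: f s.

(** A contraction of the [i]-th direction, in which the complex is
    X_i^0 -> X_i^+ (+) X_i^-, and the projector [cube_proj] onto the image of the
    section (h^+ w, - h^- w) of the augmentation. *)
Definition cube_htpy i f s : E :=
  if s i is None then h false i (f (sset s i (Some true))) + h true i (f (sset s i (Some false)))
  else 0.

Definition cube_proj i f s : E :=
  if s i is Some b then
    bool_scalar b *: h b i (f (sset s i (Some true)) - f (sset s i (Some false)))
  else 0.

Definition no_zeros_from (m : nat) f := forall s j, (m <= j)%N -> s j = None -> f s = 0.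

Definition in_range j f := forall s b, s j = Some b -> h (~~ b) j (f s) = 0.

Lemma cube_sign_sset i s j e : j != i -> (~~ (i < j)%N) || ((s j == None) == (e == None)) ->
  cube_sign i (sset s j e) = cube_sign i s.
Proof.
move=> ji ijs; rewrite /cube_sign; congr (_ ^+ _); apply: eq_card => l.
by rewrite !inE ssetE; case: (eqVneq l j) => [->|//]; case/orP: ijs => [/negbTE->|/eqP ->].
Qed.

Lemma cube_sign_flip i s j b : (i < j)%N -> s j = None ->
  cube_sign i s = - cube_sign i (sset s j (Some b)).
Proof.
move=> ij sj; rewrite /cube_sign (cardsD1 j) inE ij sj /= exprS mulN1r; congr (- (_ ^+ _)).
apply: eq_card => l; rewrite !inE ssetE.
by case: (eqVneq l j) => [->|]; rewrite ?andbF.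
Qed.

Lemma cube_sign1 i s : (forall j : 'I_n, (i < j)%N -> s j != None) -> cube_sign i s = 1.
Proof.
move=> s0; rewrite /cube_sign (_ : [set j | _]%SET = finset.set0) ?cards0//.
apply/setP => j; rewrite !inE; apply/negP => /andP[/s0 + ]; exact/negP.
Qed.

(** The homotopy formula 1 = E + d K for a cycle.  Places are contracted from the
    last one downwards: as no 0 is left after the place [i], the signs of K are
    trivial. *)
Lemma cube_homotopy i f : no_zeros_from i.+1 f -> (forall s, cube_bdry f s = 0) ->
  forall s, f s = cube_proj i f s + cube_bdry (cube_htpy i f) s.
Proof.
move=> f0 df s.
have [[l [il sl]]|no] := pselect (exists l : 'I_n, (i < l)%N /\ s l = None).
  have f0l e e' : l != e -> f (sset (sset s e None) i e') = 0.
    move=> le; apply: (f0 _ l) => //; rewrite !ssetE (negbTE le) sl; case: (eqVneq l i) => // li.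
    by rewrite li ltnn in il.
  have f0l' e' : f (sset s i e') = 0.
    apply: (f0 _ l) => //; rewrite !ssetE sl; case: (eqVneq l i) => // li.
    by rewrite li ltnn in il.
  rewrite (f0 s l)// /cube_proj !f0l' subrr.
  rewrite [X in X + _](_ : _ = 0); last by case: (s i) => // b; rewrite linear0 scaler0.
  rewrite /cube_bdry big1 ?addr0// => j sj; rewrite /cube_htpy sset_szero.
  have lj : l != j by apply/negP => /eqP lj; rewrite -lj sl in sj.
  by rewrite !f0l// !linear0 addr0; case: (sset _ _ _ _) => [b|]; rewrite scaler0.
have nz (l : 'I_n) : (i < l)%N -> s l != None.
  by move=> il; apply/eqP => sl; apply: no; exists l.
have sgni e : cube_sign i (sset s i e) = 1.
  apply: cube_sign1 => j ij; rewrite ssetE; case: (eqVneq j i) => [ji|_]; last exact: nz.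
  by rewrite ji ltnn in ij.
rewrite /cube_proj /cube_bdry; case si : (s i) => [b|].
  rewrite (bigD1 i) ?si//= big1 => [|j /andP[sj ji]]; last first.
    by rewrite /cube_htpy sset_szero ssetE eq_sym (negbTE ji) si scaler0.
  rewrite (cube_sign1 nz) scale1r addr0 /cube_htpy sset_szero sset_same !ssetK.
  have -> : f s = f (sset s i (Some b)) by rewrite -si sset_id.
  case: (b); rewrite /bool_scalar.
    rewrite scale1r (linearB (h true i)) [h false i _ + _]addrC addrA subrK.
    by rewrite hD.
  rewrite scaleN1r (linearB (h false i)) opprB addrA subrK.
  by rewrite addrC hD.
rewrite add0r; have s0 : sset s i None = s by rewrite -[X in sset s i X]si sset_id.
have termE b : \sum_(j | s j != None) cube_sign j s *: f (sset (szero s j) i (Some b)) = f s.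
  have := df (sset s i (Some b)); rewrite /cube_bdry (bigD1 i) ?sset_same//=.
  rewrite sgni scale1r sset_szero ssetK s0 => /eqP; rewrite addr_eq0 => /eqP ->.
  rewrite -sumrN; apply: eq_big => [j|j sj].
    by rewrite ssetE; case: (eqVneq j i) => [->|]; rewrite ?si ?andbT.
  have ji : j != i by apply/negP => /eqP ji; rewrite ji si in sj.
  rewrite !sset_szero (ssetC _ _ _ ji).
  case: (ltngtP j i) => [jlti|ilt|/val_inj jj]; last by rewrite jj eqxx in ji.
    by rewrite (cube_sign_flip b jlti si) scaleNr.
  by rewrite (f0 _ j) ?scaler0 ?oppr0// !ssetE (negbTE ji) eqxx.
rewrite -[LHS](hD i) -[in X in X + _](termE false) -[in X in _ + X](termE true).
rewrite !linear_sum -big_split; apply: eq_bigr => j sj /=.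
rewrite /cube_htpy sset_szero ssetE; have -> : i == j = false.
  by apply/negP => /eqP ij; rewrite -ij si in sj.
by rewrite si !linearZ scalerDr addrC.
Qed.

Lemma cube_proj_chain p i f : cube_chain p f -> cube_chain p (cube_proj i f).
Proof.
move=> Tf s; rewrite /cube_proj; case si : (s i) => [b|]; last by case: ifP.
have ds b' := sdeg_sset b' si.
have := Tf (sset s i (Some true)); have := Tf (sset s i (Some false)).
rewrite !ds; case: eqP => [sp f1 f2 j|_ -> ->]; last by rewrite subrr linear0 scaler0.
have XZ l e a w : X l e w -> X l e (a *: w).
  by move=> Xw; rewrite -[_ *: _]addr0; apply: XP.
have XB l e u v : X l e u -> X l e v -> X l e (u - v).
  by move=> Xu Xv; rewrite addrC -scaleN1r; apply: XP.
apply: XZ; rewrite linearB; move: (f1 j) (f2 j); rewrite !ssetE.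
case: (eqVneq j i) => [ji|_] X1 X2; last by apply: XB; apply: Xh.
move: X1 X2; rewrite ji si => X1 X2; case: b {si ds} => /=; apply: XB.
- exact: Xh.
- exact/Xface/Xnew.
- exact/Xface/Xnew.
- exact: Xh.
Qed.

Lemma cube_htpy_chain p i f : cube_chain p f -> cube_chain p.+1 (cube_htpy i f).
Proof.
move=> Tf s; rewrite /cube_htpy; case si : (s i) => [b|]; first by case: ifP.
have ds b := sdeg_sset_None b si.
have := Tf (sset s i (Some true)); have := Tf (sset s i (Some false)).
rewrite (ds true) eqSS -[sdeg (sset s i (Some true))]/(sdeg _).
have -> : sdeg (sset s i (Some false)) = sdeg (sset s i (Some true)).
  by apply: succn_inj; rewrite -(ds true) -(ds false).
case: eqP => [sp f1 f2 j|_ -> ->]; last by rewrite !linear0 addr0.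
have XD l e u v : X l e u -> X l e v -> X l e (u + v).
  by move=> Xu Xv; rewrite -[u]scale1r; apply: XP.
move: (f1 j) (f2 j); rewrite !ssetE.
case: (eqVneq j i) => [ji|_] X1 X2; last by apply: XD; apply: Xh.
by move: X1 X2; rewrite ji si => X1 X2; apply: XD; apply: Xnew.
Qed.

Lemma cube_proj_bdry i f : (forall s, cube_bdry f s = 0) ->
  forall s, cube_bdry (cube_proj i f) s = 0.
Proof.
move=> df s; rewrite /cube_bdry; case si : (s i) => [b|]; last first.
  apply: big1 => j sj; rewrite /cube_proj sset_szero ssetE.
  by have -> : i == j = false; [apply/negP => /eqP ij; rewrite -ij si in sj|rewrite si scaler0].
rewrite (bigD1 i) ?si//= {1}/cube_proj sset_szero sset_same scaler0 add0r.
have termE b' : \sum_(j | (s j != None) && (j != i))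
    cube_sign j s *: f (sset (szero s j) i (Some b')) = - cube_sign i s *: f (szero s i).
  have := df (sset s i (Some b')); rewrite /cube_bdry (bigD1 i) ?sset_same//= addrC.
  rewrite sset_szero ssetK (_ : cube_sign i (sset s i _) = cube_sign i s); last first.
    rewrite /cube_sign; congr (_ ^+ _); apply: eq_card => l; rewrite !inE ssetE.
    by case: (eqVneq l i) => [->|//]; rewrite ltnn.
  move/eqP; rewrite addr_eq0 -scaleNr -sset_szero => /eqP <-; apply: eq_big => [j|j /andP[sj ji]].
    by rewrite ssetE; case: (eqVneq j i) => [->|]; rewrite ?andbF.
  rewrite !sset_szero (ssetC _ _ _ ji) cube_sign_sset// 1?eq_sym//.
  by rewrite si orbT.
transitivity (bool_scalar b *: h b i (\sum_(j | (s j != None) && (j != i))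
    cube_sign j s *: f (sset (szero s j) i (Some true)) - \sum_(j | (s j != None) && (j != i))
    cube_sign j s *: f (sset (szero s j) i (Some false)))); last first.
  by rewrite !termE subrr linear0 scaler0.
rewrite -sumrB linear_sum scaler_sumr; apply: eq_bigr => j /andP[_ ji].
rewrite /cube_proj sset_szero ssetE eq_sym (negbTE ji) si -scalerBr.
by rewrite (linearZZ (h b i)) !scalerA mulrC.
Qed.

Lemma cube_proj_zeros m i f : no_zeros_from m.+1 f -> m = i :> nat ->
  no_zeros_from m (cube_proj i f).
Proof.
move=> f0 mi s j; rewrite leq_eqVlt /cube_proj => /orP[/eqP mj sj|mj sj].
  by have -> : i = j; [apply: val_inj; rewrite /= -mi|rewrite sj].
case: (s i) => // b.
have f0' e : f (sset s i e) = 0.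
  apply: (f0 _ j) => //; rewrite ssetE; case: (eqVneq j i) => // ji.
  by rewrite mi ji ltnn in mj.
by rewrite !f0' subrr linear0 scaler0.
Qed.

Lemma cube_proj_range i f : in_range i (cube_proj i f).
Proof.
move=> s b si; rewrite /cube_proj si (linearZZ (h (~~ b) i)).
by have := hK (~~ b) i; rewrite negbK => ->; rewrite scaler0.
Qed.

Lemma cube_proj_range_other i j f : in_range j f -> in_range j (cube_proj i f).
Proof.
case: (eqVneq i j) => [->|ij]; first by move=> _; apply: cube_proj_range.
move=> fr s b sj; rewrite /cube_proj; case: (s i) => [c|]; last exact: linear0.
rewrite linearZ /= hC linearB /= !fr ?ssetE; last 2 first.
- by rewrite eq_sym (negbTE ij).
- by rewrite eq_sym (negbTE ij).
by rewrite subrr linear0 scaler0.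
Qed.

(** The terms at [s] and at [s] with the opposite sign in the [i]-th place enter the
    augmentation with opposite scalars; the pairing shows that [cube_proj] does not
    change it. *)
Lemma cube_sum_split i (F : signs n -> E) :
  \sum_(s : signs n | sdeg s == 1%N) F s =
  \sum_(s : signs n | (sdeg s == 1%N) && (s i == Some true)) (F s + F (sset s i (Some false))).
Proof.
rewrite (bigID (fun s : signs n => s i == Some true)) big_split /=; congr (_ + _).
rewrite (reindex_onto (fun s => sset s i (Some false)) (fun s => sset s i (Some true))) /=.
  apply: eq_bigl => s; rewrite ssetK sset_same andbT.
  have [si|si] := eqVneq (s i) (Some true).
    by rewrite (sdeg_sset _ si) -{1}si sset_id eqxx.
  rewrite andbF; apply/negbTE; rewrite negb_and; apply/orP; right.
  by apply/negP => /eqP ss; rewrite -ss sset_same eqxx in si.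
move=> s /andP[]; rewrite sdeg1 => /forallP/(_ i) si st; rewrite ssetK.
have -> : Some false = s i by case: (s i) si st => [[]|].
exact: sset_id.
Qed.

Lemma cube_proj_aug i f : cube_aug (cube_proj i f) = cube_aug f.
Proof.
rewrite /cube_aug !(cube_sum_split i); apply: eq_bigr => s /andP[_ /eqP si].
have ss : sset s i (Some true) = s by rewrite -si sset_id.
rewrite /cube_proj si sset_same !ssetK ss.
pose P := \prod_(j | j != i) (if s j == Some true then 1 else -1 : k).
have -> : \prod_j (if s j == Some true then 1 else -1 : k) = P.
  by rewrite (bigD1 i)//= si eqxx mul1r.
have -> : \prod_j (if sset s i (Some false) j == Some true then 1 else -1 : k) = - P.
  rewrite (bigD1 i)//= sset_same /= mulN1r; congr (- _); apply: eq_bigr => j ji.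
  by rewrite ssetE (negbTE ji).
by rewrite /bool_scalar !scaleNr !scale1r scalerN opprK -scalerDr hD scalerBr.
Qed.

Lemma cube_reduce p f m : (m <= n)%N -> cube_chain p f -> (forall s, cube_bdry f s = 0) ->
  exists f' eta, [/\ cube_chain p f', cube_chain p.+1 eta,
     forall s, f s = f' s + cube_bdry eta s & [/\ forall s, cube_bdry f' s = 0,
     no_zeros_from (n - m) f', forall j : 'I_n, (n - m <= j)%N -> in_range j f' &
     cube_aug f' = cube_aug f]].
Proof.
move=> + Tf df; elim: m => [|m ih] mn.
  exists f, (fun=> 0); split => //.
  - by move=> s; case: ifP.
  - by move=> s; rewrite /cube_bdry big1 ?addr0// => i _; rewrite scaler0.
  - by split => // [s|] j; rewrite subn0 leqNgt ltn_ord.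
have [f' [eta [Tf' Teta fE [df' zf' rf' af']]]] := ih (ltnW mn).
have im : (n - m.+1 < n)%N by lia.
pose i := Ordinal im.
have nm : (n - m = (n - m.+1).+1)%N by lia.
rewrite nm in zf' rf'.
exists (cube_proj i f'), (fun s => cube_htpy i f' s + eta s); split.
- exact: cube_proj_chain.
- move=> s; have := cube_htpy_chain i Tf' s; have := Teta s; case: ifP => _.
    by move=> X1 X2 j; rewrite -[cube_htpy _ _ _]scale1r; apply: XP.
  by move=> -> ->; rewrite addr0.
- move=> s; rewrite fE (cube_homotopy (i := i) zf' df' s) -addrA; congr (_ + _).
  by rewrite /cube_bdry -big_split; apply: eq_bigr => j _; rewrite scalerDr.
- split; first exact: cube_proj_bdry.
  + exact: cube_proj_zeros.
  + move=> j; rewrite leq_eqVlt => /orP[/eqP ij|ij].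
      by have -> : j = i; [apply: val_inj|apply: cube_proj_range].
    exact/cube_proj_range_other/rf'.
  + by rewrite cube_proj_aug.
Qed.

(** After all places have been projected, the term at [s] lies in the image of the
    orthogonal projector onto the orthant [s]; the augmentation is then a sum of
    independent terms. *)
Lemma cube_aug_inj f : cube_chain 1 f -> (forall j, in_range j f) -> cube_aug f = 0 ->
  forall s, f s = 0.
Proof.
move=> Tf rf af s; have [sd|sd] := boolP (sdeg s == 1%N); last first.
  by have := Tf s; rewrite (negbTE sd).
pose ho i : {linear E -> E} := if s i is Some b then h b i else idfun.
pose U (l : seq 'I_n) : {linear E -> E} :=
  foldr (fun i (F : {linear E -> E}) => ho i \o F : {linear E -> E}) (idfun : {linear E -> E}) l.
have UE l s' : sdeg s' == 1%N ->
    U l (f s') = if all (fun i => s i == s' i) l then f s' else 0.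
  move=> sd'; elim: l => //= i l ->; rewrite /ho.
  move: sd sd'; rewrite !sdeg1 => /forallP/(_ i) si /forallP/(_ i) si'.
  case sib : (s i) si => [b|] // _; case sib' : (s' i) si' => [b'|] // _.
  case: ifP => _; rewrite ?andbT ?andbF ?linear0//.
  have := rf i s' b' sib'; case: eqP => [[<-] h0|bb' h0].
    by rewrite -[RHS](hD i); case: (b) h0 => /= ->; rewrite ?addr0 ?add0r.
  by rewrite -h0; case: (b) (b') bb' => [] [].
have : U (enum 'I_n) (cube_aug f) = 0 by rewrite af linear0.
rewrite /cube_aug linear_sum (bigD1 s sd) /= [X in _ + X]big1 => [|s' /andP[sd' ss']]; last first.
  rewrite linearZ /= UE// ifF ?scaler0//; apply/negbTE/negP => /allP ssE.
  by case/eqP: ss'; apply/ffunP => i; rewrite (eqP (ssE i _))// mem_enum.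
rewrite addr0 linearZ /= UE// ifT; last by apply/allP.
move/eqP; rewrite scaler_eq0 => /orP[|/eqP//].
rewrite prodf_seq_eq0 => /hasP[i _] /=; case: ifP => _; rewrite ?oppr_eq0 oner_eq0.
all: by [].
Qed.

(** A cycle is homologous to its projection in all places.  That projection vanishes
    at sign vectors with a 0, hence altogether if [p > 1]. *)
Lemma cube_exact p f : (0 < p)%N -> cube_chain p f -> (forall s, cube_bdry f s = 0) ->
  (p = 1%N -> cube_aug f = 0) ->
  exists2 eta, cube_chain p.+1 eta & forall s, f s = cube_bdry eta s.
Proof.
move=> p0 Tf df af; have [f' [eta [Tf' Teta fE [df' zf' rf' af']]]] := cube_reduce (leqnn n) Tf df.
exists eta => // s; rewrite fE -[RHS]add0r; congr (_ + _).
have [sp|sp] := eqVneq (sdeg s) p; last by have := Tf' s; rewrite (negbTE sp).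
have [p1|p1] := eqVneq p 1%N.
  move: Tf'; rewrite p1 => Tf'; apply: cube_aug_inj => // [j|]; last by rewrite af' af.
  by apply: rf'; rewrite subnn.
have : sdeg s != 1%N by rewrite sp.
rewrite sdeg1 negb_forall => /existsP[i]; rewrite negbK => /eqP si.
by apply: (zf' s i) => //; rewrite subnn.
Qed.

End SignCube.

(** * Exactness of the wedge complexes *)

Lemma ext_map_comp (k : fieldType) (V : lmodType k) (F F' H : {linear V -> V}) w :
  (forall x, F (F' x) = H x) -> ext_map F (ext_map F' w) = ext_map H w.
Proof.
move=> FF; pose K : {linear ext V -> ext V} := ext_map F \o ext_map F'.
rewrite -[LHS]/(K w); move: w; apply: ext_ext => s.
rewrite -[LHS]/(ext_map F (ext_map F' (wedge s))) (ext_mapE F' s) (ext_mapE F) (ext_mapE H).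
by rewrite -map_comp; congr wedge; apply: eq_map.
Qed.

Section WedgeExact.
Variables (k : fieldType) (n : nat) (g : finLieAlgType k).
Local Notation G := (tate_lie n g).
Implicit Types (w : ext G) (i : 'I_n) (s : signs n).

(** The exterior power of 1 - p_i and its complement.  Multiplying a single letter by
    p_i is not well defined on wedges, but these commuting orthogonal idempotents
    are: the first makes all letters lie in I_i^-, and the second is a sum of wedges
    with at least one letter in I_i^+. *)
Definition neg_part i : {linear ext G -> ext G} := ext_map (rows g (sign_wt k false i)).

Definition pos_part i : {linear ext G -> ext G} := idfun \- neg_part i.

Definition sign_part (b : bool) i : {linear ext G -> ext G} :=
  if b then pos_part i else neg_part i.

Lemma sign_part_pos i w : sign_part true i w = w - neg_part i w. Proof. by []. Qed.
Lemma sign_part_neg i w : sign_part false i w = neg_part i w. Proof. by []. Qed.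

Lemma sign_wt_idem b i r : sign_wt k b i r * sign_wt k b i r = sign_wt k b i r.
Proof.
case: b; rewrite /sign_wt /nonneg_wt; case: (0 <= r i)%R;
  by rewrite ?subrr ?subr0 ?mul0r ?mulr1.
Qed.

Lemma neg_part_idem i w : neg_part i (neg_part i w) = neg_part i w.
Proof.
apply: ext_map_comp => x; rewrite /rows /= rowscale_comp.
congr (rowscale _ (x : iter_band (endo g) n)).
by apply/funext => r; apply: sign_wt_idem.
Qed.

Lemma neg_partC i j w : neg_part i (neg_part j w) = neg_part j (neg_part i w).
Proof.
have mid x : rows g (sign_wt k false i) (rows g (sign_wt k false j) x) =
    rows g (fun r => sign_wt k false i r * sign_wt k false j r) x.
  exact: rowscale_comp.
have mid' x : rows g (sign_wt k false j) (rows g (sign_wt k false i) x) =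
    rows g (fun r => sign_wt k false i r * sign_wt k false j r) x.
  rewrite -mid; exact: rowscaleC.
by rewrite /neg_part (ext_map_comp w mid) (ext_map_comp w mid').
Qed.

Lemma sign_partD i w : sign_part true i w + sign_part false i w = w.
Proof. exact: subrK. Qed.

Lemma sign_partK b i w : sign_part b i (sign_part (~~ b) i w) = 0.
Proof.
case: b; first by rewrite sign_part_pos sign_part_neg neg_part_idem subrr.
by rewrite sign_part_neg sign_part_pos (linearB (neg_part i)) /= neg_part_idem subrr.
Qed.

Lemma sign_partC b i c j w :
  sign_part b i (sign_part c j w) = sign_part c j (sign_part b i w).
Proof.
have NC := neg_partC; move: (@neg_part) sign_part_pos sign_part_neg NC => N hT hF NC.
case: b; case: c; rewrite ?hT ?hF ?hT ?hF.
- rewrite (linearB (N i)) (linearB (N j)) NC !opprB !addrA.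
  by rewrite [LHS](ACl (1*4*3*2)%AC).
- by rewrite (linearB (N j)) NC.
- by rewrite (linearB (N i)) NC.
- exact: NC.
Qed.

Lemma tate_X0 i e r : tate_X (g := g) i e r 0.
Proof. by case: e => [b|] /=; [|split]; apply: ce_ideal0. Qed.

Lemma tate_XP i e r a u v : tate_X (g := g) i e r u -> tate_X i e r v -> tate_X i e r (a *: u + v).
Proof.
case: e => [b|] /=; first exact: ce_idealP.
by move=> [u1 u2] [v1 v2]; split; apply: ce_idealP.
Qed.

Lemma tate_X_ideal r i e w : (forall b, (e == Some b) || (e == None) ->
  ce_ideal (tate_ideal b i) r w) -> tate_X (g := g) i e r w.
Proof.
by move=> eb; case: e eb => [b|] eb /=; [apply: eb; rewrite eqxx|split; apply: eb].
Qed.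

Lemma tate_ideal_X b r i e w : (e == Some b) || (e == None) ->
  tate_X (g := g) i e r w -> ce_ideal (tate_ideal b i) r w.
Proof.
by case: e => [c|] /=; [rewrite orbF => /eqP[->]|case: b => _ []].
Qed.

Lemma neg_part_ideal b r i j w :
  ce_ideal (tate_ideal b j) r w -> ce_ideal (tate_ideal b j) r (neg_part i w).
Proof. by apply: ce_ideal_map => x; apply: tate_ideal_rows. Qed.

Lemma sign_part_ideal b r i j c w :
  ce_ideal (tate_ideal b j) r w -> ce_ideal (tate_ideal b j) r (sign_part c i w).
Proof.
move=> Jw; case: c; last exact: neg_part_ideal.
by rewrite sign_part_pos; apply: ce_idealB => //; apply: neg_part_ideal.
Qed.

Lemma sign_part_X r i e b j w : tate_X i e r w -> tate_X i e r (sign_part b j w).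
Proof.
by move=> Xw; apply: tate_X_ideal => c ec; apply: sign_part_ideal; apply: tate_ideal_X Xw.
Qed.

Lemma sign_part_new r i b (J : set G) w : ce_ideal J r.+1 w ->
  ce_ideal (tate_ideal b i) r.+1 (sign_part b i w).
Proof.
move=> Jw; case: b; last by apply: ce_ideal_map Jw => x _; apply: tate_ideal_sign_wt.
rewrite sign_part_pos; apply: ext_map_sub; last by apply: ce_idealS Jw.
move=> x; have := tate_ideal_sign_wt true i (x : G); rewrite /= /rows /= => Jx.
have -> : x - rowscale (sign_wt k false i) x =
    rowscale (sign_wt k true i) (x : iter_band (endo g) n).
  apply/eqP; rewrite subr_eq -rowscaleD -[X in X == _]rowscale1; apply/eqP.
  by congr (rowscale _ _); apply/funext => r'; rewrite /sign_wt addrC subrK.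
exact: Jx.
Qed.

Lemma sign_part_X_new r i b w : tate_X i (Some (~~ b)) r.+1 w ->
  tate_X i None r.+1 (sign_part b i w).
Proof.
move=> Xw; apply: tate_X_ideal => c _; have [->|cb] := eqVneq c b.
  exact: sign_part_new Xw.
by apply: sign_part_ideal; have -> : c = ~~ b by move: cb; case: (c) (b) => [] [].
Qed.

Lemma tate_X_face r i b w : tate_X i None r w -> tate_X (g := g) i (Some b) r w.
Proof. by case: b => -[]. Qed.

Lemma tate_exact p r f : (0 < p)%N -> tate_T p r.+1 f ->
  (forall s, tate_bdry (g := g) f s = 0) -> (p = 1%N -> tate_bdry1 f = 0) ->
  exists2 eta, tate_T p.+1 r.+1 eta & forall s, f s = tate_bdry eta s.
Proof.
apply: (@cube_exact k _ n sign_part (fun i e => @tate_X k n g i e r.+1)).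
- exact: sign_partD.
- exact: sign_partK.
- exact: sign_partC.
- by move=> i e; apply: tate_X0.
- by move=> i e a u v; apply: tate_XP.
- by move=> i e b j w; apply: sign_part_X.
- by move=> i b w; apply: sign_part_X_new.
- by move=> i b w; apply: tate_X_face.
Qed.

End WedgeExact.

(** * The trace kills boundaries *)

Section EndoTrace.
Variables (k : fieldType) (V : vectType k).

Lemma endo_trace_linear : linear (@endo_trace k V : endo V -> k^o).
Proof.
move=> a f h; rewrite /endo_trace.
by rewrite (passmx.mxof_linear (vbasis {:V}) (vbasis {:V}) a f h) linearP.
Qed.

HB.instance Definition _ :=
  GRing.isLinear.Build k (endo V) k^o *:%R (@endo_trace k V) endo_trace_linear.

Definition endo_tr : {linear endo V -> k^o} := @endo_trace k V.

Lemma endo_traceC (f h : endo V) : endo_tr (f ⋅ h) = endo_tr (h ⋅ f).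
Proof.
rewrite /endo_tr /=.
have bV : basis_of {:V} (vbasis {:V}) := vbasisP _.
by rewrite /endo_trace !(passmx.mxof_comp _ _ bV) mxtrace_mulC.
Qed.

End EndoTrace.

Arguments endo_tr {k} V.

Lemma tate_tauE (k : fieldType) (n : nat) (g : finLieAlgType k) (x : iter_band (endo g) n) :
  tate_tau x = endo_tr g (iter_trace x).
Proof. by []. Qed.

Section PairSpan.
Variables (k : fieldType) (n : nat) (g : finLieAlgType k).
Local Notation G := (tate_lie n g).
Implicit Types (w : ext G) (i : 'I_n) (x y : G).

Lemma wedge0 (L : lmodType k) s : wedge (0 :: s : seq L) = 0.
Proof.
have := (wedge_alternating L).1 [::] s (-1) 0 0; rewrite scaler0 addr0 scaleN1r addNr.
by [].
Qed.

(** A chain involves finitely many letters, so they have a common threshold, beyond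
    which the cut kills the whole chain. *)
Lemma ce_ideal_threshold pos i r w : ce_ideal (tate_ideal pos i) r.+1 w ->
  exists2 b, outer_only i b & forall v : ('I_n -> int) -> k,
    (forall q, (b q <= height pos (q i))%R -> v q = 0) -> ext_map (rows g v) w = 0.
Proof.
pose P u := exists2 b, outer_only i b & forall v : ('I_n -> int) -> k,
    (forall q, (b q <= height pos (q i))%R -> v q = 0) -> ext_map (rows g v) u = 0.
apply: (@lspan_min _ _ _ P) => [|a u v [b bo bE] [c co cE]|_ [x [s [Jx _ ->]]]].
- by exists (fun=> 0) => // v _; apply: (linear0 (ext_map (rows g v))).
- exists (fun q => Order.min (b q) (c q)) => [q q' qq|f fE].
    by rewrite (bo _ _ qq) (co _ _ qq).
  rewrite (linearP (ext_map (rows g f))) bE ?cE ?scaler0 ?addr0// => q bq; apply: fE.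
    by rewrite Order.TotalTheory.ge_min bq orbT.
  by rewrite Order.TotalTheory.ge_min bq.
- have [b bo bE] := iter_ideal_threshold Jx; exists b => // v vE.
  rewrite (ext_mapE (rows g v) (x :: s)) [map _ _]/= [rows g v x](_ : _ = 0) ?wedge0//.
  exact: bE.
Qed.

Definition shared (l : seq (bool * 'I_n)) x y :=
  forall c, c \in l -> tate_ideal c.1 c.2 x \/ tate_ideal c.1 c.2 y.

Lemma wedge2Dl x x' y : wedge [:: x + x'; y] = wedge [:: x; y] + wedge [:: x'; y].
Proof. by have := (wedge_alternating G).1 [::] [:: y] 1 x x'; rewrite /= !scale1r. Qed.

Lemma wedge2Dr x y y' : wedge [:: x; y + y'] = wedge [:: x; y] + wedge [:: x; y'].
Proof. by have := (wedge_alternating G).1 [:: x] [::] 1 y y'; rewrite /= !scale1r. Qed.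

(** To treat one more ideal J, cut the rows at a common threshold of the letters in J
    of an expression of [w] in J /\ G.  This splits every letter into a live part,
    inside J, and a dead part, and the wedges of two dead parts add up to 0, because
    the dead cut kills [w]. *)
Lemma shared_span (l : seq (bool * 'I_n)) w :
  lspan [set u | exists x y, u = wedge [:: x; y]] w ->
  (forall c, c \in l -> ce_ideal (tate_ideal c.1 c.2) 2 w) ->
  lspan [set u | exists x y, shared l x y /\ u = wedge [:: x; y]] w.
Proof.
move=> w2; elim: l => [|[pos i] l ih] Jw.
  by apply: lspanS w2 => _ [x [y ->]]; exists x, y; split => // c.
have {}ih : lspan [set u | exists x y, shared l x y /\ u = wedge [:: x; y]] w.
  by apply: ih => c cl; apply: Jw; rewrite inE cl orbT.
have [b bo bE] := ce_ideal_threshold (Jw (pos, i) (mem_head _ _)).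
pose live (q : 'I_n -> int) : k := (b q <= height pos (q i))%R%:R.
pose dead (q : 'I_n -> int) : k := 1 - live q.
have dead0 : ext_map (rows g dead) w = 0.
  by apply: bE => q bq; rewrite /dead /live bq subrr.
have liveJ x : tate_ideal pos i (rows g live x).
  apply: rowscale_ideal => q; exists (b q) => q' qq q'b.
  by rewrite /live -(bo _ _ qq) Order.POrderTheory.lt_geF.
have split_x x : x = rows g live x + rows g dead x.
  rewrite /rows /= -(rowscaleD live dead (x : iter_band (endo g) n)).
  rewrite -[LHS](rowscale1 (x : iter_band (endo g) n)).
  by congr (rowscale _ _); apply/funext => q; rewrite /dead addrC subrK.
rewrite -[w]subr0 -{}dead0.
pose F : {linear ext G -> ext G} := idfun \- ext_map (rows g dead).
rewrite -[w - _]/(F w); move: w ih {w2 Jw bE}.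
apply: lspan_linear => _ [x [y [xy ->]]].
rewrite -[F _]/(wedge [:: x; y] - ext_map (rows g dead) (wedge [:: x; y])) {F}.
rewrite (ext_mapE (rows g dead)) [map _ _]/=.
have -> : wedge [:: x; y] - wedge [:: rows g dead x; rows g dead y] =
    wedge [:: rows g live x; y] + wedge [:: rows g dead x; rows g live y].
  by rewrite {1}(split_x x) wedge2Dl {2}(split_x y) wedge2Dr -!addrA subrr addr0.
have old u v : tate_ideal u.1 u.2 x \/ tate_ideal u.1 u.2 y -> forall v', 
  tate_ideal u.1 u.2 (rows g v x) \/ tate_ideal u.1 u.2 (rows g v' y).
  by move=> + v' => -[]; [left|right]; apply: tate_ideal_rows.
apply: lspanD; apply: sub_lspan.
- exists (rows g live x), y; split => // c; rewrite inE => /orP[/eqP->|cl]; first by left.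
  by case: (xy c cl); [left; apply: tate_ideal_rows|right].
- exists (rows g dead x), (rows g live y); split => // c.
  rewrite inE => /orP[/eqP->|cl]; first by right.
  exact/old/xy.
Qed.

Lemma ext1_ce_diff2 x y : ext1 G (ce_diff G (wedge [:: x; y])) = ⁅y, x⁆.
Proof.
rewrite (ce_diffE [:: x; y]) /ce_term !(big_ord_recl, big_ord0) /= !addr0 !add0r.
rewrite /bump /= addn0 expr1 scaleN1r (linearN (ext1 G)) [RHS]lieC; congr (- _).
exact: eliftE.
Qed.

(** The boundary of x /\ y is a commutator, and the pairs of [shared_span] are
    traceable. *)
Lemma tate_tau_bdry w : (0 < n)%N -> (forall i, tate_X i None 2 w) ->
  trace_ideal (ext1 G (ce_diff G w) : iter_band (endo g) n) /\ tate_tau (ext1 G (ce_diff G w)) = 0.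
Proof.
move=> n0 Xw; pose P u := trace_ideal (ext1 G (ce_diff G u) : iter_band (endo g) n) /\
  tate_tau (ext1 G (ce_diff G u)) = 0.
have Jw b i : ce_ideal (tate_ideal b i) 2 w by case: b (Xw i) => -[].
apply: (@lspan_min _ _
  [set u | exists x y, shared (enum {: bool * 'I_n}) x y /\ u = wedge [:: x; y]] P).
- rewrite /P (linear0 (ce_diff G)) (linear0 (ext1 G)); split.
    by move=> pos i; apply: iter_ideal0.
  by rewrite tate_tauE iter_trace0 (linear0 (endo_tr g)).
- move=> a u v [Ju tu] [Jv tv]; rewrite /P (linearP (ce_diff G)) (linearP (ext1 G)); split.
    exact: trace_idealP.
  rewrite tate_tauE iter_traceP// (linearP (endo_tr g)).
  by rewrite -!tate_tauE tu tv scaler0 addr0.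
- move=> _ [x [y [xy ->]]]; rewrite /P ext1_ce_diff2.
  have tyx : traceable (y : iter_band (endo g) n) x.
    by move=> pos i; case: (xy (pos, i)); rewrite ?mem_enum//; [right|left].
  have txy := traceableC tyx.
  have Jyx := traceable_mul tyx; have Jxy := traceable_mul txy.
  have E : (⁅y, x⁆ : iter_band (endo g) n) =
      (-1) *: ((x : iter_band (endo g) n) ⋅ y) + (y : iter_band (endo g) n) ⋅ x.
    by rewrite scaleN1r addrC.
  rewrite [⁅y, x⁆]E; split; first exact: trace_idealP.
  rewrite tate_tauE iter_traceP// (linearP (endo_tr g)).
  by rewrite (iter_traceC (@endo_traceC k g) tyx) scaleN1r addNr.
- apply: shared_span; last by move=> c _; apply: Jw.
  apply: lspanS (Jw true (Ordinal n0)) => _ [x [s [_ s1 ->]]].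
  by case: s s1 => [|y []] // _; exists x, y.
Qed.

End PairSpan.

(** * Independence of the zigzag *)

Section Uniqueness.
Variables (k : fieldType) (n : nat) (g : finLieAlgType k).
Local Notation G := (tate_lie n g).
Implicit Types (f h : signs n -> ext G) (s : signs n).

Lemma tate_TB p r f h : tate_T p r f -> tate_T p r h -> tate_T p r (fun s => f s - h s).
Proof.
move=> Tf Th s; have := Tf s; have := Th s; case: ifP => _ => [Xh Xf i|-> ->]; last exact: subr0.
by rewrite addrC -scaleN1r; apply: tate_XP.
Qed.

Lemma tate_T_diff p r f : tate_T p r.+2 f -> tate_T p r.+1 (fun s => ce_diff G (f s)).
Proof.
move=> Tf s; have := Tf s; case: ifP => _ => [Xf i|->]; last exact: (linear0 (ce_diff G)).
apply: tate_X_ideal => b sb; apply: ce_ideal_diff; first exact: tate_ideal_lie.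
exact: tate_ideal_X (Xf i).
Qed.

Lemma tate_bdryB f h s : tate_bdry (fun s => f s - h s) s = tate_bdry f s - tate_bdry h s.
Proof. by rewrite /tate_bdry -sumrB; apply: eq_bigr => i _; rewrite scalerBr. Qed.

Lemma tate_bdry_diff f s : tate_bdry (fun s => ce_diff G (f s)) s = ce_diff G (tate_bdry f s).
Proof.
rewrite /tate_bdry (linear_sum (ce_diff G)); apply: eq_bigr => i _.
by rewrite (linearZZ (ce_diff G)).
Qed.

Lemma tate_bdry_deg p r f s : tate_T p.+1 r f -> sdeg s != p -> tate_bdry f s = 0.
Proof.
move=> Tf sp; rewrite /tate_bdry big1// => i si; have := Tf (szero s i).
by rewrite (sdeg_szero si) eqSS (negbTE sp) => ->; rewrite scaler0.
Qed.

Lemma sdeg_le s : (sdeg s <= n.+1)%N.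
Proof. by rewrite /sdeg ltnS -[X in (_ <= X)%N]card_ord max_card. Qed.

Lemma sdeg_none : sdeg ([ffun=> None] : signs n) = n.+1.
Proof.
by rewrite sdegE (@eq_count _ _ predT) ?count_predT ?size_enum_ord// => i; rewrite ffunE.
Qed.

(** The usual comparison of zigzags: the difference [d] of two of them is, degree by
    degree, a Chevalley-Eilenberg boundary up to a cycle for the sign boundary, and
    this cycle bounds by exactness.  At the end there is nothing left to bound, so the
    two last terms differ by a Chevalley-Eilenberg boundary. *)
Lemma tate_system_unique theta0 theta theta' : (0 < n)%N ->
  tate_system theta0 theta -> tate_system theta0 theta' ->
  tate_tau (ext1 G (theta n.+1 [ffun=> None])) = tate_tau (ext1 G (theta' n.+1 [ffun=> None])).
Proof.
move=> n0 [T1 b1 d1] [T2 b2 d2].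
pose d p s : ext G := theta p s - theta' p s.
have Td p : (1 <= p <= n.+1)%N -> tate_T p (n.+2 - p) (d p).
  by move=> pn; apply: tate_TB; [apply: T1|apply: T2].
have augd : tate_bdry1 (d 1%N) = 0.
  rewrite /tate_bdry1 (eq_bigr _ (fun s _ => scalerBr _ _ _)) sumrB.
  by rewrite -[X in X - _]/(tate_bdry1 _) -[X in _ - X]/(tate_bdry1 _) b1 b2 subrr.
have dd p s : (1 <= p <= n)%N -> sdeg s = p -> tate_bdry (d p.+1) s = ce_diff G (d p s).
  by move=> pn sp; rewrite tate_bdryB d1// d2// (linearB (ce_diff G)).
have main p : (1 <= p <= n.+1)%N -> exists eta, [/\ tate_T p (n.+3 - p) eta,
    forall s, tate_bdry (fun s => d p s - ce_diff G (eta s)) s = 0 &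
    p = 1%N -> forall s, eta s = 0].
  elim: p => // p ih /andP[_]; rewrite ltnS => pn.
  have [->|p0] := posnP p.
    exists (fun=> 0); split => //.
      by move=> s; case: ifP => // _ i; apply: tate_X0.
    move=> s; rewrite tate_bdryB tate_bdry_diff.
    rewrite [tate_bdry (fun=> 0) s](_ : _ = 0); last first.
      by rewrite /tate_bdry big1// => i _; rewrite scaler0.
    by rewrite (linear0 (ce_diff G)) subr0 (@tate_bdry_deg 0 n.+1)//; apply: (Td 1%N).
  have pn' : (1 <= p <= n.+1)%N by rewrite p0 leqW.
  have [eta [Teta ceta eta0]] := ih pn'.
  have e1 : (n.+3 - p = (n - p).+3)%N by lia.
  have e2 : (n.+2 - p = (n - p).+2)%N by lia.
  have Te : tate_T p (n - p).+2 (fun s => d p s - ce_diff G (eta s)).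
    apply: tate_TB; first by rewrite -e2; apply: Td.
    by apply: tate_T_diff; rewrite -e1.
  have aug : p = 1%N -> tate_bdry1 (fun s => d p s - ce_diff G (eta s)) = 0.
    move=> p1; rewrite -[RHS]augd /tate_bdry1; apply: eq_bigr => s _.
    by rewrite eta0// (linear0 (ce_diff G)) subr0 p1.
  have [eta' Teta' etaE] := tate_exact p0 Te ceta aug.
  exists eta'; split; last by case=> p1; rewrite p1 in p0.
    by rewrite (_ : (n.+3 - p.+1 = (n - p).+2)%N)//; lia.
  move=> s; rewrite tate_bdryB tate_bdry_diff -etaE.
  have [sp|sp] := eqVneq (sdeg s) p.
    rewrite dd ?p0// (linearB (ce_diff G) (d p s)) (ce_diff_square (eta s)) subr0 subrr.
    by [].
  have pn1 : (1 <= p.+1 <= n.+1)%N by [].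
  rewrite (tate_bdry_deg (Td _ pn1) sp).
  have := Te s; rewrite (negbTE sp) => ->; rewrite (linear0 (ce_diff G)) subr0.
  by [].
have [|eta [Teta ceta eta1]] := main n.+1; first by rewrite leqnn.
have Te : tate_T n.+1 1 (fun s => d n.+1 s - ce_diff G (eta s)).
  apply: tate_TB; first by have := Td n.+1; rewrite subSS subSnn; apply; rewrite leqnn.
  by apply: tate_T_diff; move: Teta; rewrite !subSS subSn// subSnn.
have [|eta' Teta' etaE] := tate_exact (ltn0Sn n) Te ceta.
  by move=> n1; move: n0; rewrite -ltnS n1.
set s0 : signs n := [ffun=> None].
have dE : theta n.+1 s0 = ce_diff G (eta s0) + theta' n.+1 s0.
  have : d n.+1 s0 - ce_diff G (eta s0) = 0.
    rewrite etaE /tate_bdry big1// => i _; have := Teta' (szero s0 i).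
    rewrite ifF => [->|]; first by rewrite scaler0.
    by apply/eqP => sE; have := sdeg_le (szero s0 i); rewrite sE ltnn.
  by move/eqP; rewrite subr_eq0 /d subr_eq => /eqP.
have Xeta i : tate_X i None 2 (eta s0).
  by have := Teta s0; rewrite sdeg_none eqxx => /(_ i); rewrite ffunE !subSS subSn// subSnn.
have [Jeta teta] := tate_tau_bdry n0 Xeta.
have Jth : trace_ideal (ext1 G (theta' n.+1 s0) : iter_band (endo g) n).
  have X i : tate_X i None 1 (theta' n.+1 s0).
    have := T2 n.+1; rewrite leqnn subSS subSnn => /(_ isT s0).
    by rewrite sdeg_none eqxx => /(_ i); rewrite ffunE.
  move=> b i; have : ce_ideal (tate_ideal b i) 1 (theta' n.+1 s0) by case: b (X i) => -[].
  apply: (@lspan_min _ _ _ (fun u => iter_ideal b i (ext1 G u : iter_band (endo g) n))).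
  - rewrite (linear0 (ext1 G)); exact: iter_ideal0.
  - by move=> a u v Ju Jv; rewrite (linearP (ext1 G)); apply: iter_idealP.
  - move=> _ [x [[|y s] [Jx // _ ->]]].
    have -> : ext1 G (wedge [:: x]) = x by exact: eliftE.
    exact: Jx.
rewrite dE (linearD (ext1 G)) tate_tauE.
have -> : ext1 G (ce_diff G (eta s0)) + ext1 G (theta' n.+1 s0) =
    1 *: (ext1 G (ce_diff G (eta s0)) : iter_band (endo g) n) + ext1 G (theta' n.+1 s0).
  by rewrite scale1r.
rewrite iter_traceP// (linearP (endo_tr g)) -!tate_tauE teta scaler0 add0r.
by [].
Qed.

End Uniqueness.

(** * The end of the zigzag as an antisymmetrised product *)

Section LiftPerm.

Lemma reindex_lift_perm (R : Type) (idx : R) (op : Monoid.com_law idx) m (i j : 'I_m.+1)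
    (F : 'S_m.+1 -> R) :
  \big[op/idx]_(s : 'S_m.+1 | s i == j) F s = \big[op/idx]_(s : 'S_m) F (lift_perm i j s).
Proof.
pose low (s : 'S_m.+1) k := odflt k (unlift (s i) (s (lift i k))).
have lowK (s : 'S_m.+1) k : lift (s i) (low s k) = s (lift i k).
  rewrite /low; case: unliftP => [k' //|/perm_inj/esym/eqP].
  by rewrite (negbTE (neq_lift _ _)).
have low_inj (s : 'S_m.+1) : injective (low s).
  by move=> k k' kk'; apply: (@lift_inj _ i); apply: (@perm_inj _ s); rewrite -!lowK kk'.
rewrite (reindex (lift_perm i j)) /=.
  by apply: eq_bigl => s; rewrite lift_perm_id eqxx.
exists (fun s => perm (@low_inj s)) => [s _|s /eqP sij]; apply/permP => k.
  rewrite permE; apply: (@lift_inj _ (lift_perm i j s i)).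
  by rewrite lowK lift_perm_lift lift_perm_id.
case: (unliftP i k) => [k' ->|->]; last by rewrite lift_perm_id.
by rewrite lift_perm_lift permE -sij lowK.
Qed.

(** Expansion of a sum over permutations along the value at [i], as for the cofactors
    of a determinant. *)
Lemma sum_lift_perm (V : nmodType) m (i : 'I_m.+1) (F : 'S_m.+1 -> V) :
  \sum_(s : 'S_m.+1) F s = \sum_j \sum_(s : 'S_m) F (lift_perm i j s).
Proof.
rewrite (partition_big (fun s : 'S_m.+1 => s i) predT)//=.
by apply: eq_bigr => j _; apply: reindex_lift_perm.
Qed.

End LiftPerm.

Section Antisymmetrized.
Variables (k : fieldType) (n : nat) (g : finLieAlgType k).
Local Notation A := (iter_band (endo g) n).
Local Notation G := (tate_lie n g).
Local Notation adj := (adj_complex G).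

Lemma tate_op_zero_tensor (i : 'I_n) (f : G) (s : seq G) :
  tate_op g None i (tensor f (wedge s)) =
  \sum_(m < size s) (-1) ^+ m.+1 *:
    tensor (cut_bracket i (s`_m : A) (f : A) : G) (wedge (delat m s)).
Proof.
rewrite tate_op_zeroE.
exact: (adj_cut_diff (P := rowscale (nonneg_wt k i)) (fun x y => rowscaleM _ x y) f s).
Qed.

Definition brackets m (ix : 'I_m -> 'I_n) (y : 'I_m -> G) (f : G) : G :=
  foldr (fun p (x : A) => cut_bracket (ix p) (y p) x) f (enum 'I_m).

Definition zero_ops m (ix : 'I_m -> 'I_n) (z : adj) : adj :=
  foldr (fun p => tate_op g None (ix p)) z (enum 'I_m).

Lemma zero_ops_linear m (ix : 'I_m -> 'I_n) : linear (zero_ops ix).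
Proof.
move=> a u v; rewrite /zero_ops; elim: (enum _) => //= p l ->.
exact: (linearP (tate_op g None (ix p))).
Qed.

HB.instance Definition _ m (ix : 'I_m -> 'I_n) :=
  GRing.isLinear.Build k adj adj *:%R (zero_ops ix) (zero_ops_linear ix).

Definition zero_opsl m (ix : 'I_m -> 'I_n) : {linear adj -> adj} := zero_ops ix.

Let widen1 m : 'I_m -> 'I_m.+1 := widen_ord (leqnSn m).

Lemma widen1E m (p : 'I_m) : widen1 p = lift ord_max p.
Proof. by apply: val_inj; apply: esym; apply: lift_max. Qed.

Lemma bracketsS m (ix : 'I_m.+1 -> 'I_n) y f :
  brackets ix y f = brackets (fun p => ix (lift ord_max p)) (fun p => y (lift ord_max p))
    (cut_bracket (ix ord_max) (y ord_max : A) (f : A) : G).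
Proof.
rewrite /brackets enum_ordSr foldr_rcons foldr_map.
elim: (enum 'I_m) => //= p l ->.
by rewrite -[widen_ord _ _]/(widen1 p) widen1E.
Qed.

Lemma zero_opsS m (ix : 'I_m.+1 -> 'I_n) z :
  zero_ops ix z = zero_opsl (fun p => ix (lift ord_max p)) (tate_op g None (ix ord_max) z).
Proof.
rewrite /zero_opsl /= /zero_ops enum_ordSr foldr_rcons foldr_map.
elim: (enum 'I_m) => //= p l ->.
by rewrite -[widen_ord _ _]/(widen1 p) widen1E.
Qed.

Lemma delat_enum m (y : 'I_m.+1 -> G) (j : 'I_m.+1) :
  delat j [seq y p | p <- enum 'I_m.+1] = [seq y (lift j p) | p <- enum 'I_m].
Proof.
have sz : size [seq y p | p <- enum 'I_m.+1] = m.+1 by rewrite size_map size_enum_ord.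
apply: (@eq_from_nth _ 0); first by rewrite size_delat ?sz// size_map size_enum_ord.
rewrite size_delat ?sz//= => p pm.
rewrite [RHS](nth_map (Ordinal pm)) ?size_enum_ord//.
have -> : nth (Ordinal pm) (enum 'I_m) p = Ordinal pm by apply: val_inj; rewrite /= nth_enum_ord.
have jm := ltn_ord j.
have nthy q (qm : (q < m.+1)%N) : [seq y p | p <- enum 'I_m.+1]`_q = y (Ordinal qm).
  rewrite (nth_map (Ordinal qm)) ?size_enum_ord//; congr y.
  by apply: val_inj; rewrite /= nth_enum_ord.
rewrite /delat nth_cat size_takel ?sz; last exact: ltnW.
case: (ltnP p j) => pj.
  rewrite nth_take// (nthy p (leqW pm)).
  by congr y; apply: val_inj; rewrite /= /bump leqNgt pj.
rewrite nth_drop addSn subnKC// (nthy p.+1 pm).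
by congr y; apply: val_inj; rewrite /= /bump pj.
Qed.

(** The operator applied first is the last one; it removes one letter [y j] with the
    sign of its position, and the expansion along the last value of the permutation
    collects these signs. *)
Lemma zero_ops_perm m (ix : 'I_m -> 'I_n) (y : 'I_m -> G) (f : G) :
  zero_ops ix (tensor f (wedge [seq y p | p <- enum 'I_m])) =
  (-1) ^+ 'C(m.+1, 2) *: \sum_(s : 'S_m) (-1) ^+ s *:
     tensor (brackets ix (fun p => y (s p)) f) (wedge [::]).
Proof.
elim: m ix y f => [|m ih] ix y f.
  rewrite scale1r (big_pred1 (1%g : 'S_0)) => [|s]; last first.
    by apply/esym/eqP/permP => -[].
  by rewrite odd_perm1 scale1r /zero_ops /brackets !enum_ord0.
rewrite zero_opsS tate_op_zero_tensor (linear_sum (zero_opsl _)) size_map size_enum_ord.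
rewrite (sum_lift_perm ord_max) scaler_sumr; apply: eq_bigr => j _.
rewrite (linearZZ (zero_opsl _)) delat_enum [zero_opsl _ _]ih.
rewrite !scaler_sumr; apply: eq_bigr => s _; rewrite !scalerA bracketsS lift_perm_id.
rewrite (nth_map j) ?size_enum_ord// nth_ord_enum.
have -> : (fun p => y (lift_perm ord_max j s (lift ord_max p))) = (fun p => y (lift j (s p))).
  by apply/funext => p; rewrite lift_perm_lift.
have -> : 'C(m.+2, 2) = ('C(m.+1, 2) + m.+1)%N by rewrite binS bin1.
move: 'C(m.+1, 2) => b; congr (_ *: _).
rewrite odd_lift_perm; move: (odd_perm s) => o.
rewrite !signr_addb (signr_odd _ (ord_max : 'I_m.+1)) (signr_odd _ j) exprD !exprS.
rewrite (_ : nat_of_ord ord_max = m)//.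
have mm : (-1) ^+ m * (-1) ^+ m = 1 :> k by rewrite -exprMn mulrNN mulr1 expr1n.
move: ((-1) ^+ m) ((-1) ^+ j) ((-1) ^+ b) ((-1) ^+ o) mm => x c d e mm.
rewrite !mulN1r !mulNr mulrN mulNr; congr (- _).
by rewrite -!mulrA (mulrA x x) mm mul1r mulrCA.
Qed.

End Antisymmetrized.

(** * The formula *)

Section BracketTrace.
Variables (k : fieldType) (n : nat) (R : assocAlgType k).
Local Notation A := (iter_band R n).
Local Notation mono := (@iter_mono k R n).

(** Each bracket keeps a monomial with product weights of this form: it puts a step
    function in its own place and shifts the weights of the other places. *)
Lemma foldr_bracket_mono (l : seq 'I_n) (c : 'I_n -> 'I_n -> int) (X : 'I_n -> R) d Z :
  uniq l ->
  exists v : 'I_n -> int -> k,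
    foldr (fun p (x : A) => cut_bracket p (mono (c p) (X p)) x) (mono d Z) l =
      rowscale (fun r => \prod_j v j (r j))
        (mono (fun j => \sum_(p <- l) c p j + d j) (foldr (fun p z => X p ⋅ z) Z l)) /\
    forall j, if j \in l then has_sum (v j) (c j j)%:~R else v j = fun=> 1.
Proof.
elim: l => [|i l ih] /= => [_|/andP[il /ih[v [vE vj]]]].
  exists (fun _ _ => 1); split => //.
  rewrite -[LHS]rowscale1; congr (rowscale _ _); first by apply/funext => r; rewrite big1.
  by congr iter_mono; apply/funext => j; rewrite big_nil add0r.
exists (fun j t => (if j == i then (0 <= t)%R%:R - (0 <= t - c i i)%R%:R else 1) * v j (t - c i j)).
split.
  rewrite vE cut_bracket_mono; congr (rowscale _ _).
    apply/funext => r; rewrite [RHS]big_split /= [X in _ = X * _](bigD1 i)//= eqxx.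
    rewrite [X in _ = _ * X * _]big1 ?mulr1//.
    by move=> j /negbTE ->.
  by congr iter_mono; apply/funext => j; rewrite big_cons addrA.
move=> j; have := vj j; rewrite inE; case: (eqVneq j i) => [->|ji] /=.
  rewrite (negbTE il) => ->; have := has_sum_step k (c i i); congr has_sum.
  by apply/funext => t; rewrite mulr1.
case: (j \in l) => [vs|->]; last by apply/funext => t; rewrite mulr1.
have := has_sum_shift (c i j) vs; congr has_sum.
by apply/funext => t; rewrite mul1r.
Qed.

End BracketTrace.

Section Formula.
Variables (k : fieldType) (n : nat) (g : finLieAlgType k).
Local Notation A := (iter_band (endo g) n).
Local Notation G := (tate_lie n g).

Lemma cut_bracket_ideal pos i j (y x : A) :
  iter_ideal pos j x -> iter_ideal pos j (cut_bracket i y x).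
Proof.
move=> Jx; apply: iter_idealD; first exact/iter_ideal_rowscale/iter_ideal_mull.
exact/iter_idealN/iter_ideal_mull/iter_ideal_rowscale.
Qed.

(** [p_i, y] = - [1 - p_i, y], and each side lies in one of the two ideals. *)
Lemma cut_bracket_new pos i (y x : A) : iter_ideal pos i (cut_bracket i y x).
Proof.
have Jsign b z : @iter_ideal k (endo g) b n i (rowscale (sign_wt k b i) z).
  exact: (tate_ideal_sign_wt b i (z : G)).
have E : cut_bracket i y x = (if pos then 1 else -1) *:
    (rowscale (sign_wt k pos i) (y ⋅ x) - y ⋅ rowscale (sign_wt k pos i) x).
  have compl z : rowscale (sign_wt k false i) z = z - rowscale (nonneg_wt k i) z.
    apply/eqP; rewrite eq_sym subr_eq -rowscaleD -[X in X == _]rowscale1; apply/eqP.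
    by congr (rowscale _ _); apply/funext => r; rewrite subrK.
  case: (pos); first by rewrite scale1r.
  rewrite scaleN1r !compl amulBr opprB opprB [RHS]addrC addrA subrK.
  by [].
rewrite E -[_ *: _]addr0; apply: iter_idealP; last exact: iter_ideal0.
by apply: iter_idealD; [|apply/iter_idealN/iter_ideal_mull].
Qed.

Lemma brackets_trace_ideal (y : 'I_n -> G) (f : G) :
  trace_ideal (brackets id y f : A).
Proof.
move=> pos i; rewrite /brackets; have : i \in enum 'I_n by rewrite mem_enum.
elim: (enum 'I_n) => //= p l ih; rewrite inE => /orP[/eqP <-|/ih Ji].
  exact: cut_bracket_new.
exact: cut_bracket_ideal.
Qed.

Lemma tate_embed_mono (c : {ffun 'I_n -> int}) (Y : g) :
  tate_embed n g (lmono c Y) = iter_mono c (ad Y).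
Proof. exact: fs_sum_single. Qed.

Lemma adE (x y : g) : ad x y = ⁅x, y⁆. Proof. exact: lfunE. Qed.

Lemma ad_lie (x y : g) : ad ⁅x, y⁆ = ad x ⋅ ad y - ad y ⋅ ad x :> endo g.
Proof.
by apply/lfunP => z; rewrite add_lfunE opp_lfunE !comp_lfunE !adE lie_bracket.
Qed.

Lemma tate_embed_lie (x y : laurent n g) :
  tate_embed n g ⁅x, y⁆ = ⁅tate_embed n g x, tate_embed n g y⁆.
Proof.
have lieDr (L : lieAlgType k) (u v w : L) : ⁅u, v + w⁆ = ⁅u, v⁆ + ⁅u, w⁆.
  exact: (linearD (lie u)).
have lie0l (L : lieAlgType k) (u : L) : ⁅0, u⁆ = 0.
  by apply: (addrI ⁅0, u⁆); rewrite -lieDl !addr0.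
have lie0r (L : lieAlgType k) (u : L) : ⁅u, 0⁆ = 0 by exact: (linear0 (lie u)).
move: x; apply: fsupp_ind => [|a X x ihx]; first by rewrite lie0l !linear0 lie0l.
rewrite lieDl !(linearD (tate_embed n g)) lieDl ihx; congr (_ + _) => {ihx x}.
move: y; apply: fsupp_ind => [|b Y y ihy].
  by rewrite lie0r (linear0 (tate_embed n g)) lie0r.
rewrite lieDr !(linearD (tate_embed n g)) lieDr ihy; congr (_ + _) => {ihy y}.
rewrite [⁅(fsingle a X : laurent n g), fsingle b Y⁆](_ : _ = lmono (a + b) ⁅X, Y⁆); last first.
  exact: laurent_lie_mono.
rewrite !tate_embed_mono ad_lie (linearB (iter_mono (a + b))) /=.
rewrite -[RHS]/((iter_mono a (ad X) : A) ⋅ iter_mono b (ad Y) -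
  (iter_mono b (ad Y) : A) ⋅ iter_mono a (ad X)).
rewrite !iter_monoM; congr (iter_mono _ _ - iter_mono _ _); apply/funext => i.
  by rewrite ffunE.
by rewrite ffunE addrC.
Qed.

Lemma tau_brackets (Y : 'I_n.+1 -> g) (c : 'I_n.+1 -> {ffun 'I_n -> int}) (s : 'S_n) :
  tate_tau (brackets id
    (fun p => tate_embed n g (lmono (c (lift ord0 (s p))) (Y (lift ord0 (s p)))))
    (tate_embed n g (lmono (c ord0) (Y ord0)))) =
  if [forall i, \sum_p c p i == 0] then
    trace_form (rcons [seq Y (lift ord0 (s i)) | i <- enum 'I_n] (Y ord0)) *
      \prod_i (c (lift ord0 (s i)) i)%:~R
  else 0.
Proof.
rewrite /brackets tate_embed_mono.
rewrite (_ : foldr _ _ _ = foldr (fun p (x : A) =>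
    cut_bracket p (iter_mono (fun i => c (lift ord0 (s p)) i) (ad (Y (lift ord0 (s p))))) x)
    (iter_mono (c ord0) (ad (Y ord0))) (enum 'I_n)); last first.
  by elim: (enum 'I_n) => //= p l ->; rewrite tate_embed_mono.
have [v [-> vj]] := foldr_bracket_mono (fun p i => c (lift ord0 (s p)) i)
  (fun p => ad (Y (lift ord0 (s p))) : endo g) (c ord0) (ad (Y ord0)) (enum_uniq 'I_n).
have vs j : has_sum (v j) (c (lift ord0 (s j)) j)%:~R by have := vj j; rewrite mem_enum.
rewrite tate_tauE.
have := iter_trace_mono (endo_tr g) 1
  (fun j => \sum_(p <- enum 'I_n) c (lift ord0 (s p)) j + c ord0 j)
  (foldr (fun p z => ad (Y (lift ord0 (s p))) ⋅ z) (ad (Y ord0) : endo g) (enum 'I_n)) vs.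
rewrite (_ : (fun r => 1 * _) = (fun r => \prod_j v j (r j))); last first.
  by apply/funext => r; rewrite mul1r.
move=> ->; rewrite mul1r.
have -> : [forall i, \sum_(p <- enum 'I_n) c (lift ord0 (s p)) i + c ord0 i == 0] =
    [forall i, \sum_p c p i == 0].
  apply: eq_forallb => i; rewrite big_enum /= big_ord_recl [in RHS]addrC.
  by rewrite [in RHS](reindex_inj (@perm_inj _ s)).
case: ifP => // _; rewrite mulrC; congr (_ * _).
rewrite /trace_form foldr_rcons foldr_map.
rewrite (_ : ad (Y ord0) ⋅ (\1%VF : endo g) = ad (Y ord0)) //.
exact: comp_lfun1r.
Qed.

End Formula.

Theorem theorem3 (k : fieldType) (n : nat) (g : finLieAlgType k)
    (n_ge1 : (1 <= n)%N) (g_centreless : centreless g)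
    (theta : ext (laurent n g)) (lift_theta : adj_complex (laurent n g))
    (N : nat) (a : 'I_N -> k) (Y : 'I_N -> 'I_n.+1 -> g)
    (c : 'I_N -> 'I_n.+1 -> {ffun 'I_n -> int})
    (theta_cycle : ce_diff (laurent n g) theta = 0)
    (lift_cycle : adj_diff (laurent n g) lift_theta = 0)
    (lift_theta_lifts : adj_to_ce (laurent n g) lift_theta = theta)
    (lift_theta_terms : lift_theta = \sum_m a m *:
       tensor (lmono (c m ord0) (Y m ord0))
              (wedge [seq lmono (c m (lift ord0 p)) (Y m (lift ord0 p))
                     | p <- enum 'I_n])) :
  let theta_G := ext_map (tate_embed n g) theta in
  tate_res theta_G = [set tate_class theta_G] /\
  tate_class theta_G = \sum_m a m * tate_formula (Y m) (c m).
Proof.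
move=> theta_G; set G := tate_lie n g.
pose z : adj_complex G := adj_map (tate_embed n g) lift_theta.
pose letter m (p : 'I_n) : G := tate_embed n g (lmono (c m (lift ord0 p)) (Y m (lift ord0 p))).
pose head m : G := tate_embed n g (lmono (c m ord0) (Y m ord0)).
have zE : z = \sum_m a m *: tensor (head m) (wedge [seq letter m p | p <- enum 'I_n]).
  rewrite /z lift_theta_terms (linear_sum (adj_map _)); apply: eq_bigr => m _.
  by rewrite (linearZZ (adj_map _)) adj_mapE -map_comp.
have z_theta : adj_to_ce G z = theta_G.
  by rewrite /z adj_map_to_ce lift_theta_lifts.
have dz : adj_diff G z = 0.
  by rewrite /z (adj_map_diff (@tate_embed_lie k n g)) lift_cycle (linear0 (adj_map _)).
have Tz : adj_ideal setT n z.
  rewrite zE; apply: lspan_sum => m _; apply: lspanZ; apply: sub_lspan.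
  by exists (head m), [seq letter m p | p <- enum 'I_n]; rewrite size_map size_enum_ord.
have sys := tate_zigzag_system Tz dz; rewrite z_theta in sys.
pose val := \sum_m a m * tate_formula (Y m) (c m).
have ext1_adj (f : G) : ext1 G (adj_to_ce G (tensor f (wedge [::]))) = f.
  by rewrite (adj_to_ceE f [::]); apply: eliftE.
have valE : tate_tau (ext1 G (tate_zigzag z n.+1 [ffun=> None])) = val.
  rewrite /tate_zigzag sdeg_none eqxx [n.+1.-1]/=.
  have -> : tate_ops [ffun=> None] (enum 'I_n) z = zero_opsl g id z.
    by rewrite /tate_ops /zero_opsl /= /zero_ops; elim: (enum 'I_n) => //= p l ->; rewrite ffunE.
  rewrite zE (linear_sum (zero_opsl g id)).
  pose term m (s : 'S_n) : iter_band (endo g) n := brackets id (fun p => letter m (s p)) (head m).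
  have -> : ext1 G ((-1) ^+ 'C(n, 2) *: adj_to_ce G (\sum_m zero_opsl g id (a m *:
      tensor (head m) (wedge [seq letter m p | p <- enum 'I_n])))) =
    \sum_m \sum_(s : 'S_n) (a m * ((-1) ^+ n * (-1) ^+ s)) *: term m s :> iter_band (endo g) n.
    rewrite (linearZZ (ext1 G)) (linear_sum (adj_to_ce G)) (linear_sum (ext1 G)) scaler_sumr.
    apply: eq_bigr => m _; rewrite (linearZZ (zero_opsl g id)) (linearZZ (adj_to_ce G)).
    rewrite (linearZZ (ext1 G)) [zero_opsl g id _]zero_ops_perm (linearZZ (adj_to_ce G)).
    rewrite (linearZZ (ext1 G)) (linear_sum (adj_to_ce G)) (linear_sum (ext1 G)).
    rewrite !scaler_sumr; apply: eq_bigr => s _.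
    rewrite (linearZZ (adj_to_ce G)) (linearZZ (ext1 G)) ext1_adj !scalerA.
    (* binomial(n, 2) + binomial(n + 1, 2) = n^2 has the parity of n. *)
    congr (_ *: _); rewrite binS bin1 exprD -!mulrA mulrCA; congr (_ * _).
    rewrite !mulrA; congr (_ * _); rewrite -exprD addnn -muln2 mulnC exprM sqrrN !expr1n mul1r.
    by [].
  rewrite tate_tauE.
  have Jterm m s : trace_ideal (term m s) by apply: brackets_trace_ideal.
  have JZ b (x : iter_band (endo g) n) : trace_ideal x -> trace_ideal (b *: x).
    by move=> Jx pos i; rewrite -[_ *: _]addr0; apply: iter_idealP; [apply: Jx|apply: iter_ideal0].
  rewrite iter_trace_sum => [|m]; last by apply: trace_ideal_sum => s; apply: JZ.
  rewrite (linear_sum (endo_tr g)); apply: eq_bigr => m _.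
  rewrite iter_trace_sum => [|s]; last exact: JZ.
  rewrite (linear_sum (endo_tr g)).
  rewrite (eq_bigr (fun s : 'S_n =>
      a m * ((-1) ^+ n * ((-1) ^+ s * tate_tau (term m s))))); last first.
    move=> s _; rewrite -[_ *: _]addr0 iter_traceP//; last by move=> pos i; apply: iter_ideal0.
    by rewrite iter_trace0 addr0 (linearZZ (endo_tr g)) -tate_tauE -[LHS]/(_ * _) !mulrA.
  rewrite -mulr_sumr -mulr_sumr /tate_formula; congr (_ * _).
  rewrite (eq_bigr _ (fun s _ => congr1 _ (tau_brackets (Y m) (c m) s))).
  case: ifP => _; last by rewrite big1 ?mulr0// => s _; rewrite mulr0.
  by congr (_ * _); apply: eq_bigr => s _; rewrite mulrA.
have resE : tate_res theta_G = [set val].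
  apply/seteqP; split=> v /= => [[th sys' ->]|->].
    by rewrite -valE; apply: tate_system_unique sys' sys.
  by exists (tate_zigzag z).
have classE : tate_class theta_G = val.
  by rewrite /tate_class resE; apply: xget_unique.
by rewrite classE.
Qed.
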